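(* Assume (A1)–(A4). For $k\in\mathbb N$ let $\delta_k:=2^{-k}$ and let $\lambda_{\delta_k}:=\lim_{m\to\infty}\lambda^m_{\delta_k}$, where $\lambda^m_{\delta}$ is the (uniquely determined) constant of a solution of the one-step equation (OS) on $B_m$ with step $\delta$. Set $\lambda:=\liminf_{k\to\infty}\lambda_{\delta_k}$. If $\lambda>r(f)$, then there exists $w\in\mathcal C_b(E)$ such that \[ w(x)=\sup_{\tau\in\mathcal T_{x,b}}\ln\mathbb E_x\Big[\exp\Big(\int_0^\tau(f(X_s)-\lambda)ds+Mw(X_\tau)\Big)\Big],\qquad x\in E. \]
   Context: Setting: $X$ is a standard Feller–Markov process with values in a locally compact separable metric space $(E,\rho)$ with Borel $\sigma$-field $\mathcal E$; laws $\mathbb P_x$, expectations $\mathbb E_x$, $P_t(x,A)=\mathbb P_x[X_t\in A]$. $\mathcal C_b(E)$: bounded continuous functions. $\mathcal T_{x,b}$: $\mathbb P_x$-a.s. bounded stopping times. $U\subseteq E$ compact; $(B_m)$ compact, $U\subset B_0$, $B_m\subset B_{m+1}$, $\bigcup B_m=E$. $Mh(x):=\sup_{\xi\in U}(c(x,\xi)+h(\xi))$. $r(f):=\lim_{t\to\infty}\frac1t\ln\sup_{x}\mathbb E_x[e^{\int_0^tf(X_s)ds}]$. For $\delta>0$: $\tau_{B_m}:=\delta\inf\{k\in\mathbb N:X_{k\delta}\notin B_m\}$. (OS) on $B_m$ with step $\delta$: $\lambda^m_\delta\in\mathbb R$, $w^m_\delta$ bounded continuous on $B_m$, $w^m_\delta=Mw^m_\delta$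 off $B_m$, and for $x\in B_m$: $w^m_\delta(x)=\max\big(\ln\mathbb E_x[e^{\int_0^\delta(f(X_s)-\lambda^m_\delta)ds+1_{\{X_\delta\in B_m\}}w^m_\delta(X_\delta)+1_{\{X_\delta\notin B_m\}}Mw^m_\delta(X_\delta)}],\ Mw^m_\delta(x)\big)$. (Solutions exist, $\lambda^m_\delta$ equals the optimal value of the dyadic long-run risk-sensitive impulse control problem with obligatory impulses outside $B_m$, and is non-decreasing in $m$.) Standing assumptions: (A1) $f:E\to(-\infty,0]$ is continuous and bounded; $c:E\times U\to(-\infty,0]$ is continuous, bounded, and for some $c_0<0$: $0>c_0\ge c(x,\xi)\ge c(x,\eta)+c(\eta,\xi)$ for all $x\in E$, $\xi,\eta\in U$; moreover $\sup_{\xi\in U}|c(x,\xi)-c(y,\xi)|\to0$ as $x,y$ both tend to infinity. (A2) For every $t>0$ and $x_n\to x$: $\sup_{A\in\mathcal E}|P_t(x_n,A)-P_t(x,A)|\to0$. (A3) For every compact $\Gamma\subset E$, $t_0,r_0>0$: $\lim_{r\to\infty}M_\Gamma(t_0,r)=0$, $\lim_{t\to0}M_\Gamma(t,r_0)=0$, where $M_\Gamma(t,r):=\sup_{x\in\Gamma}\mathbb P_x[\sup_{s\le t}\rho(X_s,x)\ge r]$. (A4) For every $m$, $x\in B_m$, $\delta>0$, open $\mathcal O\subset B_m$: $\mathbb P_x[\bigcup_{i\ge1}\{X_{i\delta}\in\mathcal O\}]=1$; and $\mathbb P_x[\tau_{B_m}<\infty]=1$ for all $x\in E$, $\delta>0$,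 $m$. *)

(* Defs.v *)
From HB Require Import structures.
From mathcomp Require Import all_boot all_order all_algebra.
From mathcomp Require Import all_classical all_reals all_analysis.
Set Implicit Arguments. Unset Strict Implicit. Unset Printing Implicit Defensive.
Import Order.TTheory GRing.Theory Num.Theory.
Import numFieldNormedType.Exports.
Local Open Scope classical_set_scope.
Local Open Scope ring_scope.

Section Metric.
Context {R : realType} {E : Type} (rho : E -> E -> R).

Definition is_metric : Prop :=
  [/\ (forall x y, 0 <= rho x y),
      (forall x y, rho x y = 0 <-> x = y),
      (forall x y, rho x y = rho y x) &
      (forall x y z, rho x z <= rho x y + rho y z)].

Definition rball (x : E) (r : R) : set E := [set y | rho x y < r].

Definition ropen (A : set E) : Prop :=
  forall x, A x -> exists2 r : R, 0 < r & rball x r `<=` A.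

Definition rcompact (K : set E) : Prop :=
  forall G : set (set E), (forall A, G A -> ropen A) ->
    K `<=` \bigcup_(A in G) A ->
    exists F : set (set E), [/\ finite_set F, F `<=` G & K `<=` \bigcup_(A in F) A].

Definition rlocally_compact : Prop :=
  forall x, exists K, rcompact K /\ exists2 r : R, 0 < r & rball x r `<=` K.

Definition rseparable : Prop :=
  exists D : set E, countable D /\
    forall x (e : R), 0 < e -> exists2 y, D y & rho x y < e.

Definition rcontinuous (g : E -> R) : Prop :=
  forall x (e : R), 0 < e ->
    exists2 eta : R, 0 < eta & forall y, rho x y < eta -> `|g x - g y| < e.

Definition rcontinuous_on (A : set E) (g : E -> R) : Prop :=
  forall x (e : R), A x -> 0 < e ->
    exists2 eta : R, 0 < eta & forall y, A y -> rho x y < eta -> `|g x - g y| < e.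

Definition bnd (g : E -> R) : Prop := exists C : R, forall x, `|g x| <= C.

Definition rcvg (u : nat -> E) (x : E) : Prop :=
  forall e : R, 0 < e -> exists N, forall n, (N <= n)%N -> rho (u n) x < e.

End Metric.

Definition lcs_metric_borel {R : realType} {d : measure_display}
  (E : measurableType d) (rho : E -> E -> R) : Prop :=
  [/\ is_metric rho, rlocally_compact rho, rseparable rho &
      (@measurable _ E) = <<s [set A | ropen rho A] >>].

Section Process.
Context {R : realType} {dE dO : measure_display}
  {E : measurableType dE} {Om : measurableType dO}.
Variables (X : R -> Om -> E) (P : E -> probability Om R).

Definition Ptr (t : R) (x : E) (A : set E) : R := fine (P x (X t @^-1` A)).

Definition Ex (x : E) (g : Om -> R) : R := fine (\int[P x]_w (g w)%:E).

Definition tint (g : R -> R) (t : R) : R :=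
  fine (\int[lebesgue_measure]_(s in `[0, t]) (g s)%:E).

Variable F : R -> set (set Om).

Definition stopping_time (tau : Om -> R) : Prop :=
  (forall w, 0 <= tau w) /\ (forall t, 0 <= t -> F t [set w | tau w <= t]).

Definition F_at (tau : Om -> R) : set (set Om) :=
  [set B | measurable B /\ forall t, 0 <= t -> F t (B `&` [set w | tau w <= t])].

Definition Txb (x : E) : set (Om -> R) :=
  [set tau | stopping_time tau /\ exists T : R, {ae P x, forall w, tau w <= T}].

Variable rho : E -> E -> R.

Definition standard_feller_markov : Prop :=
      (forall t, 0 <= t -> sigma_algebra setT (F t) /\ F t `<=` measurable) /\
      (forall s t, 0 <= s -> s <= t -> F s `<=` F t) /\
      (forall t, 0 <= t -> F t = \bigcap_(s in `]t, +oo[) F s) /\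
      (forall N, measurable N -> (forall x, P x N = 0%E) ->
         forall t, 0 <= t -> F t N) /\
      (forall t A, 0 <= t -> measurable A -> F t (X t @^-1` A)) /\
      (forall x, P x [set w | X 0 w = x] = 1%E) /\
      (forall L, measurable L -> measurable_fun setT (fun x => fine (P x L))) /\
      (forall w t (e : R), 0 <= t -> 0 < e -> exists2 eta : R, 0 < eta &
         forall s, t <= s -> s < t + eta -> rho (X s w) (X t w) < e) /\
      (forall w t, 0 < t -> exists l, forall e : R, 0 < e -> exists2 eta : R, 0 < eta &
         forall s, 0 <= s -> t - eta < s -> s < t -> rho (X s w) l < e) /\
      (forall x tau t A B, stopping_time tau -> 0 <= t -> measurable A -> F_at tau B ->
         P x (B `&` [set w | A (X (tau w + t) w)])
         = (\int[P x]_(w in B) (Ptr t (X (tau w) w) A)%:E)%E) /\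
      (forall x (taun : nat -> Om -> R) tau,
         (forall n, stopping_time (taun n)) -> stopping_time tau ->
         (forall n w, taun n w <= taun n.+1 w) ->
         (forall w, (fun n => taun n w) @ \oo --> tau w) ->
         {ae P x, forall w, rcvg rho (fun n => X (taun n w) w) (X (tau w) w)}) /\
      (forall t g, 0 <= t -> rcontinuous rho g -> bnd g ->
         rcontinuous rho (fun x => Ex x (fun w => g (X t w)))).

End Process.

Definition Mop {R : realType} {E : Type} (c : E -> E -> R) (U : set E)
  (h : E -> R) (x : E) : R :=
  sup [set c x xi + h xi | xi in U].

Section Control.
Context {R : realType} {dE dO : measure_display}
  {E : measurableType dE} {Om : measurableType dO}.
Variables (X : R -> Om -> E) (P : E -> probability Om R) (rho : E -> E -> R)
  (f : E -> R) (c : E -> E -> R) (U : set E).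

(* (1/t) ln sup_x E_x[exp(int_0^t f(X_s) ds)] ; r(f) is its limit t -> oo *)
Definition rf_approx (t : R) : R :=
  t^-1 * ln (sup [set Ex P x (fun w => expR (tint (fun s => f (X s w)) t)) | x in setT]).

Definition MGamma (G : set E) (t r : R) : R :=
  sup [set fine (P x [set w | r <= sup [set rho (X s w) x | s in `[0, t]]]) | x in G].

Definition OS (B : set E) (delta lam : R) (w : E -> R) : Prop :=
  [/\ (exists C : R, forall x, B x -> `|w x| <= C),
      rcontinuous_on rho B w,
      (forall x, ~ B x -> w x = Mop c U w x) &
      (forall x, B x -> w x =
         Num.max
           (ln (Ex P x (fun om =>
              expR (tint (fun s => f (X s om) - lam) delta
                    + (if `[< B (X delta om) >] then w (X delta om)
                       else Mop c U w (X delta om))))))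
           (Mop c U w x))].

Definition stop_value (lam : R) (w : E -> R) (x : E) (tau : Om -> R) : R :=
  ln (Ex P x (fun om =>
    expR (tint (fun s => f (X s om) - lam) (tau om) + Mop c U w (X (tau om) om)))).

End Control.

(* Main.v *)
(** Write [T] for the Feynman-Kac operator of [f - lambda] over one step of a grid,
    [G = exp (Mw)] and let [W] be the supremum of the values of the optimal stopping
    problems with reward [G] over the dyadic grids.  Since [lambda > r(f)] these values
    are uniformly bounded, and discretizing a stopping time from above shows that [W]
    is also the supremum over all bounded stopping times.  Bounding a grid value by the
    expectation of the maximal reward up to a small time [t] shows that [W x] is close
    to [E_x (W (X_t))], uniformly on compact sets, so that [W] is continuous by (A2)
    and (A3).

    The constants of the one-step equation increase with [B_m] by comparison at an
    approximate maximum point, hence [lambda] is a limit of the [lambda^m_delta] along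
    an ultrafilter of pairs [(k, m)] in which [m] is as large as needed compared to [k].
    The normalized solutions [w_i] are only known to be bounded on [U], but [M w_i]
    depends on them through finitely many numbers up to a small uniform error, because
    [xi |-> c (., xi)] is continuous for the uniform norm; so [M w_i] converges
    uniformly to some [g] along the ultrafilter.  With [G = exp g], the solutions satisfy
    [w_i <= ln W + o(1)] uniformly and [ln W <= w_i + o(1)] pointwise on [U], which is
    enough to get [M (ln W) = g], that is, [ln W] is the required solution. *)

Require Import Defs.
From HB Require Import structures.
From mathcomp Require Import all_boot all_order all_algebra.
From mathcomp Require Import all_classical all_reals all_analysis.
From mathcomp Require Import measurable_realfun zify lra ring.
Set Implicit Arguments. Unset Strict Implicit. Unset Printing Implicit Defensive.
Import Order.TTheory GRing.Theory Num.Theory.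
Import numFieldNormedType.Exports.
Local Open Scope classical_set_scope.
Local Open Scope ring_scope.

(** * Bounded measurable functions and expectations *)

(** The two bounds on the solutions differ because of where the equation holds. Outside [B_m] a
    solution equals its own impulse value, so the upper inequality, [exp w] at most the maximum of
    [T (exp w)] and [exp (M w)], holds on all of [E]. Unrolled over a horizon [j] it leaves a
    remainder of order [exp (- kappa j)], where [kappa] is half the gap between [lambda] and a rate
    [mu > r(f)]; hence a bound uniform in the starting point. The lower bound rests on
    [T (exp w) <= exp w], which is known only inside [B_m]: it can be followed only until the exit
    from [B_m], and the number of grid times to be watched grows with [k]. Hence [m] has to be
    chosen after [k], and the estimate is pointwise. No modulus of continuity of the [w_i] is shown
    to survive the passage to the limit in [k]. Therefore a limit is taken of [M w_i] only, whose
    regularity comes from [c], and the continuity of the final solution is derived from the stopping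
    problem itself. *)

Definition bm {R : realType} {d} {T : measurableType d} (g : T -> R) : Prop :=
  measurable_fun setT g /\ bnd g.

Section bounded_measurable.
Context {R : realType} {d} {T : measurableType d}.
Implicit Types (u v g : T -> R).

Lemma bm_cst (a : R) : bm (fun _ : T => a).
Proof. by split; [exact: measurable_cst|exists `|a|]. Qed.

Lemma bmD u v : bm u -> bm v -> bm (fun x => u x + v x).
Proof.
move=> [mu [C uC]] [mv [D vD]]; split; first exact: measurable_funD.
by exists (C + D) => x; rewrite (le_trans (ler_normD _ _))// lerD.
Qed.

Lemma bmM u v : bm u -> bm v -> bm (fun x => u x * v x).
Proof.
move=> [mu [C uC]] [mv [D vD]]; split; first exact: measurable_funM.
by exists (C * D) => x; rewrite normrM ler_pM.
Qed.

Lemma bmZ (a : R) u : bm u -> bm (fun x => a * u x).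
Proof. by apply: bmM; exact: bm_cst. Qed.

Lemma bmN u : bm u -> bm (fun x => - u x).
Proof. by move=> /(bmZ (-1)); under eq_fun do rewrite mulN1r. Qed.

Lemma bmB u v : bm u -> bm v -> bm (fun x => u x - v x).
Proof. by move=> ? /bmN; exact: bmD. Qed.

Lemma bm_indic (A : set T) : measurable A -> bm (\1_A : T -> R).
Proof.
move=> mA; split; first exact: measurable_indic.
by exists 1 => x; rewrite indicE normr_nat; case: (_ \in _); rewrite ?ler01.
Qed.

Lemma bm_max u v : bm u -> bm v -> bm (fun x => Num.max (u x) (v x)).
Proof.
move=> [mu [C uC]] [mv [D vD]]; split; first exact: measurable_maxr.
exists (Num.max C D) => x; rewrite maxEle; case: ifP => _.
  by rewrite le_max vD orbT.
by rewrite le_max uC.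
Qed.

Lemma bm_exp u : bm u -> bm (fun x => expR (u x)).
Proof.
move=> [mu [C uC]]; split; first exact: measurableT_comp.
exists (expR C) => x; rewrite ger0_norm ?expR_ge0// ler_expR.
by rewrite (le_trans (ler_norm _)).
Qed.

Lemma bm_sum (n : nat) (u : nat -> T -> R) :
  (forall i, (i < n)%N -> bm (u i)) -> bm (fun x => \sum_(i < n) u i x).
Proof.
elim: n => [_|n ih h]; first by under eq_fun do rewrite big_ord0; exact: bm_cst.
under eq_fun do rewrite big_ord_recr/=; apply: bmD; last exact: h.
by apply: ih => i ni; apply: h; rewrite ltnS ltnW.
Qed.

Lemma measurable_ge (u : T -> R) (a : R) : measurable_fun setT u ->
  measurable [set x | a <= u x].
Proof.
move=> mu; rewrite (_ : mkset _ = setT `&` u @^-1` `[a, +oo[%classic).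
  exact: mu.
by apply/seteqP; split => x /=; rewrite in_itv/= andbT// => -[].
Qed.

Lemma sum_lt_minn (n k : nat) : (\sum_(j < n) (j < k) = minn n k)%N.
Proof.
elim: n => [|n ih]; first by rewrite big_ord0 min0n.
by rewrite big_ord_recr/= ih; lia.
Qed.

(** The sum counts the positive integers up to [y], hence is its integer part; [y <= n] ensures that
    none of them is missed. *)
Lemma staircase_approx (n : nat) (y : R) : 0 <= y <= n%:R ->
  `|y - \sum_(j < n) (j.+1%:R <= y)%R%:R| <= 1.
Proof.
move=> /andP[y0 yn].
have -> : \sum_(j < n) (j.+1%:R <= y)%R%:R = (Num.truncn y)%:R :> R.
  under eq_bigr => j _ do rewrite -truncn_ge_nat//.
  rewrite -natr_sum sum_lt_minn (minn_idPr _)//.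
  by rewrite -(ler_nat R) (le_trans _ yn)// truncn_le.
have /andP[h1 h2] := truncn_itv y0.
rewrite -natr1 in h2; rewrite ger0_norm; lra.
Qed.

(* [u] is uniformly close to staircases, which are linear combinations of the
   indicators of its superlevel sets. *)
Lemma bm_ind (Q : (T -> R) -> Prop) :
  (forall A, measurable A -> Q (\1_A)) ->
  (forall a u v, bm u -> bm v -> Q u -> Q v -> Q (fun x => a * u x + v x)) ->
  (forall u, bm u -> (forall e : R, 0 < e ->
     exists v, [/\ bm v, Q v & forall x, `|u x - v x| <= e]) -> Q u) ->
  forall u, bm u -> Q u.
Proof.
move=> Qi Ql Qu u bu; have [mu [C uC]] := bu.
have Q0 : Q (fun _ => 0).
  rewrite (_ : (fun _ => 0) = (\1_set0 : T -> R)); first exact: Qi.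
  by apply: funext => x; rewrite indicE in_set0.
have Q1 : Q (fun _ => 1).
  rewrite (_ : (fun _ => 1) = (\1_setT : T -> R)); first exact: Qi.
  by apply: funext => x; rewrite indicE in_setT.
have Qs n (v : nat -> T -> R) :
    (forall i, bm (v i)) -> (forall i, Q (v i)) -> Q (fun x => \sum_(i < n) v i x).
  move=> bv Qv; elim: n => [|n ih]; first by under eq_fun do rewrite big_ord0.
  under eq_fun do rewrite big_ord_recr/= addrC -[v _ _]mul1r.
  by apply: (Ql) => //; apply: bm_sum.
apply: Qu => // e e0.
pose D := `|C| + 1.
have D0 : 0 < D by rewrite ltr_pwDr.
have uD x : -D <= u x <= D.
  by rewrite -ler_norml (le_trans (uC x))// (le_trans (ler_norm _))// lerDl.
(* The values of [u] lie in an interval of length [2 * D]; with [n] cells the mesh is at most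
   [e]. *)
pose n := (Num.truncn (2 * D / e)).+1.
have n0 : (0 : R) < n%:R by rewrite ltr0n.
have ne : 2 * D / n%:R <= e.
  rewrite ler_pdivrMr// [e * _]mulrC -ler_pdivrMr//.
  by apply: ltW; exact: truncnS_gt.
pose y x := n%:R * ((u x + D) / (2 * D)).
pose s j x : R := \1_[set x | j.+1%:R <= y x] x.
have my : measurable_fun setT y.
  apply: measurable_funM => //; apply: measurable_funM => //.
  exact: measurable_funD.
have bs j : bm (s j) by apply: bm_indic; exact: measurable_ge.
have Qsj j : Q (s j) by apply: Qi; exact: measurable_ge.
(* The constant is written [(- D) * 1 + 0] so that closure under [a * u + v] also produces it. *)
pose v x := 2 * D / n%:R * (\sum_(j < n) s j x) + ((- D) * 1 + 0).
exists v; split.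
- apply: bmD; first by apply: bmZ; apply: bm_sum.
  exact: bm_cst.
- apply: (Ql).
  + exact: bm_sum.
  + exact: bm_cst.
  + exact: Qs.
  + by apply: (Ql) => //; exact: bm_cst.
- move=> x; have -> : u x - v x = 2 * D / n%:R * (y x - \sum_(j < n) s j x).
    rewrite /v mulrBr /y; have -> : 2 * D / n%:R * (n%:R * ((u x + D) / (2 * D))) = u x + D.
      by field; rewrite ?gt_eqF//.
    by lra.
  rewrite normrM ger0_norm; last by rewrite divr_ge0// ltW// mulr_gt0.
  rewrite (le_trans _ ne)// -[leRHS]mulr1 ler_wpM2l//.
    by rewrite divr_ge0// ltW// mulr_gt0.
  have -> : \sum_(j < n) s j x = \sum_(j < n) (j.+1%:R <= y x)%R%:R.
    apply: eq_bigr => j _; rewrite /s indicE; congr (_%:R); congr nat_of_bool.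
    by apply/idP/idP; rewrite inE.
  apply: staircase_approx; have /andP[h1 h2] := uD x.
  apply/andP; split; first by apply: mulr_ge0 => //; apply: divr_ge0; lra.
  by rewrite /y ler_piMr// ler_pdivrMr; lra.
Qed.

End bounded_measurable.

Section expectation.
Context {R : realType} {dE d} {E : measurableType dE} {Om : measurableType d}.
Variable P : E -> probability Om R.
Implicit Types (g h : Om -> R) (x : E).

Lemma bm_integrable x g : bm g -> (P x).-integrable setT (EFin \o g).
Proof.
move=> [mg [C gC]]; apply: measurable_bounded_integrable => //.
  exact: fin_num_fun_lty (fin_num_measure (P x)).
exists C; split; first by rewrite num_real.
by move=> M CM w _; exact: le_trans (gC w) (ltW CM).
Qed.

Lemma eq_Ex x g h : g =1 h -> Ex P x g = Ex P x h.
Proof. by move=> /funext ->. Qed.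

Lemma ExD x g h : bm g -> bm h ->
  Ex P x (fun w => g w + h w) = Ex P x g + Ex P x h.
Proof. by move=> bg bh; apply: RintegralD => //; exact: bm_integrable. Qed.

Lemma ExB x g h : bm g -> bm h ->
  Ex P x (fun w => g w - h w) = Ex P x g - Ex P x h.
Proof. by move=> bg bh; apply: RintegralB => //; exact: bm_integrable. Qed.

Lemma ExZ x (a : R) g : bm g -> Ex P x (fun w => a * g w) = a * Ex P x g.
Proof. by move=> bg; apply: RintegralZl => //; exact: bm_integrable. Qed.

Lemma Ex_cst x (a : R) : Ex P x (fun _ => a) = a.
Proof.
rewrite -[RHS]mulr1 -[X in a * X]/(fine 1%E) -(probability_setT (P x)).
exact: (@Rintegral_cst _ _ _ (P x) setT measurableT a).
Qed.

Lemma Ex_le x g h : bm g -> bm h -> (forall w, g w <= h w) ->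
  Ex P x g <= Ex P x h.
Proof. by move=> bg bh gh; apply: le_Rintegral => //; exact: bm_integrable. Qed.

Lemma Ex_ge0 x g : (forall w, 0 <= g w) -> 0 <= Ex P x g.
Proof. by move=> g0; apply: Rintegral_ge0. Qed.

Lemma Ex_le_cst x g (a : R) : bm g -> (forall w, g w <= a) -> Ex P x g <= a.
Proof.
move=> bg ga; rewrite -[leRHS](Ex_cst x); apply: Ex_le => //; exact: bm_cst.
Qed.

Lemma Ex_ge_cst x g (a : R) : bm g -> (forall w, a <= g w) -> a <= Ex P x g.
Proof.
move=> bg ga; rewrite -[leLHS](Ex_cst x); apply: Ex_le => //; exact: bm_cst.
Qed.

Lemma Ex_norm_le x g (a : R) : bm g -> (forall w, `|g w| <= a) -> `|Ex P x g| <= a.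
Proof.
move=> bg ga; rewrite ler_norml; apply/andP; split.
  by apply: Ex_ge_cst => // w; have := ga w; rewrite ler_norml => /andP[].
by apply: Ex_le_cst => // w; have := ga w; rewrite ler_norml => /andP[].
Qed.

Lemma Ex_indic x (A : set Om) : measurable A -> Ex P x (\1_A) = fine (P x A).
Proof. by move=> mA; rewrite /Ex integral_indic// setIT. Qed.

Lemma Ex_cvg x (g_ : nat -> Om -> R) g (C : R) :
  (forall n, measurable_fun setT (g_ n)) -> (forall n w, `|g_ n w| <= C) ->
  (forall w, g_ ^~ w @ \oo --> g w) ->
  (fun n => Ex P x (g_ n)) @ \oo --> Ex P x g.
Proof.
move=> mg gC gg.
have mgl : measurable_fun setT g by apply: (measurable_fun_cvg mg) => w _.
have bgl : bm g.
  split => //; exists C => w.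
  by apply: (@closed_cvg _ _ (\oo) _ (fun n => `|g_ n w|) (fun y => y <= C));
    [exact: closed_le|apply: nearW => n; exact: gC|apply: cvg_norm].
have [|||||_ _ h] := @dominated_convergence _ _ _ (P x) setT measurableT
  (fun n => EFin \o g_ n) (EFin \o g) (cst C%:E).
- by move=> n; exact/measurable_EFinP.
- exact/measurable_EFinP.
- by apply: aeW => w _; apply: cvg_EFin; [exact: nearW|exact: gg].
- exact: (bm_integrable x (bm_cst C)).
- by apply: aeW => w n _; rewrite /= lee_fin.
apply: fine_cvg; rewrite fineK; first exact: h.
exact: (integrable_fin_num measurableT (bm_integrable x bgl)).
Qed.

Lemma Ex_ae_eq x g h : measurable_fun setT g -> measurable_fun setT h ->
  {ae P x, forall w, g w = h w} -> Ex P x g = Ex P x h.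
Proof.
move=> mg mh gh; congr fine; apply: ae_eq_integral => //.
- exact/measurable_EFinP.
- exact/measurable_EFinP.
- by apply: filterS gh => w /= -> _.
Qed.

End expectation.

(** * Compactness and continuity for a metric *)

Section metric.
Context {R : realType} {E : Type} (rho : E -> E -> R).
Hypothesis rhoM : is_metric rho.

Lemma rho_sym x y : rho x y = rho y x.
Proof. by have [_ _ +] := rhoM. Qed.

Lemma rho_tri x y z : rho x z <= rho x y + rho y z.
Proof. by have [_ _ _] := rhoM. Qed.

Lemma rho_xx x : rho x x = 0.
Proof. by have [_ h _ _] := rhoM; apply/h. Qed.

Lemma ropen_rball x r : ropen rho (rball rho x r).
Proof.
move=> y xy; exists (r - rho x y); first by rewrite subr_gt0.
move=> z; rewrite /rball/= => yz.
by rewrite (le_lt_trans (rho_tri x y z))// -ltrBrDl.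
Qed.

(* Compactness as an induction principle: a property of sets that is hereditary,
   stable under finite unions and true locally holds of a compact set. *)
Lemma rcompact_ind (K : set E) (Q : set E -> Prop) : rcompact rho K ->
  Q set0 -> (forall A B, Q A -> Q B -> Q (A `|` B)) ->
  (forall A B, A `<=` B -> Q B -> Q A) ->
  (forall x, K x -> exists2 r : R, 0 < r & Q (rball rho x r)) -> Q K.
Proof.
move=> cK Q0 QU QS Qx.
have [||F [fF FG KF]] := cK [set A | ropen rho A /\ Q A].
- by move=> A [].
- move=> x /Qx[r r0 Qr]; exists (rball rho x r); last by rewrite /rball/= rho_xx.
  by split=> //; exact: ropen_rball.
apply: (QS) KF _; have {}FG A : F A -> Q A by move=> /FG[].
have /finite_seqP[s Fs] := fF.
have {}FG A : A \in s -> Q A by move=> As; apply: FG; rewrite Fs.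
rewrite {}Fs {fF}.
elim: s FG => [|A s ih] FG.
  by apply: (QS) Q0 => x [A].
apply: (QS _ (A `|` \bigcup_(B in [set` s]) B)); last first.
  apply: QU; first by apply: FG; rewrite mem_head.
  by apply: ih => B Bs; apply: FG; rewrite in_cons Bs orbT.
move=> x [B /=]; rewrite in_cons => /orP[/eqP -> Ax|Bs Bx]; first by left.
by right; exists B.
Qed.

Lemma rcompact_closed (K : set E) : rcompact rho K -> ropen rho (~` K).
Proof.
move=> cK x Kx.
suff [r r0 rK] : exists2 r : R, 0 < r & forall y, K y -> r <= rho x y.
  by exists r => // y; rewrite /rball/= => xy /rK; rewrite leNgt xy.
apply: (rcompact_ind (Q := fun A => exists2 r : R, 0 < r &
    forall y, A y -> r <= rho x y)) cK _ _ _ _.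
- by exists 1.
- move=> A B [a a0 aA] [b b0 bB]; exists (Num.min a b); first by rewrite lt_min a0.
  by move=> y [/aA|/bB] h; rewrite ge_min h ?orbT.
- by move=> A B AB [r r0 rB]; exists r => // y /AB/rB.
- move=> y Ky; have xy0 : 0 < rho x y.
    have [h0 h1 _ _] := rhoM; rewrite lt_neqAle h0 andbT eq_sym.
    by apply/eqP => /h1 xy; apply: Kx; rewrite xy.
  exists (rho x y / 2); first by rewrite divr_gt0.
  exists (rho x y / 2); first by rewrite divr_gt0.
  move=> z; rewrite /rball/= => yz; have := rho_tri x z y.
  rewrite (rho_sym z y); lra.
Qed.

(** The second point is free to leave [K], as a path started in [K] does. *)
Lemma rcompact_ucont (K : set E) (g : E -> R) (e : R) : rcompact rho K -> 0 < e ->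
  rcontinuous rho g -> exists2 r : R, 0 < r &
    forall x y, K x -> rho x y < r -> `|g x - g y| < e.
Proof.
move=> cK e0 cg.
apply: (rcompact_ind (Q := fun A => exists2 r : R, 0 < r &
    forall x y, A x -> rho x y < r -> `|g x - g y| < e)) cK _ _ _ _.
- by exists 1.
- move=> A B [a a0 aA] [b b0 bB]; exists (Num.min a b); first by rewrite lt_min a0.
  move=> x y [/aA|/bB] h; rewrite lt_min => /andP[xa xb]; exact: h.
- by move=> A B AB [r r0 rB]; exists r => // x y /AB/rB; apply.
- move=> y Ky; have [r r0 yr] := cg y (e / 2) (divr_gt0 e0 (ltr0Sn R 1)).
  exists (r / 2); first by rewrite divr_gt0.
  exists (r / 2); first by rewrite divr_gt0.
  move=> x z; rewrite /rball/= => yx xz.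
  have h1 := yr x; have h2 := yr z; have h3 := rho_tri y x z.
  have {}h1 : `|g y - g x| < e / 2 by apply: h1; lra.
  have {}h2 : `|g y - g z| < e / 2 by apply: h2; lra.
  have := ler_normB (g y - g z) (g y - g x).
  have -> : g y - g z - (g y - g x) = g x - g z by ring.
  by lra.
Qed.

Lemma rcontinuous_sub_on (K : set E) (g : E -> R) :
  rcontinuous rho g -> rcontinuous_on rho K g.
Proof. by move=> cg x e _ /(cg x)[r r0 h]; exists r => // y _; exact: h. Qed.

Lemma rcontinuous_rho z : rcontinuous rho (rho^~ z).
Proof.
move=> x e e0; exists e => // y xy.
have h1 := rho_tri x y z; have h2 := rho_tri y x z.
rewrite (rho_sym y x) in h2; rewrite ltr_norml; apply/andP; split; lra.
Qed.

Lemma rcontinuous_expR (g : E -> R) : rcontinuous rho g ->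
  rcontinuous rho (fun x => expR (g x)).
Proof.
move=> cg x e e0.
have /cvgrPdist_lt/(_ e e0) : expR y @[y --> g x] --> expR (g x).
  exact: continuous_expR.
move=> /nbhs_ballP[r r0 h].
have [s s0 hs] := cg x r r0; exists s => // y /hs xy.
by apply: h; rewrite /ball/=.
Qed.

End metric.

(** * Borel measurability of open sets, compact sets and continuous functions *)

Section borel.
Context {R : realType} {d : measure_display} {E : measurableType d}.
Variable rho : E -> E -> R.
Hypothesis HE : lcs_metric_borel rho.

Lemma lcs_metric : is_metric rho. Proof. by have [] := HE. Qed.

Lemma ropen_measurable (A : set E) : ropen rho A -> measurable A.
Proof. by have [_ _ _ ->] := HE => oA; apply: sub_sigma_algebra. Qed.

Lemma rcompact_measurable (K : set E) : rcompact rho K -> measurable K.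
Proof.
move=> /(rcompact_closed lcs_metric)/ropen_measurable/measurableC.
by rewrite setCK.
Qed.

Lemma rcontinuous_on_measurable (K : set E) (g : E -> R) : measurable K ->
  rcontinuous_on rho K g -> measurable_fun K g.
Proof.
move=> mK cg; apply: (measurability _ (RGenOInfty.measurableE R)) => _ [_ [a ->] <-].
(* [O] is a union of balls whose trace on [K] lies in the superlevel set, so a relatively open set
   is the trace of an open one. *)
pose O := [set y | exists x r, rball rho x r y /\
    forall z, K z -> rball rho x r z -> a < g z].
have -> : K `&` g @^-1` `]a, +oo[ = K `&` O.
  apply/seteqP; split => x [Kx]; rewrite /= ?in_itv/= ?andbT.
    move=> ax; split => //; have [|r r0 h] := cg x (g x - a) Kx.
      by rewrite subr_gt0.
    exists x, r; split; first by rewrite /rball/= (rho_xx lcs_metric).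
    by move=> z Kz /(h _ Kz); rewrite ltr_norml => /andP[]; lra.
  by move=> [y [r [xy h]]]; split => //; apply: h.
apply: measurableI => //; apply: ropen_measurable.
move=> y [x [r [xy h]]].
have [s s0 sy] := ropen_rball lcs_metric xy.
by exists s => // z /sy xz; exists x, r.
Qed.

Lemma rcontinuous_measurable (g : E -> R) :
  rcontinuous rho g -> measurable_fun setT g.
Proof.
by move=> cg; apply: rcontinuous_on_measurable => //; exact: rcontinuous_sub_on.
Qed.

End borel.

(** * Riemann sums of right-continuous functions *)

Section riemann_sums.
Context {R : realType}.
Implicit Types (g : R -> R) (a t : R).
Notation mu := (@lebesgue_measure R).

(** This is the regularity of a continuous function along a path. Sampling points therefore have to
    approach from the right, and every grid below rounds up. *)
Definition rcont0 g : Prop := forall t (e : R), 0 <= t -> 0 < e ->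
  exists2 eta : R, 0 < eta & forall s, t <= s -> s < t + eta -> `|g s - g t| < e.

Lemma rcont0_cvg g (q : nat -> R) t : rcont0 g -> 0 <= t ->
  (forall n, t <= q n) -> q @ \oo --> t -> (fun n => g (q n)) @ \oo --> g t.
Proof.
move=> rg t0 tq qt; apply/cvgrPdist_lt => e e0.
have [eta eta0 h] := rg t e t0 e0.
move/cvgrPdist_lt : qt => /(_ eta eta0); apply: filterS => n.
rewrite distrC => /(le_lt_trans (ler_norm _)); rewrite ltrBlDl => qn.
by rewrite distrC; exact: h.
Qed.

Lemma measurable_fun_nat_comp d (S : measurableType d)
    (N : S -> nat) (h : nat -> R) :
  (forall k, measurable [set s | N s = k]) -> measurable_fun setT (h \o N).
Proof.
move=> mN _ Y mY; rewrite setTI.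
rewrite (_ : _ @^-1` _ = \bigcup_(k in [set k | Y (h k)]) [set s | N s = k]).
  by apply: bigcup_measurable => k _; exact: mN.
apply/seteqP; split => s /=; first by move=> Ys; exists (N s).
by move=> [k /= Yk Nk]; rewrite Nk.
Qed.

(* The right end of the cell of the grid [a + eta N] containing [u]. *)
Definition grid_up (a eta u : R) : R :=
  a + (Num.truncn (Num.max 0 ((u - a) / eta))).+1%:R * eta.

Lemma grid_upE (a eta u : R) k : 0 < eta ->
  a + k%:R * eta <= u -> u < a + k.+1%:R * eta ->
  grid_up a eta u = a + k.+1%:R * eta.
Proof.
move=> eta0 h1 h2; rewrite /grid_up; congr (_ + _.+1%:R * _).
have h : k%:R <= (u - a) / eta < k.+1%:R.
  by rewrite ler_pdivlMr// ltr_pdivrMr// lerBrDl h1 ltrBlDl h2.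
rewrite (max_idPr _); first exact: truncn_def.
by case/andP: h => h _; rewrite (le_trans _ h).
Qed.

Lemma grid_up_itv (a eta u : R) : 0 < eta -> a <= u ->
  u <= grid_up a eta u <= u + eta.
Proof.
move=> eta0 au; rewrite /grid_up.
have y0 : 0 <= (u - a) / eta by rewrite divr_ge0 ?subr_ge0// ltW.
rewrite (max_idPr _)//; have /andP[] := truncn_itv y0.
rewrite ler_pdivlMr// ltr_pdivrMr// -natr1 => h1 h2.
by apply/andP; split; lra.
Qed.

Lemma measurable_grid_up (a eta : R) g : 0 < eta ->
  measurable_fun setT (fun u => g (grid_up a eta u)).
Proof.
move=> eta0.
apply: (@measurable_fun_nat_comp _ R
  (fun u => Num.truncn (Num.max 0 ((u - a) / eta)))
  (fun k => g (a + k.+1%:R * eta))) => k.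
rewrite (_ : mkset _ =
    [set u | k%:R <= Num.max 0 ((u - a) / eta)] `&`
    ~` [set u | k.+1%:R <= Num.max 0 ((u - a) / eta)]).
  have m : measurable_fun setT (fun u : R => Num.max 0 ((u - a) / eta)).
    apply: measurable_maxr => //; apply: measurable_funM => //.
    exact: measurable_funB.
  by apply: measurableI; [|apply: measurableC]; exact: measurable_ge.
have y0 u : 0 <= Num.max 0 ((u - a) / eta) by rewrite le_max lexx.
apply/seteqP; split => u /=.
  by move=> <-; have /andP[-> /lt_geF ->] := truncn_itv (y0 u).
by move=> [h1 /negP]; rewrite -ltNge => h2; apply: truncn_def; rewrite h1.
Qed.

Lemma bounded_integrable_itv g (C : R) (i : interval R) :
  (mu [set` i] < +oo)%E -> measurable_fun setT g -> (forall s, `|g s| <= C) ->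
  mu.-integrable [set` i] (EFin \o g).
Proof.
move=> ioo mg gC; apply: measurable_bounded_integrable => //.
  exact: measurable_funTS.
exists C; split; first by rewrite num_real.
by move=> M CM w _; exact: le_trans (gC w) (ltW CM).
Qed.

Lemma lebesgue_itv_lty (b1 b2 : bool) (x y : R) :
  (mu [set` Interval (BSide b1 x) (BSide b2 y)] < +oo)%E.
Proof.
by rewrite lebesgue_measure_itv/=; case: ifP => _; rewrite ?ltry// -EFinB ltry.
Qed.

Lemma Rintegral_grid_up g (C a eta : R) (m : nat) : 0 < eta ->
  (forall s, `|g s| <= C) ->
  Rintegral mu `[a, a + m%:R * eta[ (fun u => g (grid_up a eta u)) =
  \sum_(i < m) eta * g (a + i.+1%:R * eta).
Proof.
move=> eta0 gC; elim: m => [|m ih].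
  by rewrite big_ord0 mul0r addr0 set_itvco0 Rintegral_set0.
have mh : (a + m%:R * eta <= a + m.+1%:R * eta)%R by rewrite -natr1; lra.
have m0 : 0 <= m%:R * eta by rewrite mulr_ge0// ltW.
rewrite big_ord_recr/= -ih.
rewrite (@itv_bndbnd_setU _ _ _ (BLeft (a + m%:R * eta))); last 2 first.
- by rewrite bnd_simp; lra.
- by rewrite bnd_simp.
rewrite Rintegral_setU//=; last 2 first.
- rewrite -itv_bndbnd_setU; last 2 first.
  + by rewrite bnd_simp; lra.
  + by rewrite bnd_simp.
  apply: (@bounded_integrable_itv _ C) => //; first exact: lebesgue_itv_lty.
  exact: measurable_grid_up.
- apply/disj_setPS => y [/=]; rewrite 2!in_itv/= => /andP[_ yx] /andP[].
  by rewrite leNgt yx.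
congr (_ + _).
rewrite (@eq_Rintegral _ _ _ _ _ (fun _ => g (a + m.+1%:R * eta))); last first.
  move=> u; rewrite inE/= in_itv/= => /andP[h1 h2].
  by rewrite (@grid_upE _ _ _ m).
rewrite Rintegral_cst// mulrC; congr (_ * _).
rewrite [X in fine X]lebesgue_measure_itv/= lte_fin ltrD2l ltr_pM2r// ltr_nat ltnSn.
by rewrite -EFinB/= -natr1; ring.
Qed.

(** Right-continuity is given on the half-line only, hence the cut at zero. The function is then a
    limit of its samples on grids of mesh [1 / (n + 1)], each taking countably many values. *)
Lemma rcont0_measurable g : rcont0 g ->
  measurable_fun setT (fun s : R => g (Num.max 0 s)).
Proof.
move=> rg.
apply: (@measurable_fun_cvg _ R R setT
  (fun n u => g (grid_up 0 (n.+1%:R)^-1 (Num.max 0 u)))) => [n|u _].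
  apply: (measurableT_comp (measurable_grid_up 0 g _)) => //.
  exact: measurable_maxr.
have u0 : 0 <= Num.max 0 u by rewrite le_max lexx.
have n0 n : 0 < n.+1%:R^-1 :> R by rewrite invr_gt0.
apply: rcont0_cvg => // [n|].
  by have /andP[] := grid_up_itv (n0 n) u0.
apply: (@squeeze_cvgr _ _ _ _ (fun=> Num.max 0 u)
    (fun n => Num.max 0 u + n.+1%:R^-1)).
- by apply: nearW => n; exact: grid_up_itv.
- exact: cvg_cst.
- rewrite -[X in _ --> X]addr0; apply: cvgD; first exact: cvg_cst.
  exact: cvg_harmonic.
Qed.


Lemma tint_max0 g t : tint g t = tint (fun s => g (Num.max 0 s)) t.
Proof.
congr fine; apply: eq_integral => s; rewrite inE/= in_itv/= => /andP[s0 _].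
by rewrite (max_idPr s0).
Qed.

Lemma tint0 g : tint g 0 = 0.
Proof. by rewrite /tint set_itv1 integral_set1. Qed.

Lemma tintB_itv g (C a t : R) : measurable_fun setT g -> (forall s, `|g s| <= C) ->
  0 <= a -> 0 <= t -> tint g (a + t) - tint g a = Rintegral mu `[a, a + t[ g.
Proof.
move=> mg gC a0 t0.
have il b1 b2 (x y : R) :
    mu.-integrable [set` Interval (BSide b1 x) (BSide b2 y)] (EFin \o g).
  by apply: bounded_integrable_itv gC => //; exact: lebesgue_itv_lty.
rewrite Rintegral_itv_bndo_bndc//; rewrite -Rintegral_itv_obnd_cbnd//.
by rewrite -(@Rintegral_itvB _ _ (BLeft 0)) ?bnd_simp//; lra.
Qed.

(** The integral of the function sampled by [grid_up] is exactly the Riemann sum; the samples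
    converge pointwise by right-continuity, and dominated convergence applies with the constant
    [C]. *)
Lemma tint_riemann_pos g (C a t : R) : rcont0 g -> (forall s, `|g s| <= C) ->
  0 <= a -> 0 < t ->
  (fun n : nat => \sum_(i < n.+1) t / n.+1%:R * g (a + i.+1%:R * (t / n.+1%:R)))
    @ \oo --> tint g (a + t) - tint g a.
Proof.
move=> rg gC a0 t0.
pose g0 s := g (Num.max 0 s).
have mg : measurable_fun setT g0 by exact: rcont0_measurable.
have gC0 s : `|g0 s| <= C by exact: gC.
have ig (i : interval R) : (mu [set` i] < +oo)%E -> mu.-integrable [set` i] (EFin \o g0).
  by move=> ioo; exact: bounded_integrable_itv gC0.
rewrite !(tint_max0 g) -/g0.
rewrite (tintB_itv mg gC0 a0 (ltW t0)).
have n0 n : 0 < t / n.+1%:R by rewrite divr_gt0.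
pose G n u := g0 (grid_up a (t / n.+1%:R) u).
have -> : (fun n : nat => \sum_(i < n.+1) t / n.+1%:R *
     g (a + i.+1%:R * (t / n.+1%:R))) =
   (fun n => Rintegral mu `[a, a + t[ (G n)).
  apply/funext => n.
  have -> : a + t = a + n.+1%:R * (t / n.+1%:R).
    by congr (_ + _); rewrite mulrC divfK// pnatr_eq0.
  rewrite (@Rintegral_grid_up g0 C)//; apply: eq_bigr => i _.
  by rewrite /g0 (max_idPr _)// addr_ge0// mulr_ge0// ltW.
have mD : measurable (`[a, a + t[%classic : set R) by [].
have Du u : `[a, a + t[%classic u -> a <= u by rewrite /= in_itv/= => /andP[].
have [|||||_ _ h] := @dominated_convergence _ _ _ mu _ mD
  (fun n => EFin \o G n) (EFin \o g0) (cst C%:E).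
- move=> n; apply/measurable_EFinP; apply: measurable_funTS.
  exact: measurable_grid_up.
- by apply/measurable_EFinP; apply: measurable_funTS.
- apply: aeW => u /Du au; apply: cvg_EFin; first exact: nearW.
  have au0 : 0 <= u by lra.
  rewrite /g0 /G (max_idPr au0) /comp /=.
  rewrite /g0.
  rewrite (_ : (fun x => _) = (fun n => g (grid_up a (t / n.+1%:R) u))); last first.
    apply/funext => n; rewrite (max_idPr _)//.
    by have /andP[h _] := grid_up_itv (n0 n) au; rewrite (le_trans au0).
  apply: rcont0_cvg => // [n|].
    by have /andP[] := grid_up_itv (n0 n) au.
  apply: (@squeeze_cvgr _ _ _ _ (fun=> u) (fun n => u + t / n.+1%:R)).
  - by apply: nearW => n; exact: grid_up_itv.
  - exact: cvg_cst.
  - rewrite -[X in _ --> X]addr0; apply: cvgD; first exact: cvg_cst.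
    rewrite -[X in _ --> X](mulr0 t); apply: cvgM; first exact: cvg_cst.
    exact: cvg_harmonic.
- apply: (@bounded_integrable_itv (cst C) `|C|) => //.
  exact: lebesgue_itv_lty.
- by apply: aeW => u n _; rewrite /= lee_fin; exact: gC0.
rewrite /Rintegral; apply: fine_cvg; rewrite fineK; first exact: h.
by apply: integrable_fin_num => //; apply: ig; exact: lebesgue_itv_lty.
Qed.

Lemma tint_riemann g (C a t : R) : rcont0 g -> (forall s, `|g s| <= C) ->
  0 <= a -> 0 <= t ->
  (fun n : nat => \sum_(i < n.+1) t / n.+1%:R * g (a + i.+1%:R * (t / n.+1%:R)))
    @ \oo --> tint g (a + t) - tint g a.
Proof.
move=> rg gC a0; rewrite le_eqVlt => /predU1P[<-|]; last exact: tint_riemann_pos gC a0.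
rewrite addr0 subrr (_ : (fun n => _) = (fun=> 0)); first exact: cvg_cst.
by apply/funext => n; rewrite big1// => i _; rewrite !mul0r.
Qed.

Lemma riemann_sum_bound g (C a t : R) n : (forall s, `|g s| <= C) -> 0 <= t ->
  `|\sum_(i < n.+1) t / n.+1%:R * g (a + i.+1%:R * (t / n.+1%:R))| <= C * t.
Proof.
move=> gC t0; apply: (le_trans (ler_norm_sum _ _ _)).
have tn : 0 <= t / n.+1%:R by rewrite divr_ge0.
apply: (@le_trans _ _ (\sum_(i < n.+1) t / n.+1%:R * C)).
  by apply: ler_sum => i _; rewrite normrM (ger0_norm tn) ler_wpM2l.
rewrite sumr_const card_ord -(mulr_natr (_ * C)) le_eqVlt; apply/orP; left; apply/eqP.
have : n.+1%:R != 0 :> R by rewrite pnatr_eq0.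
by move: (n.+1%:R) => k k0; field.
Qed.

Lemma cvg_norm_le (u : nat -> R) l (C : R) : u @ \oo --> l ->
  (forall n, `|u n| <= C) -> `|l| <= C.
Proof.
move=> ul uC; apply: (@closed_cvg _ _ (\oo) _ (fun n => `|u n|) (fun y => y <= C)).
- exact: closed_le.
- exact: nearW.
- exact: cvg_norm.
Qed.

Lemma tintB_bound g (C a t : R) : rcont0 g -> (forall s, `|g s| <= C) ->
  0 <= a -> 0 <= t -> `|tint g (a + t) - tint g a| <= C * t.
Proof.
move=> rg gC a0 t0; apply: cvg_norm_le (tint_riemann rg gC a0 t0) _ => n.
exact: riemann_sum_bound.
Qed.

Lemma tint_bound g (C t : R) : rcont0 g -> (forall s, `|g s| <= C) ->
  0 <= t -> `|tint g t| <= C * t.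
Proof.
by move=> rg gC t0; have := tintB_bound rg gC (lexx 0) t0; rewrite add0r tint0 subr0.
Qed.

Lemma tint_subc g (C l t : R) : rcont0 g -> (forall s, `|g s| <= C) ->
  0 <= t -> tint (fun s => g s - l) t = tint g t - l * t.
Proof.
move=> rg gC t0.
have rgl : rcont0 (fun s => g s - l).
  move=> s e s0 e0; have [eta eta0 h] := rg s e s0 e0; exists eta => // r sr rs.
  by rewrite opprB addrA subrK; exact: h.
have glC s : `|g s - l| <= C + `|l| by rewrite (le_trans (ler_normB _ _))// lerD.
have h1 := tint_riemann rgl glC (lexx 0) t0.
have h0 := tint_riemann rg gC (lexx 0) t0.
rewrite add0r tint0 subr0 in h1; rewrite add0r tint0 subr0 in h0.
suff h2 : (fun n : nat => \sum_(i < n.+1)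
    t / n.+1%:R * (g (0 + i.+1%:R * (t / n.+1%:R)) - l)) @ \oo --> tint g t - l * t.
  by rewrite -(cvg_lim (@Rhausdorff R) h1) -(cvg_lim (@Rhausdorff R) h2).
rewrite [X in X @ _ --> _](_ : _ = (fun n : nat => \sum_(i < n.+1)
    t / n.+1%:R * g (0 + i.+1%:R * (t / n.+1%:R))) \- cst (l * t)).
  by apply: cvgB; [exact: h0|exact: cvg_cst].
apply/funext => n /=.
rewrite (_ : l * t = \sum_(i < n.+1) (t / n.+1%:R * l)); last first.
  rewrite sumr_const card_ord -(mulr_natr (_ * l)).
  have : n.+1%:R != 0 :> R by rewrite pnatr_eq0.
  by move: (n.+1%:R) => k k0; field.
by rewrite -sumrB; apply: eq_bigr => i _; rewrite mulrBr.
Qed.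

End riemann_sums.

(** * The Markov property *)

Section process.
Context {R : realType} {dE dO : measure_display}
  {E : measurableType dE} {Om : measurableType dO}.
Variables (X : R -> Om -> E) (P : E -> probability Om R) (F : R -> set (set Om))
  (rho : E -> E -> R).
Hypotheses (HE : lcs_metric_borel rho) (HX : standard_feller_markov X P F rho).

(** Adaptedness is plain measurability for the type carrying [F s] as its sigma-algebra, so the
    closure lemmas on [bm] serve again; [F_genE] identifies the generated sigma-algebra with
    [F s]. *)
Definition abm (s : R) (g : Om -> R) : Prop :=
  @bm R _ (g_sigma_algebraType (F s)) g.

Lemma F_sigma t : 0 <= t -> sigma_algebra setT (F t).
Proof. by move=> t0; have [/(_ t t0)[]] := HX. Qed.

Lemma F_measurable t A : 0 <= t -> F t A -> measurable A.
Proof. by move=> t0; have [/(_ t t0)[_ +]] := HX => /(_ A). Qed.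

Lemma F_mono s t A : 0 <= s -> s <= t -> F s A -> F t A.
Proof. by move=> s0 st; have [_ [+ _]] := HX => /(_ s t s0 st A). Qed.

Lemma F_genE t : 0 <= t ->
  @measurable _ (g_sigma_algebraType (F t)) = F t.
Proof. by move=> t0; exact: (sigma_algebra_id (F_sigma t0)). Qed.

Lemma F_setT t : 0 <= t -> F t setT.
Proof. by move=> t0; rewrite -F_genE//; exact: measurableT. Qed.

Lemma F_setC t A : 0 <= t -> F t A -> F t (~` A).
Proof. by move=> t0; rewrite -F_genE//; exact: measurableC. Qed.

Lemma F_setI t A B : 0 <= t -> F t A -> F t B -> F t (A `&` B).
Proof. by move=> t0; rewrite -F_genE//; exact: measurableI. Qed.

Lemma F_bigcup t (A : nat -> set Om) (D : set nat) : 0 <= t ->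
  (forall i, D i -> F t (A i)) -> F t (\bigcup_(i in D) A i).
Proof.
move=> t0 FA; rewrite -F_genE//; apply: bigcup_measurable => i Di.
by rewrite F_genE//; exact: FA.
Qed.

Lemma abm_bm s g : 0 <= s -> abm s g -> bm g.
Proof.
move=> s0 [mg bg]; split=> // _ Y mY.
by have := mg measurableT Y mY; rewrite F_genE//; exact: F_measurable.
Qed.

Lemma abm_mono s t g : 0 <= s -> s <= t -> abm s g -> abm t g.
Proof.
move=> s0 st [mg bg]; split=> // _ Y mY.
have := mg measurableT Y mY; rewrite !F_genE//; first exact: F_mono.
exact: le_trans st.
Qed.

Lemma abm_X t (u : E -> R) : 0 <= t -> bm u -> abm t (fun w => u (X t w)).
Proof.
move=> t0 [mu [C uC]]; split; last by exists C.
move=> _ Y mY; rewrite setTI F_genE//.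
have [_ [_ [_ [_ [+ _]]]]] := HX => /(_ t (u @^-1` Y) t0); apply.
by rewrite -[X in measurable X]setTI; exact: mu.
Qed.

Lemma bm_X t (u : E -> R) : 0 <= t -> bm u -> bm (fun w => u (X t w)).
Proof. by move=> t0 /(abm_X t0)/abm_bm; exact. Qed.

Lemma F_X t (A : set E) : 0 <= t -> measurable A -> F t (X t @^-1` A).
Proof. by move=> t0 mA; have [_ [_ [_ [_ [+ _]]]]] := HX => /(_ t A t0 mA). Qed.

Lemma abm_indic s (A : set Om) : 0 <= s -> F s A -> abm s (\1_A).
Proof. by move=> s0 FA; apply: (@bm_indic R _ (g_sigma_algebraType (F s))); rewrite F_genE. Qed.

Lemma abm_lt s (u v : Om -> R) : 0 <= s -> abm s u -> abm s v ->
  F s [set w | u w < v w].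
Proof.
move=> s0 [mu _] [mv _]; rewrite -F_genE//.
have /(_ measurableT [set true] I) := measurable_fun_ltr mu mv.
by rewrite setTI; congr measurable; apply/seteqP; split => w.
Qed.

(** The process structure gives measurability of [x |-> P x L] for events; [bm_ind] carries it to
    bounded functions. *)
Lemma bm_Ex (h : Om -> R) : bm h -> bm (fun x => Ex P x h).
Proof.
apply: (@bm_ind R _ Om (fun h => bm (fun x => Ex P x h))) => [A mA|a u v bu bv Qu Qv|u bu Qu].
- have [_ [_ [_ [_ [_ [_ [+ _]]]]]]] := HX => /(_ A mA).
  under [X in bm X]eq_fun do rewrite Ex_indic//.
  move=> mP; split=> //; exists 1 => x.
  by rewrite ger0_norm ?fine_ge0// -lee_fin fineK ?probability_le1// fin_num_measure.
- rewrite (_ : (fun x => _) = (fun x => a * Ex P x u + Ex P x v)); last first.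
    by apply/funext => x; rewrite ExD ?ExZ//; exact: bmZ.
  by apply: bmD => //; exact: bmZ.
- split; last first.
    have [_ [C uC]] := bu; exists C => x; exact: Ex_norm_le.
  have n0 n : (0 : R) < n.+1%:R^-1 by rewrite invr_gt0.
  have /choice[v hv] : forall n : nat, exists v, [/\ bm v, bm (fun x => Ex P x v) &
      forall w, `|u w - v w| <= n.+1%:R^-1] by move=> n; exact: Qu.
  apply: (@measurable_fun_cvg _ E R setT (fun n x => Ex P x (v n))) => [n|x _].
    by have [_ []] := hv n.
  apply/cvgrPdist_lt => e e0.
  have /cvgrPdist_lt/(_ e e0) := @cvg_harmonic R.
  apply: filterS => n; rewrite sub0r normrN ger0_norm ?ltW//; last exact: n0.
  have [bv _ uv] := hv n => he.
  apply: le_lt_trans he; rewrite -ExB//; apply: Ex_norm_le => //; exact: bmB.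
Qed.

Lemma stopping_time_cst s : 0 <= s -> stopping_time F (fun _ => s).
Proof.
move=> s0; split => // t t0; have [st|ts] := leP s t.
  rewrite (_ : mkset _ = setT); first exact: F_setT.
  by apply/seteqP; split.
rewrite (_ : mkset _ = ~` setT); first by apply: F_setC => //; exact: F_setT.
by apply/seteqP; split => w; rewrite /= ?leNgt ?ts//; apply: contra_notP.
Qed.

Lemma F_at_cst s A : 0 <= s -> F s A -> F_at F (fun _ => s) A.
Proof.
move=> s0 FA; split; first exact: F_measurable FA.
move=> t t0; have [_ h] := stopping_time_cst s0.
move: (h t t0); have [st|ts] := leP s t => Ft.
  by apply: F_setI => //; exact: F_mono st FA.
by rewrite (_ : mkset _ = set0) in Ft *; rewrite ?setI0//; apply/seteqP; split.
Qed.

(** The strong Markov property at the constant time [s]. It concerns one later time only, which is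
    why functionals of the whole path need a further argument. *)
Lemma markov_indic x s t (A : set Om) (B : set E) : 0 <= s -> 0 <= t ->
  F s A -> measurable B ->
  Ex P x (fun w => \1_A w * \1_B (X (s + t) w)) =
  Ex P x (fun w => \1_A w * Ex P (X s w) (fun w' => \1_B (X t w'))).
Proof.
move=> s0 t0 FA mB.
have [_ [_ [_ [_ [_ [_ [_ [_ [_ [+ _]]]]]]]]]] := HX.
move=> /(_ x (fun _ => s) t B A (stopping_time_cst s0) t0 mB (F_at_cst s0 FA)).
have mA := F_measurable s0 FA.
have mAB : measurable (A `&` [set w | B (X (s + t) w)]).
  apply: measurableI => //; apply: (@F_measurable (s + t)).
    by rewrite addr_ge0.
  by apply: F_X => //; rewrite addr_ge0.
move=> h; transitivity (fine (P x (A `&` [set w | B (X (s + t) w)]))).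
  rewrite -Ex_indic//; apply: eq_Ex => w; rewrite !indicE -natrM mulnb.
  by congr (nat_of_bool _)%:R; rewrite in_setI; congr andb; apply/idP/idP; rewrite !inE.
rewrite h /Ex [in LHS]integral_mkcond; congr fine; apply: eq_integral => w _.
rewrite patchE indicE; case: ifPn => wA; last by rewrite mul0r.
rewrite mul1r; congr EFin; rewrite /Ptr -Ex_indic; last first.
  by apply: (F_measurable t0); exact: F_X.
by apply: eq_Ex => w'; rewrite !indicE; congr (nat_of_bool _)%:R; apply/idP/idP; rewrite !inE.
Qed.

Definition semigroup t (u : E -> R) y := Ex P y (fun w => u (X t w)).

Lemma bm_semigroup t u : 0 <= t -> bm u -> bm (semigroup t u).
Proof. by move=> t0 bu; apply: bm_Ex; exact: bm_X. Qed.

Lemma Ex_eq_approx x (a b : Om -> R) : bm a -> bm b ->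
  (forall e : R, 0 < e -> exists a' b', [/\ bm a', bm b', Ex P x a' = Ex P x b',
     (forall w, `|a w - a' w| <= e) & (forall w, `|b w - b' w| <= e)]) ->
  Ex P x a = Ex P x b.
Proof.
move=> ba bb h; apply/eqP; rewrite -subr_eq0 -normr_le0; apply/ler_addgt0Pr => e e0.
rewrite add0r; have [|a' [b' [ba' bb' ab' aa' bb'e]]] := h (e / 2).
  by rewrite divr_gt0.
have h1 : `|Ex P x a - Ex P x a'| <= e / 2.
  by rewrite -ExB//; apply: Ex_norm_le => //; exact: bmB.
have h2 : `|Ex P x b - Ex P x b'| <= e / 2.
  by rewrite -ExB//; apply: Ex_norm_le => //; exact: bmB.
have := ler_normB (Ex P x a - Ex P x a') (Ex P x b - Ex P x b').
rewrite (_ : _ - _ - _ = Ex P x a - Ex P x b); first by lra.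
by rewrite ab'; ring.
Qed.

(** [bm_ind] is used twice: over [F s] for [H], with [u] an indicator, and then over [E] for [u]. *)
Lemma markov_simple x s t (H : Om -> R) (u : E -> R) : 0 <= s -> 0 <= t ->
  abm s H -> bm u ->
  Ex P x (fun w => H w * u (X (s + t) w)) =
  Ex P x (fun w => H w * semigroup t u (X s w)).
Proof.
move=> s0 t0 bH bu; have st0 : 0 <= s + t by rewrite addr_ge0.
have tX (v : E -> R) : bm v -> bm (fun w => v (X (s + t) w)) by exact: bm_X.
have sX (v : E -> R) : bm v -> bm (fun w => semigroup t v (X s w)).
  by move=> bv; apply: bm_X => //; exact: bm_semigroup.
(* The error allowed on one factor is scaled by the bound of the other; the [+ 1] avoids a division
   by zero. *)
have close (C e : R) (a b : R) : 0 < e -> `|a| <= C -> `|b| <= e / (`|C| + 1) ->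
    `|a * b| <= e.
  move=> e0 aC be; have C0 : 0 < `|C| + 1 by rewrite ltr_pwDr.
  rewrite normrM (@le_trans _ _ ((`|C| + 1) * (e / (`|C| + 1))))//.
    rewrite ler_pM// (le_trans aC)// (le_trans (ler_norm _))//.
    by rewrite lerDl.
  by rewrite mulrC divfK// gt_eqF.
have CC (C e : R) : 0 < e -> 0 < e / (`|C| + 1).
  by move=> e0; rewrite divr_gt0// ltr_pwDr.
have semi1 A y : measurable A -> `|semigroup t \1_A y| <= 1.
  move=> mA; apply: Ex_norm_le => [|w].
    by apply: bm_X => //; exact: bm_indic.
  by rewrite indicE normr_nat; case: (_ \in _); rewrite ?ler01.
have ind1 (A : set E) y : `|\1_A y| <= 1 :> R.
  by rewrite indicE normr_nat; case: (_ \in _); rewrite ?ler01.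
have step1 A : measurable A -> Ex P x (fun w => H w * \1_A (X (s + t) w)) =
    Ex P x (fun w => H w * semigroup t \1_A (X s w)).
  move=> mA; have bA : bm (\1_A : E -> R) by exact: bm_indic.
  move: H bH; apply: (@bm_ind R _ (g_sigma_algebraType (F s)) (fun H =>
    Ex P x (fun w => H w * \1_A (X (s + t) w)) =
    Ex P x (fun w => H w * semigroup t \1_A (X s w)))).
  - by rewrite F_genE// => B FB; exact: markov_indic.
  - move=> a u1 u2 /(abm_bm s0) b1 /(abm_bm s0) b2 h1 h2.
    under eq_Ex do rewrite mulrDl -mulrA.
    under [RHS]eq_Ex do rewrite mulrDl -mulrA.
    rewrite !ExD ?ExZ ?h1 ?h2//; do ?apply: bmZ; do ?apply: bmM => //; do ?exact: tX; exact: sX.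
  - move=> u0 /(abm_bm s0) b0 h; apply: Ex_eq_approx.
    + by apply: bmM => //; exact: tX.
    + by apply: bmM => //; exact: sX.
    + move=> e e0; have [v [/(abm_bm s0) bv hv uv]] := h _ (CC 1 _ e0).
      exists (fun w => v w * \1_A (X (s + t) w)).
      exists (fun w => v w * semigroup t \1_A (X s w)); split => //.
      * by apply: bmM => //; exact: tX.
      * by apply: bmM => //; exact: sX.
      * by move=> w; rewrite -mulrBl mulrC; exact: (close 1).
      * by move=> w; rewrite -mulrBl mulrC; apply: (close 1) => //; exact: semi1.
have {}bH := abm_bm s0 bH; have [_ [C HC]] := bH.
move: u bu; apply: bm_ind => [//|a u1 u2 b1 b2 h1 h2|u0 b0 h].
- under eq_Ex do rewrite mulrDr mulrCA.
  have -> : semigroup t (fun y => a * u1 y + u2 y) =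
      (fun y => a * semigroup t u1 y + semigroup t u2 y).
    apply/funext => y; rewrite /semigroup ExD ?ExZ//; do ?apply: bmZ; exact: bm_X.
  under [RHS]eq_Ex do rewrite mulrDr mulrCA.
  rewrite !ExD ?ExZ ?h1 ?h2//; do ?apply: bmZ; do ?apply: bmM => //; do ?exact: tX; exact: sX.
- apply: Ex_eq_approx.
  + by apply: bmM => //; exact: tX.
  + by apply: bmM => //; exact: sX.
  + move=> e e0; have [v [bv hv uv]] := h _ (CC C _ e0).
    exists (fun w => H w * v (X (s + t) w)).
    exists (fun w => H w * semigroup t v (X s w)); split => //.
    * by apply: bmM => //; exact: tX.
    * by apply: bmM => //; exact: sX.
    * by move=> w; rewrite -mulrBr; exact: (close C).
    * move=> w; rewrite -mulrBr; apply: (close C) => //.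
      rewrite /semigroup -ExB; [|exact: bm_X|exact: bm_X].
      by apply: Ex_norm_le => //; apply: bmB; exact: bm_X.
Qed.

Lemma Ex_X0 x (u : E -> R) (H : Om -> R) : bm u -> bm H ->
  Ex P x (fun w => H w * u (X 0 w)) = Ex P x H * u x.
Proof.
move=> bu bH; rewrite mulrC -ExZ//; apply: Ex_ae_eq.
- by have [] : bm (fun w => H w * u (X 0 w)) by apply: bmM => //; exact: bm_X.
- by have [] : bm (fun w => u x * H w) by exact: bmZ.
have mx : measurable [set y | y = x].
  rewrite -[mkset _]setCK; apply: measurableC; apply: (ropen_measurable HE) => y yx.
  have [h0 h1 h2 _] := lcs_metric HE.
  exists (rho x y); last by move=> z; rewrite /rball/= => + zx; rewrite zx h2 ltxx.
  rewrite lt_neqAle h0 andbT eq_sym; apply/eqP => /h1 xy; exact: yx.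
have mX : measurable [set w | X 0 w = x].
  exact: (F_measurable (lexx 0) (F_X (lexx 0) mx)).
exists (~` [set w | X 0 w = x]); split; first exact: measurableC.
- rewrite probability_setC//.
  by have [_ [_ [_ [_ [_ [-> _]]]]]] := HX; rewrite subee.
- by move=> w; apply: contra_not => /= ->; rewrite mulrC.
Qed.

End process.

(** * The Feynman-Kac operators *)

Section feynman_kac.
Context {R : realType} {dE dO : measure_display}
  {E : measurableType dE} {Om : measurableType dO}.
Variables (X : R -> Om -> E) (P : E -> probability Om R) (F : R -> set (set Om))
  (rho : E -> E -> R).
Hypotheses (HE : lcs_metric_borel rho) (HX : standard_feller_markov X P F rho).
Variables (q : E -> R) (C : R).
Hypotheses (cq : rcontinuous rho q) (qC : forall x, `|q x| <= C).

Definition Zexp (t : R) (w : Om) : R := expR (tint (fun s => q (X s w)) t).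

Definition FK (t : R) (u : E -> R) (y : E) : R :=
  Ex P y (fun w => Zexp t w * u (X t w)).

Lemma path_rcont w (u : E -> R) : rcontinuous rho u -> rcont0 (fun s => u (X s w)).
Proof.
move=> cu t e t0 e0; have [r r0 hr] := cu (X t w) e e0.
have [_ [_ [_ [_ [_ [_ [_ [+ _]]]]]]]] := HX.
move=> /(_ w t r t0 r0)[eta eta0 h]; exists eta => // s ts st.
rewrite distrC; apply: hr; rewrite (rho_sym (lcs_metric HE)); exact: h.
Qed.

Lemma bm_q : bm q.
Proof. by split; [exact: rcontinuous_measurable HE _ cq|exists C]. Qed.

Definition rsum (s t : R) (n : nat) (w : Om) : R :=
  \sum_(i < n.+1) t / n.+1%:R * q (X (s + i.+1%:R * (t / n.+1%:R)) w).

Lemma abm_psum (s eta : R) (n : nat) : 0 <= s -> 0 <= eta ->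
  abm F (s + n%:R * eta)
    (fun w => \sum_(i < n) eta * q (X (s + i.+1%:R * eta) w)).
Proof.
move=> s0 eta0.
apply: (@bm_sum R _ (g_sigma_algebraType (F (s + n%:R * eta))) n
  (fun i w => eta * q (X (s + i.+1%:R * eta) w))) => i ni.
apply: (@bmZ R _ (g_sigma_algebraType (F (s + n%:R * eta)))).
have si0 : 0 <= s + i.+1%:R * eta by rewrite addr_ge0// mulr_ge0.
apply: (abm_mono HX si0); last exact: (abm_X HX si0 bm_q).
by rewrite lerD2l ler_wpM2r// ler_nat.
Qed.

Lemma abm_rsum (s t : R) (n : nat) : 0 <= s -> 0 <= t -> abm F (s + t) (rsum s t n).
Proof.
move=> s0 t0; have -> : s + t = s + n.+1%:R * (t / n.+1%:R).
  by rewrite mulrC divfK// pnatr_eq0.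
by apply: abm_psum => //; rewrite divr_ge0.
Qed.

Lemma rsum_bound s t n w : 0 <= t -> `|rsum s t n w| <= C * t.
Proof. by move=> t0; apply: (@riemann_sum_bound R (fun r => q (X r w))). Qed.

Lemma rsum_cvg s t w : 0 <= s -> 0 <= t -> (fun n => rsum s t n w) @ \oo -->
  tint (fun r => q (X r w)) (s + t) - tint (fun r => q (X r w)) s.
Proof.
by move=> s0 t0; apply: (@tint_riemann R (fun r => q (X r w)) C) => //; exact: path_rcont.
Qed.

Lemma abm_tint t : 0 <= t -> abm F t (fun w => tint (fun s => q (X s w)) t).
Proof.
move=> t0; split; last first.
  by exists (C * t) => w; apply: tint_bound => //; exact: path_rcont.
apply: (@measurable_fun_cvg _ (g_sigma_algebraType (F t)) R setT
  (fun n => rsum 0 t n)) => [n|w _].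
  by have [] := @abm_rsum 0 t n (lexx 0) t0; rewrite add0r.
by have := @rsum_cvg 0 t w (lexx 0) t0; rewrite add0r tint0 subr0.
Qed.

Lemma abm_Z t : 0 <= t -> abm F t (Zexp t).
Proof.
move=> t0; exact: (@bm_exp R _ (g_sigma_algebraType (F t)) _ (abm_tint t0)).
Qed.

Lemma bm_Z t : 0 <= t -> bm (Zexp t).
Proof. by move=> t0; apply: (abm_bm HX t0); exact: abm_Z. Qed.

Lemma Zexp_gt0 t w : 0 < Zexp t w. Proof. exact: expR_gt0. Qed.

Lemma Zexp0 w : Zexp 0 w = 1. Proof. by rewrite /Zexp tint0 expR0. Qed.

Lemma ZexpD_le s t w : 0 <= s -> 0 <= t ->
  expR (- (C * t)) * Zexp s w <= Zexp (s + t) w <= expR (C * t) * Zexp s w.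
Proof.
move=> s0 t0; rewrite /Zexp -!expRD !ler_expR.
have := tintB_bound (path_rcont w cq) (fun s => qC (X s w)) s0 t0.
by rewrite ler_norml => /andP[h1 h2]; apply/andP; split; lra.
Qed.

Lemma Zexp_le t w : 0 <= t -> expR (- (C * t)) <= Zexp t w <= expR (C * t).
Proof. by move=> t0; have := ZexpD_le w (lexx 0) t0; rewrite add0r Zexp0 !mulr1. Qed.

Lemma bm_FK t u : 0 <= t -> bm u -> bm (FK t u).
Proof.
move=> t0 bu; apply: (bm_Ex HX); apply: bmM; first exact: bm_Z.
exact: (bm_X HX).
Qed.

Lemma bm_ZX t u : 0 <= t -> bm u -> bm (fun w => Zexp t w * u (X t w)).
Proof. by move=> t0 bu; apply: bmM; [exact: bm_Z|exact: (bm_X HX)]. Qed.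

Lemma FK_ge0 t u y : (forall x, 0 <= u x) -> 0 <= FK t u y.
Proof. by move=> u0; apply: Ex_ge0 => w; rewrite mulr_ge0// ltW// Zexp_gt0. Qed.

Lemma FK_le t u v y : 0 <= t -> bm u -> bm v -> (forall x, u x <= v x) ->
  FK t u y <= FK t v y.
Proof.
move=> t0 bu bv uv; apply: Ex_le; [exact: bm_ZX|exact: bm_ZX|move=> w].
by rewrite ler_wpM2l// ltW// Zexp_gt0.
Qed.

Lemma FKD t u v y : 0 <= t -> bm u -> bm v ->
  FK t (fun x => u x + v x) y = FK t u y + FK t v y.
Proof.
move=> t0 bu bv; rewrite /FK -ExD; [|exact: bm_ZX|exact: bm_ZX].
by apply: eq_Ex => w; rewrite mulrDr.
Qed.

Lemma FKZ t (a : R) u y : 0 <= t -> bm u -> FK t (fun x => a * u x) y = a * FK t u y.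
Proof.
move=> t0 bu; rewrite /FK -ExZ; last exact: bm_ZX.
by apply: eq_Ex => w; rewrite mulrCA.
Qed.

(** One grid step of the discretized Feynman-Kac operator; the weight is evaluated at the right end
    of the step, as in [rsum]. *)
Let K (eta : R) (u : E -> R) : E -> R :=
  semigroup X P eta (fun y => expR (eta * q y) * u y).

Let bmv eta u : bm u -> bm (fun y => expR (eta * q y) * u y).
Proof. by move=> bu; apply: bmM => //; apply: bm_exp; apply: bmZ; exact: bm_q. Qed.

(** Induction with [u] general: the Markov property absorbs the last factor of the product into [u],
    so the iterate of [K] grows from the inside ([iterSr]). *)
Let chain x s eta n (H : Om -> R) u : 0 <= s -> 0 <= eta -> abm F s H -> bm u ->
  Ex P x (fun w => H w * expR (\sum_(i < n) eta * q (X (s + i.+1%:R * eta) w)) *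
    u (X (s + n%:R * eta) w)) =
  Ex P x (fun w => H w * iter n (K eta) u (X s w)).
Proof.
move=> s0 eta0 bH; elim: n u => [|n ih] u bu.
  by apply: eq_Ex => w; rewrite big_ord0 expR0 mulr1 mul0r addr0.
have sn0 : 0 <= s + n%:R * eta by rewrite addr_ge0// mulr_ge0.
have e1 : s + n.+1%:R * eta = s + n%:R * eta + eta by rewrite -natr1; ring.
have bH2 : abm F (s + n%:R * eta)
    (fun w => H w * expR (\sum_(i < n) eta * q (X (s + i.+1%:R * eta) w))).
  apply: (@bmM R _ (g_sigma_algebraType (F (s + n%:R * eta)))).
    by apply: (abm_mono HX s0) bH; rewrite lerDl mulr_ge0.
  apply: (@bm_exp R _ (g_sigma_algebraType (F (s + n%:R * eta)))).
  exact: abm_psum.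
have bK : bm (K eta u) by apply: (bm_semigroup HX) => //; exact: bmv.
under [RHS]eq_Ex do rewrite iterSr.
rewrite -ih//.
have := markov_simple HX x sn0 eta0 bH2 (bmv eta bu); rewrite -/(K eta u) => <-.
by apply: eq_Ex => w; rewrite big_ord_recr/= expRD -e1; ring.
Qed.

(* The multiplicative functional [Zexp] is a limit of products over a grid, to
   which the one-time Markov property applies step by step. *)
Lemma markov_FK x s t (H : Om -> R) u : 0 <= s -> 0 <= t -> abm F s H -> bm u ->
  Ex P x (fun w => H w * (Zexp (s + t) w * u (X (s + t) w))) =
  Ex P x (fun w => H w * (Zexp s w * FK t u (X s w))).
Proof.
move=> s0 t0 bH bu; have st0 : 0 <= s + t by rewrite addr_ge0.
have eta0 n : 0 <= t / n.+1%:R by rewrite divr_ge0.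
have etaE n : n.+1%:R * (t / n.+1%:R) = t by rewrite mulrC divfK// pnatr_eq0.
pose a n y := Ex P y (fun w => expR (rsum 0 t n w) * u (X t w)).
have bHZ : abm F s (fun w => H w * Zexp s w).
  by apply: (@bmM R _ (g_sigma_algebraType (F s))) => //; exact: abm_Z.
have bHZ' := abm_bm HX s0 bHZ.
have [_ [CH HC]] := bHZ'; have [_ [Cu uC]] := bu.
have buX r : 0 <= r -> bm (fun w => u (X r w)) by move=> r0; exact: (bm_X HX).
have brs r n : 0 <= r -> bm (rsum r t n).
  by move=> r0; apply: (abm_bm HX (addr_ge0 r0 t0)); exact: abm_rsum.
have ers r n w : `|expR (rsum r t n w)| <= expR (C * t).
  rewrite ger0_norm ?expR_ge0// ler_expR (le_trans (ler_norm _))//.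
  exact: rsum_bound.
have bmK m eta : 0 <= eta -> bm (iter m (K eta) u).
  move=> h; elim: m => [//|m ihm]; rewrite iterS.
  by apply: (bm_semigroup HX) => //; exact: bmv.
(* The chain identity at [s = 0] with [H = 1]. As the inner expectation uses the same mesh, the two
   sides of [key] agree exactly before any limit is taken. *)
have aE n y : a n y = iter n.+1 (K (t / n.+1%:R)) u y.
  transitivity (Ex P y (fun w => cst 1 w * iter n.+1 (K (t / n.+1%:R)) u (X 0 w))).
    rewrite -chain//; last exact: (@bm_cst R _ (g_sigma_algebraType (F 0))).
    by apply: eq_Ex => w; rewrite mul1r etaE add0r.
  rewrite (Ex_X0 HE HX)//; [by rewrite Ex_cst mul1r|exact: bmK|exact: bm_cst].
have ba n : bm (a n).
  by apply: (bm_Ex HX); apply: bmM; [apply: bm_exp; exact: brs|exact: buX].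
have key n : Ex P x (fun w => (H w * Zexp s w) * expR (rsum s t n w) * u (X (s + t) w)) =
    Ex P x (fun w => (H w * Zexp s w) * a n (X s w)).
  have := @chain x s _ n.+1 _ _ s0 (eta0 n) bHZ bu; rewrite etaE => ->.
  by apply: eq_Ex => w; rewrite aE.
have aC n y : `|a n y| <= expR (C * t) * Cu.
  apply: Ex_norm_le => [|w]; last by rewrite normrM ler_pM.
  by apply: bmM; [apply: bm_exp; exact: brs|exact: buX].
have cvgexp r w : 0 <= r -> (fun n => expR (rsum r t n w)) @ \oo -->
    expR (tint (fun r => q (X r w)) (r + t) - tint (fun r => q (X r w)) r).
  move=> r0; exact: (cvg_comp (fun n => rsum r t n w) expR
    (@rsum_cvg r t w r0 t0) (@continuous_expR R _)).
have c1 : (fun n => Ex P x (fun w =>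
      (H w * Zexp s w) * expR (rsum s t n w) * u (X (s + t) w))) @ \oo -->
    Ex P x (fun w => H w * (Zexp (s + t) w * u (X (s + t) w))).
  apply: (@Ex_cvg _ _ _ _ _ _ _ _ _ (CH * expR (C * t) * Cu)).
  - move=> n; suff [] : bm (fun w => H w * Zexp s w * expR (rsum s t n w) * u (X (s + t) w)) by [].
    by apply: bmM; [apply: bmM => //; apply: bm_exp; exact: brs|exact: buX].
  - by move=> n w; rewrite normrM ler_pM// normrM ler_pM.
  - move=> w; have -> : H w * (Zexp (s + t) w * u (X (s + t) w)) = H w * Zexp s w *
      expR (tint (fun r => q (X r w)) (s + t) - tint (fun r => q (X r w)) s) *
      u (X (s + t) w).
      have -> : Zexp (s + t) w = Zexp s w *
          expR (tint (fun r => q (X r w)) (s + t) - tint (fun r => q (X r w)) s).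
        by rewrite /Zexp -expRD; congr expR; rewrite addrCA subrr addr0.
      by ring.
    by apply: cvgM; [apply: cvgM; [exact: cvg_cst|exact: cvgexp]|exact: cvg_cst].
have c2 : (fun n => Ex P x (fun w => (H w * Zexp s w) * a n (X s w))) @ \oo -->
    Ex P x (fun w => H w * (Zexp s w * FK t u (X s w))).
  apply: (@Ex_cvg _ _ _ _ _ _ _ _ _ (CH * (expR (C * t) * Cu))).
  - move=> n; suff [] : bm (fun w => H w * Zexp s w * a n (X s w)) by [].
    by apply: bmM => //; exact: (bm_X HX).
  - by move=> n w; rewrite normrM ler_pM.
  - move=> w; rewrite mulrA; apply: cvgM; first exact: cvg_cst.
    apply: (@Ex_cvg _ _ _ _ _ _ _ _ _ (expR (C * t) * Cu)).
    + move=> n; suff [] : bm (fun w' => expR (rsum 0 t n w') * u (X t w')) by [].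
      by apply: bmM; [apply: bm_exp; exact: brs|exact: buX].
    + by move=> n w'; rewrite normrM ler_pM.
    + move=> w'; apply: cvgM; last exact: cvg_cst.
      by have := cvgexp 0 w' (lexx 0); rewrite add0r tint0 subr0.
rewrite -(cvg_lim (@Rhausdorff R) c1) -(cvg_lim (@Rhausdorff R) c2).
by congr (lim (_ @ \oo)); apply/funext.
Qed.

Lemma FK_semigroup s t u y : 0 <= s -> 0 <= t -> bm u ->
  FK s (FK t u) y = FK (s + t) u y.
Proof.
move=> s0 t0 bu.
have := @markov_FK y s t (cst 1) u s0 t0 (@bm_cst R _ (g_sigma_algebraType (F s)) 1) bu.
by under eq_Ex do rewrite mul1r; under [RHS]eq_Ex do rewrite mul1r.
Qed.

Lemma FK0 u y : bm u -> FK 0 u y = u y.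
Proof.
move=> bu; rewrite /FK (Ex_X0 HE HX)//; last exact: bm_Z.
by under eq_Ex do rewrite Zexp0; rewrite Ex_cst mul1r.
Qed.

End feynman_kac.

(** * Optimal stopping on a grid *)

Section grid_stopping.
Context {R : realType} {dE dO : measure_display}
  {E : measurableType dE} {Om : measurableType dO}.
Variables (X : R -> Om -> E) (P : E -> probability Om R) (F : R -> set (set Om))
  (rho : E -> E -> R).
Hypotheses (HE : lcs_metric_borel rho) (HX : standard_feller_markov X P F rho).
Variables (q : E -> R) (C : R).
Hypotheses (cq : rcontinuous rho q) (qC : forall x, `|q x| <= C).
Variable G : E -> R.
Hypotheses (bG : bm G) (G0 : forall x, 0 <= G x).

Local Notation Z := (Zexp X q).
Local Notation FK := (FK X P q).

(* The value of stopping at one of the times [0, d, .., n d] with reward [G]. *)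
Definition Vn (d : R) (n : nat) : E -> R :=
  iter n (fun u y => Num.max (FK d u y) (G y)) G.

Lemma VnS d n y : Vn d n.+1 y = Num.max (FK d (Vn d n) y) (G y).
Proof. by []. Qed.

Lemma bm_Vn d n : 0 <= d -> bm (Vn d n).
Proof.
move=> d0; elim: n => [//|n ih]; apply: bm_max => //.
exact: (bm_FK HE HX cq qC).
Qed.

Lemma Vn_geG d n y : G y <= Vn d n y.
Proof. by case: n => [//|n]; rewrite VnS le_max lexx orbT. Qed.

Lemma Vn_ge0 d n y : 0 <= Vn d n y.
Proof. exact: le_trans (G0 y) (Vn_geG d n y). Qed.

Let FK_le t u v y := @FK_le _ _ _ _ _ X P F rho HE HX q C cq qC t u v y.
Let bmF t u := @bm_FK _ _ _ _ _ X P F rho HE HX q C cq qC t u.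

Lemma Vn_leS d n y : 0 <= d -> Vn d n y <= Vn d n.+1 y.
Proof.
move=> d0; elim: n y => [|n ih] y; first exact: Vn_geG.
rewrite VnS [leRHS]VnS ge_max !le_max lexx orbT andbT.
by apply/orP; left; apply: FK_le => //; exact: bm_Vn.
Qed.

Lemma Vn_homo d m n y : 0 <= d -> (m <= n)%N -> Vn d m y <= Vn d n y.
Proof.
move=> d0 /subnK <-; elim: (n - m)%N => [//|k ih].
by rewrite addSn (le_trans ih)// Vn_leS.
Qed.

(** Waiting [j] steps and then playing an [m]-step strategy is one of the strategies with [m + j]
    steps. *)
Lemma FK_Vn d j m y : 0 <= d -> FK (j%:R * d) (Vn d m) y <= Vn d (m + j) y.
Proof.
move=> d0; elim: j m y => [|j ih] m y.
  by rewrite mul0r (FK0 HE HX cq qC) ?addn0//; exact: bm_Vn.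
have jd : 0 <= j%:R * d by rewrite mulr_ge0.
rewrite -natr1 mulrDl mul1r -(FK_semigroup HE HX cq qC)//; last exact: bm_Vn.
rewrite -addSnnS; apply: le_trans (ih _ _).
apply: FK_le => //; [by apply: bmF => //; exact: bm_Vn|exact: bm_Vn|move=> x].
by rewrite VnS le_max lexx.
Qed.

Lemma Vn_refine d n y : 0 <= d -> Vn (2 * d) n y <= Vn d (n * 2) y.
Proof.
move=> d0; have d20 : 0 <= 2 * d by rewrite mulr_ge0.
elim: n y => [//|n ih] y; rewrite VnS ge_max Vn_geG andbT.
apply: (@le_trans _ _ (FK (2 * d) (Vn d (n * 2)) y)).
  by apply: FK_le => //; exact: bm_Vn.
by apply: (le_trans (FK_Vn 2 (n * 2) y d0)); rewrite mulSn addnC.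
Qed.

(** Unrolling the inequality [n] times, what is stopped on the way is paid by [Vn] and what is never
    stopped by the terminal term. *)
Lemma subsolution_le d (W : E -> R) n y : 0 <= d -> bm W -> (forall x, 0 <= W x) ->
  (forall x, W x <= Num.max (FK d W x) (G x)) ->
  W y <= Vn d n y + FK (n%:R * d) W y.
Proof.
move=> d0 bW W0 h; elim: n y => [|n ih] y.
  by rewrite mul0r (FK0 HE HX cq qC)// lerDr.
have nd : 0 <= n%:R * d by rewrite mulr_ge0.
have e : FK (n.+1%:R * d) W y = FK d (FK (n%:R * d) W) y.
  rewrite (FK_semigroup HE HX cq qC)//; congr (Defs.Ex _ _ _).
  by rewrite -natr1 mulrDl mul1r addrC.
apply: (le_trans (h y)); rewrite VnS ge_max; apply/andP; split.
  rewrite (@le_trans _ _ (FK d (fun x => Vn d n x + FK (n%:R * d) W x) y))//.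
    by apply: FK_le => //; apply: bmD; [exact: bm_Vn|exact: bmF].
  rewrite (FKD HE HX cq qC)//; [|exact: bm_Vn|exact: bmF].
  by rewrite e lerD2r le_max lexx.
rewrite (@le_trans _ _ (Vn d n.+1 y)) ?Vn_geG//= lerDl.
exact: FK_ge0.
Qed.

Lemma bm_tau (N : nat) (tau : Om -> nat) (a : nat -> Om -> R) :
  (forall w, tau w <= N)%N -> (forall i, measurable [set w | tau w = i]) ->
  (forall i, bm (a i)) -> bm (fun w => a (tau w) w).
Proof.
move=> tN mt ba.
rewrite (_ : (fun w => _) = fun w => \sum_(i < N.+1) \1_[set w | tau w = i] w * a i w).
  by apply: (bm_sum (u := fun i w => \1_[set w | tau w = i] w * a i w)) => i _;
    apply: bmM => //; exact: bm_indic.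
apply/funext => w; rewrite (bigD1 (Ordinal (tN w : (tau w < N.+1)%N)))//=.
rewrite big1 => [|i /eqP iw]; last first.
  rewrite indicE memNset ?mul0r//= => tw; apply: iw; exact/val_inj.
by rewrite indicE mem_set//= mul1r addr0.
Qed.

Section supersolution.
Variables (d : R) (W : E -> R) (B : set E) (tau : Om -> nat) (N : nat).
Hypotheses (d0 : 0 <= d) (bW : bm W) (GW : forall y, G y <= W y) (mB : measurable B).
Hypothesis (WB : forall y, B y -> FK d W y <= W y).
Hypotheses (tN : forall w, (tau w <= N)%N)
  (Ft : forall i, F (i%:R * d) [set w | tau w = i]).

Let id0 (i : nat) : 0 <= i%:R * d. Proof. by rewrite mulr_ge0. Qed.

(** The index is strict: [FK d W <= W] is used at the times where the path continues, not at the
    time where it stops. *)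
Definition inB (n : nat) : set Om := [set w | forall j, (j < n)%N -> B (X (j%:R * d) w)].

Lemma F_inB n i : (n <= i.+1)%N -> F (i%:R * d) (inB n).
Proof.
move=> ni; rewrite (_ : inB n =
    ~` (\bigcup_(j in [set j | (j < n)%N]) ~` (X (j%:R * d) @^-1` B))).
  apply: (F_setC HX) => //; apply: (F_bigcup HX) => // j jn; apply: (F_setC HX) => //.
  apply: (F_mono HX (id0 j)); last exact: (F_X HX).
  by rewrite ler_wpM2r// ler_nat -ltnS (leq_trans jn).
rewrite setC_bigcup; apply/seteqP; split => w h j jn; first by rewrite /= => /(_ (h j jn)).
by apply: contrapT; exact: h j jn.
Qed.

Let F_tau_ge n i : (n <= i.+1)%N -> F (i%:R * d) [set w | (n <= tau w)%N].
Proof.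
move=> ni; rewrite (_ : mkset _ =
    ~` (\bigcup_(j in [set j | (j < n)%N]) [set w | tau w = j])).
  apply: (F_setC HX) => //; apply: (F_bigcup HX) => // j jn.
  apply: (F_mono HX (id0 j)); last exact: Ft.
  by rewrite ler_wpM2r// ler_nat -ltnS (leq_trans jn).
apply/seteqP; split => w /=.
  by move=> nt [j /= jn tj]; move: nt; rewrite tj leqNgt jn.
by move=> h; rewrite leqNgt; apply/negP => tn; apply: h; exists (tau w).
Qed.

Let a (n : nat) w := (\1_[set w | tau w = n] w * \1_(inB n) w) *
  (Z (n%:R * d) w * G (X (n%:R * d) w)).
Let H (n : nat) w : R := \1_([set w | (n <= tau w)%N] `&` inB n) w.

Let bZX t u := @bm_ZX _ _ _ _ _ X P F rho HE HX q C cq qC t u.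

Let mtau n : measurable [set w | tau w = n].
Proof. by apply: (F_measurable HX (id0 n)); exact: Ft. Qed.

Let minB n : measurable (inB n).
Proof. by apply: (F_measurable HX (id0 n)); exact: F_inB. Qed.

Let ba n : bm (a n).
Proof.
apply: bmM; last exact: bZX.
by apply: bmM; apply: bm_indic.
Qed.

Let FH n i : (n <= i.+1)%N -> F (i%:R * d) ([set w | (n <= tau w)%N] `&` inB n).
Proof. by move=> ni; apply: (F_setI HX) => //; [exact: F_tau_ge|exact: F_inB]. Qed.

Let bH n : bm (H n).
Proof. by apply: bm_indic; apply: (F_measurable HX (id0 n)); exact: FH. Qed.

(** On paths with [tau = n] the reward is at most [W]. On the others the event in [H n.+1] is
    already decided at time [n * d], so the Markov property turns the next value of [W] into
    [FK d W], and the path is still in [B]. *)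
Let step x n : Ex P x (a n) +
    Ex P x (fun w => H n.+1 w * (Z (n.+1%:R * d) w * W (X (n.+1%:R * d) w))) <=
  Ex P x (fun w => H n w * (Z (n%:R * d) w * W (X (n%:R * d) w))).
Proof.
have W0 y : 0 <= W y by exact: le_trans (G0 y) (GW y).
have -> : n.+1%:R * d = n%:R * d + d by rewrite -natr1 mulrDl mul1r.
have -> : Ex P x (fun w => H n.+1 w *
      (Z (n%:R * d + d) w * W (X (n%:R * d + d) w))) =
    Ex P x (fun w => H n.+1 w * (Z (n%:R * d) w * FK d W (X (n%:R * d) w))).
  exact: (markov_FK HE HX cq qC x (id0 n) d0
    (abm_indic HX (id0 n) (FH (leqnn n.+1))) bW).
rewrite -ExD//; last by apply: bmM => //; apply: bZX => //; exact: bmF.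
apply: Ex_le; [apply: bmD => //; apply: bmM => //; apply: bZX => //; exact: bmF|
  by apply: bmM => //; exact: bZX|move=> w].
rewrite /a /H.
have Z0 := ltW (Zexp_gt0 X q (n%:R * d) w).
have [wD|wD] := pselect (inB n w); last first.
  rewrite !indicE (memNset wD) !mulr0 mul0r add0r memNset; last first.
    by move=> [_ h]; apply: wD => j jn; apply: h; rewrite ltnS ltnW.
  by rewrite mul0r memNset ?mul0r// => -[].
have [tw|tw] := eqVneq (tau w) n.
  rewrite !indicE (mem_set wD) (@memNset _ (_ `&` inB n.+1)); last first.
    by move=> [/= + _]; rewrite tw ltnn.
  rewrite mul0r addr0 !mem_set ?mul1r//; last by split => //=; rewrite tw.
  by rewrite ler_wpM2l.
rewrite !indicE (@memNset _ [set w | tau w = n]); last by move=> /= tn; rewrite tn eqxx in tw.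
rewrite !mul0r add0r.
have [wn|wn] := pselect (([set w | (n < tau w)%N] `&` inB n.+1) w); last first.
  by rewrite (memNset wn) mul0r mulr_ge0// mulr_ge0.
rewrite !mem_set//; last by case: wn => /= h _; split => //; exact: ltnW.
by rewrite !mul1r ler_wpM2l//; apply: WB; case: wn => _; apply.
Qed.

Lemma supersolution_ge x :
  Ex P x (fun w => \1_(inB (tau w)) w *
    (Z ((tau w)%:R * d) w * G (X ((tau w)%:R * d) w))) <= W x.
Proof.
have W0 y : 0 <= W y by exact: le_trans (G0 y) (GW y).
(* Reward collected before index [n] plus the value of [W] on the paths still running: it starts at
   [W x] and never increases. *)
pose Phi n := Ex P x (fun w => \sum_(j < n) a j w) +
  Ex P x (fun w => H n w * (Z (n%:R * d) w * W (X (n%:R * d) w))).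
have PhiS n : Phi n.+1 <= Phi n.
  rewrite /Phi; under [X in Ex P x X + _]eq_fun do rewrite big_ord_recr/=.
  rewrite ExD//; last exact: bm_sum.
  by rewrite -addrA lerD2l; exact: step.
have Phi0 : Phi 0%N = W x.
  rewrite /Phi; under eq_Ex do rewrite big_ord0.
  rewrite Ex_cst add0r -[RHS](FK0 HE HX cq qC)//; apply: eq_Ex => w.
  by rewrite mul0r /H indicE mem_set ?mul1r.
have Phi_le n : Phi n <= W x.
  by elim: n => [|n ih]; [rewrite Phi0|exact: le_trans (PhiS n) ih].
apply: le_trans (Phi_le N.+1); rewrite /Phi -[leLHS]addr0; apply: lerD; last first.
  by apply: Ex_ge0 => w; rewrite mulr_ge0// ?mulr_ge0 ?indicE// ltW// Zexp_gt0.
rewrite (_ : (fun w => _) = (fun w => \sum_(j < N.+1) a j w))//.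
apply/funext => w; rewrite (bigD1 (Ordinal (tN w : (tau w < N.+1)%N)))//=.
rewrite big1 => [|i /eqP iw]; last first.
  rewrite /a indicE memNset ?mul0r//= => tw; apply: iw; exact/val_inj.
rewrite addr0 /a (_ : \1_[set w0 | tau w0 = tau w] w = 1) ?mul1r//.
by rewrite indicE mem_set.
Qed.

End supersolution.

Lemma Vn_attained (d : R) (n : nat) : 0 <= d ->
  exists tau : Om -> nat, [/\ forall w, (tau w <= n)%N,
    forall i, F (i%:R * d) [set w | tau w = i] &
    forall x, Vn d n x =
      Ex P x (fun w => Z ((tau w)%:R * d) w * G (X ((tau w)%:R * d) w))].
Proof.
move=> d0; have id0 (i : nat) : 0 <= i%:R * d by rewrite mulr_ge0.
have bZX t u := @bm_ZX _ _ _ _ _ X P F rho HE HX q C cq qC t u.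
(* [tau] stops at the first index at least [n - k] where the value is [G]. *)
suff claim k : (k <= n)%N -> exists tau : Om -> nat,
    [/\ forall w, (n - k <= tau w <= n)%N,
      forall i, F (i%:R * d) [set w | tau w = i] &
      forall x H, abm F ((n - k)%:R * d) H ->
        Ex P x (fun w => H w * (Z ((n - k)%:R * d) w * Vn d k (X ((n - k)%:R * d) w))) =
        Ex P x (fun w => H w * (Z ((tau w)%:R * d) w * G (X ((tau w)%:R * d) w)))].
  have [tau [t1 t2 t3]] := claim n (leqnn n).
  exists tau; split => // [w|x]; first by have /andP[] := t1 w.
  rewrite subnn in t3; have := t3 x (cst 1) (@bm_cst R _ (g_sigma_algebraType _) 1).
  under eq_Ex do rewrite mul1r; under [in RHS]eq_Ex do rewrite mul1r.
  move=> <-; rewrite mul0r -[LHS](FK0 HE HX cq qC)//; exact: bm_Vn.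
elim: k => [_|k ih kn].
  exists (cst n); split => [w|i|x H bH] /=; rewrite ?subn0 ?leqnn//.
  have [->|ni] := eqVneq n i.
    by rewrite (_ : mkset _ = setT); [exact: (F_setT HX)|apply/seteqP; split].
  rewrite (_ : mkset _ = ~` setT); first by apply: (F_setC HX) => //; exact: (F_setT HX).
  by apply/seteqP; split => w //= nE; rewrite nE eqxx in ni.
have [tau [t1 t2 t3]] := ih (ltnW kn).
pose i := (n - k.+1)%N; have iS : (n - k = i.+1)%N by rewrite /i; lia.
rewrite iS in t1 t3; rewrite -/i.
(* The continuation region at index [i]: on [A] the maximum defining [Vn] is its [FK] branch, and
   off [A] it equals [G]. *)
pose A := [set w | G (X (i%:R * d) w) < Vn d k.+1 (X (i%:R * d) w)].
have FA : F (i%:R * d) A.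
  by apply: (abm_lt HX) => //; apply: (abm_X HX) => //; exact: bm_Vn.
have mA := F_measurable HX (id0 i) FA.
pose sig w := if `[< A w >] then tau w else i.
have sigA w : A w -> sig w = tau w by move=> Aw; rewrite /sig asboolT.
have sigNA w : ~ A w -> sig w = i by move=> Aw; rewrite /sig asboolF.
have Fsig j : F (j%:R * d) [set w | sig w = j].
  have [ij|ji|ij] := ltngtP i j.
  - rewrite (_ : mkset _ = A `&` [set w | tau w = j]).
      apply: (F_setI HX) => //; apply: (F_mono HX (id0 i)) FA.
      by rewrite ler_wpM2r// ler_nat ltnW.
    apply/seteqP; split => w /=.
      have [Aw|Aw] := pselect (A w); first by rewrite sigA.
      by rewrite sigNA// => ije; rewrite ije ltnn in ij.
    by move=> [Aw]; rewrite sigA.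
  - rewrite (_ : mkset _ = ~` setT); first by apply: (F_setC HX) => //; exact: (F_setT HX).
    apply/seteqP; split => w //= sj _; have [Aw|Aw] := pselect (A w).
      by have /andP[+ _] := t1 w; rewrite -(sigA w Aw) sj; lia.
    by move: ji; rewrite -sj sigNA// ltnn.
  - rewrite -ij (_ : mkset _ = ~` A); first exact: (F_setC HX).
    apply/seteqP; split => w /=; last exact: sigNA.
    by move=> sj Aw; have /andP[+ _] := t1 w; rewrite -(sigA w Aw) sj ltnn.
have mtau j : measurable [set w | tau w = j] by apply: (F_measurable HX (id0 j)).
have msig j : measurable [set w | sig w = j] by apply: (F_measurable HX (id0 j)).
have tN w : (tau w <= n)%N by have /andP[] := t1 w.
have bG' j : bm (fun w => Z (j%:R * d) w * G (X (j%:R * d) w)) by exact: bZX.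
exists sig; split => // [w|x H bH].
  rewrite /sig; case: ifP => _; last by rewrite leqnn /i leq_subr.
  by have /andP[h1 h2] := t1 w; rewrite h2 andbT ltnW.
have bH' := abm_bm HX (id0 i) bH.
have bHA : abm F (i%:R * d) (fun w => H w * \1_A w).
  exact: (@bmM R _ (g_sigma_algebraType (F (i%:R * d))) _ _ bH
    (abm_indic HX (id0 i) FA)).
have bHA' := abm_bm HX (id0 i) bHA.
have i1 : i.+1%:R * d = i%:R * d + d by rewrite -natr1 mulrDl mul1r.
have bHA1 : abm F (i.+1%:R * d) (fun w => H w * \1_A w).
  by apply: (abm_mono HX (id0 i)) bHA; rewrite i1 lerDl.
have bAc : bm (fun w => H w * \1_(~` A) w * (Z (i%:R * d) w * G (X (i%:R * d) w))).
  by apply: bmM => //; apply: bmM => //; apply: bm_indic; exact: measurableC.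
have bVk := bm_Vn k d0.
transitivity (Ex P x (fun w => H w * \1_A w * (Z (i%:R * d) w * FK d (Vn d k) (X (i%:R * d) w)) +
    H w * \1_(~` A) w * (Z (i%:R * d) w * G (X (i%:R * d) w)))).
  apply: eq_Ex => w; rewrite !indicE in_setC; have [Aw|Aw] := boolP (w \in A).
    rewrite mulr1 mulr0 mul0r addr0; congr (_ * (_ * _)).
    have : G (X (i%:R * d) w) < Vn d k.+1 (X (i%:R * d) w) by exact: set_mem Aw.
    by rewrite VnS lt_max ltxx orbF => h; rewrite (max_idPl (ltW h)).
  rewrite mulr0 mul0r add0r mulr1; congr (_ * (_ * _)).
  apply/le_anti; rewrite Vn_geG andbT leNgt; apply/negP => h.
  by move/negP: Aw; apply; rewrite inE.
rewrite ExD//; last by apply: bmM => //; apply: bZX => //; exact: bmF.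
have -> : Ex P x (fun w => H w * \1_A w *
      (Z (i%:R * d) w * FK d (Vn d k) (X (i%:R * d) w))) =
    Ex P x (fun w => H w * \1_A w * (Z (i.+1%:R * d) w * Vn d k (X (i.+1%:R * d) w))).
  by rewrite i1; exact: esym (markov_FK HE HX cq qC x (id0 i) d0 bHA bVk).
rewrite (t3 x _ bHA1) -ExD//; last first.
  by apply: bmM => //; exact: (bm_tau tN mtau bG').
apply: eq_Ex => w; rewrite !indicE in_setC; have [Aw|Aw] := boolP (w \in A).
  by rewrite mulr1 mulr0 mul0r addr0 sigA//; exact/set_mem.
have Aw' : ~ A w by move=> Aw'; move/negP: Aw; apply; exact: mem_set.
by rewrite mulr0 mul0r add0r mulr1 sigNA.
Qed.

End grid_stopping.

(** * Optimal stopping over bounded stopping times *)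

Definition dl {R : realType} (k : nat) : R := (2 ^+ k)^-1.

Lemma dl_gt0 {R : realType} k : 0 < dl k :> R.
Proof. by rewrite invr_gt0 exprn_gt0. Qed.

Lemma dlS {R : realType} k : dl k = 2 * dl k.+1 :> R.
Proof. by rewrite /dl exprS invfM mulrA mulfV ?mul1r. Qed.

Lemma dlD {R : realType} k j : dl k = (2 ^ j)%:R * dl (k + j) :> R.
Proof. by rewrite /dl natrX exprD invfM mulrCA mulfV ?mulr1// expf_neq0. Qed.

Lemma dl_mul {R : realType} (m k : nat) : (m * 2 ^ k)%:R * dl k = m%:R :> R.
Proof. by rewrite /dl natrM natrX mulfK// expf_neq0. Qed.

Lemma cvg_dl {R : realType} : @dl R @ \oo --> (0 : R).
Proof.
rewrite (_ : dl = fun k => (2^-1 : R) ^+ k); last by apply/funext => k; rewrite /dl exprVn.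
by apply: cvg_expr; rewrite ger0_norm ?invr_ge0// invf_lt1// ltr1n.
Qed.

Section value_function.
Context {R : realType} {dE dO : measure_display}
  {E : measurableType dE} {Om : measurableType dO}.
Variables (X : R -> Om -> E) (P : E -> probability Om R) (F : R -> set (set Om))
  (rho : E -> E -> R).
Hypotheses (HE : lcs_metric_borel rho) (HX : standard_feller_markov X P F rho).
Variables (q : E -> R) (C : R).
Hypotheses (cq : rcontinuous rho q) (qC : forall x, `|q x| <= C).
Variable G : E -> R.
Hypotheses (bG : bm G) (G0 : forall x, 0 <= G x).

Local Notation Z := (Zexp X q).
Local Notation FK := (FK X P q).
Local Notation Vn := (Vn X P q G).

Let bmF t u := @bm_FK _ _ _ _ _ X P F rho HE HX q C cq qC t u.
Let bZX t u := @bm_ZX _ _ _ _ _ X P F rho HE HX q C cq qC t u.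
Let bVn d n := @bm_Vn _ _ _ _ _ X P F rho HE HX q C cq qC G bG d n.
Let Z0 t w : 0 <= Z t w := ltW (Zexp_gt0 X q t w).

(** A conditional Jensen inequality obtained from the Markov property: the event [A] where the
    second term wins belongs to [F s], and choosing by [A] at time [s] is no better than taking the
    maximum at time [s + t]. *)
Lemma jensen_max x s t (Y : Om -> R) u : 0 <= s -> 0 <= t -> abm F s Y -> bm u ->
  Ex P x (fun w => Num.max (Y w) (Z s w * FK t u (X s w))) <=
  Ex P x (fun w => Num.max (Y w) (Z (s + t) w * u (X (s + t) w))).
Proof.
move=> s0 t0 aY bu; have st0 : 0 <= s + t by rewrite addr_ge0.
pose A := [set w | Y w < Z s w * FK t u (X s w)].
have FA : F s A.
  apply: (abm_lt HX) => //; apply: (@bmM R _ (g_sigma_algebraType (F s))).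
    exact: (abm_Z HE HX cq qC).
  by apply: (abm_X HX) => //; exact: bmF.
have mA := F_measurable HX s0 FA.
have aA := abm_indic HX s0 FA.
have bA := abm_bm HX s0 aA.
have bY := abm_bm HX s0 aY.
have bAY : bm (fun w => (1 - \1_A w) * Y w).
  by apply: bmM => //; apply: bmB => //; exact: bm_cst.
rewrite [leLHS](_ : _ = Ex P x (fun w => \1_A w * (Z s w * FK t u (X s w)) +
    (1 - \1_A w) * Y w)); last first.
  apply: eq_Ex => w; rewrite indicE; have [|] := boolP (w \in A).
    by rewrite inE => Aw; rewrite (max_idPr (ltW Aw)) mul1r subrr mul0r addr0.
  rewrite notin_setE => /negP; rewrite -leNgt => Aw.
  by rewrite (max_idPl Aw) mul0r subr0 mul1r add0r.
rewrite ExD//; last by apply: bmM => //; apply: bZX => //; exact: bmF.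
rewrite -(markov_FK HE HX cq qC x s0 t0 aA bu) -ExD//; last first.
  by apply: bmM => //; exact: bZX.
apply: Ex_le.
- by apply: bmD => //; apply: bmM => //; exact: bZX.
- by apply: bm_max => //; exact: bZX.
move=> w; rewrite indicE; case: (w \in A).
  by rewrite mul1r subrr mul0r addr0 le_max lexx orbT.
by rewrite mul0r subr0 mul1r add0r le_max lexx.
Qed.

(* The largest discounted reward seen before index [j] (at least [0]). *)
Fixpoint Psi (d : R) (j : nat) (w : Om) : R :=
  if j is i.+1 then Num.max (Psi d i w) (Z (i%:R * d) w * G (X (i%:R * d) w)) else 0.

Lemma abm_Psi d j i : 0 <= d -> (j <= i.+1)%N -> abm F (i%:R * d) (Psi d j).
Proof.
move=> d0; elim: j => [|j ih] ji.
  exact: (@bm_cst R _ (g_sigma_algebraType (F (i%:R * d)))).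
have jd : 0 <= j%:R * d by rewrite mulr_ge0.
apply: (@bm_max R _ (g_sigma_algebraType (F (i%:R * d)))); first exact/ih/ltnW.
apply: (abm_mono HX jd); first by rewrite ler_wpM2r// ler_nat.
apply: (@bmM R _ (g_sigma_algebraType (F (j%:R * d)))).
  exact: (abm_Z HE HX cq qC).
exact: (abm_X HX).
Qed.

Lemma bm_Psi d j : 0 <= d -> bm (Psi d j).
Proof.
by move=> d0; apply: (abm_bm HX) (abm_Psi d0 (leqnSn j)); rewrite mulr_ge0.
Qed.

Lemma Psi_le d j w b : 0 <= b ->
  (forall i, (i < j)%N -> Z (i%:R * d) w * G (X (i%:R * d) w) <= b) -> Psi d j w <= b.
Proof.
move=> b0; elim: j => [//|j ih] h /=; rewrite ge_max h// andbT.
by apply: ih => i ij; apply: h; rewrite ltnW.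
Qed.

(** The first [j] decisions are handed to a player who sees the path up to that time; each index
    given up costs one application of [jensen_max]. *)
Lemma perfect_foresight d j m x : 0 <= d -> Vn d (m + j) x <=
  Ex P x (fun w => Num.max (Psi d j w) (Z (j%:R * d) w * Vn d m (X (j%:R * d) w))).
Proof.
move=> d0; elim: j m => [|j ih] m.
  rewrite addn0 mul0r -[leLHS](FK0 HE HX cq qC); last exact: bVn.
  apply: Ex_le; [exact: bZX (lexx 0) (bVn _ d0)| |move=> w].
    by apply: bm_max; [exact: bm_cst|exact: bZX (lexx 0) (bVn _ d0)].
  by rewrite le_max lexx orbT.
have jd : 0 <= j%:R * d by rewrite mulr_ge0.
rewrite -addSnnS; apply: (le_trans (ih m.+1)).
rewrite (_ : (fun w => _) = fun w => Num.max (Psi d j.+1 w)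
    (Z (j%:R * d) w * FK d (Vn d m) (X (j%:R * d) w))); last first.
  by apply/funext => w; rewrite VnS maxr_pMr// maxA -!maxA; congr Num.max; rewrite maxC.
have -> : j.+1%:R * d = j%:R * d + d by rewrite -natr1 mulrDl mul1r.
by apply: jensen_max => //; [exact: abm_Psi|exact: bVn].
Qed.

Hypothesis G1 : forall x, G x <= 1.

Let C0 (x : E) : 0 <= C. Proof. exact: le_trans (normr_ge0 (q x)) (qC x). Qed.

Lemma ZG_le (s t : R) w : 0 <= s -> s <= t -> Z s w * G (X s w) <= expR (C * t).
Proof.
move=> s0 st; rewrite -[leRHS]mulr1 ler_pM//.
have /andP[_ h] := Zexp_le HE HX cq qC w s0.
by rewrite (le_trans h)// ler_expR ler_wpM2l// (C0 (X 0 w)).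
Qed.

(** The value is bounded by itself: beyond the horizon [N * d] it is discounted by [theta], before
    it the reward is at most [K], so its supremum [S] satisfies [S <= K + S * theta]. *)
Lemma Vn_bound d (N n : nat) (theta : R) y : 0 <= d -> 0 <= theta < 1 ->
  (forall x, FK (N%:R * d) (cst 1) x <= theta) ->
  Vn d n y <= expR (C * (N%:R * d)) / (1 - theta).
Proof.
move=> d0 /andP[th0 th1] hth; have Nd : 0 <= N%:R * d by rewrite mulr_ge0.
set K := expR _; have K0 : 0 <= K by exact: expR_ge0.
pose S := range (Vn d n).
have [_ [D VD]] := bVn n d0.
have hS : has_sup S.
  split; first by exists (Vn d n y); exists y.
  by exists D => _ [x _ <-]; exact: le_trans (ler_norm _) (VD x).
have s0 : 0 <= sup S.
  by apply: (le_trans (Vn_ge0 X P q G0 d n y)); apply: ub_le_sup; [case: hS|exists y].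
have VS x : Vn d n x <= sup S by apply: ub_le_sup; [case: hS|exists x].
have key x : Vn d n x <= K + sup S * theta.
  apply: (le_trans (Vn_homo HE HX cq qC bG x d0 (leq_addr N n))).
  apply: (le_trans (perfect_foresight N n x d0)).
  have b1 : bm (fun w => Z (N%:R * d) w * cst 1 (X (N%:R * d) w)).
    by apply: bZX => //; exact: bm_cst.
  apply: (@le_trans _ _ (Ex P x (fun w => K + sup S *
      (Z (N%:R * d) w * cst 1 (X (N%:R * d) w))))).
    apply: Ex_le.
    - by apply: bm_max; [exact: bm_Psi|apply: bZX => //; exact: bVn].
    - by apply: bmD; [exact: bm_cst|exact: bmZ].
    move=> w; rewrite ge_max; apply/andP; split.
      rewrite -[leLHS]addr0 lerD ?mulr_ge0// Psi_le// => i iN.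
      apply: ZG_le; first by rewrite mulr_ge0.
      by rewrite ler_wpM2r// ler_nat ltnW.
    by rewrite mulr1 -[leLHS]add0r lerD// mulrC ler_wpM2r.
  rewrite ExD ?ExZ ?Ex_cst//; [|exact: bm_cst|exact: bmZ].
  by rewrite lerD2l ler_wpM2l//; exact: hth.
have sK : sup S <= K + sup S * theta.
  by apply: ge_sup; [case: hS|move=> _ [x _ <-]; exact: key].
rewrite (le_trans (VS y))// ler_pdivlMr ?subr_gt0//; lra.
Qed.

Variables (M : nat) (theta : R).
Hypotheses (th01 : 0 <= theta < 1) (FKth : forall x, FK M%:R (cst 1) x <= theta).

(** The previous bound at the horizon [M], reached in [M * 2 ^ k] steps of length [dl k]; it is the
    same on all dyadic grids. *)
Definition Vbd : R := expR (C * M%:R) / (1 - theta).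

Lemma Vn_le_Vbd k n y : Vn (dl k) n y <= Vbd.
Proof.
have := @Vn_bound (dl k) (M * 2 ^ k) n theta y (ltW (dl_gt0 k)) th01.
by rewrite dl_mul; apply.
Qed.

Let d0 k : 0 <= dl k :> R := ltW (dl_gt0 k).

Lemma Vn_refine_pow k j n y : Vn (dl k) n y <= Vn (dl (k + j)) (n * 2 ^ j) y.
Proof.
elim: j => [|j ih]; first by rewrite addn0 muln1.
apply: (le_trans ih); rewrite dlS -addnS expnSr mulnA.
exact: (Vn_refine HE HX cq qC bG).
Qed.

(* [Un] increases with [n] and dominates [Vn (dl k) m] for [n >= k, m]. *)
Definition Un n y := Vn (dl n) (n * 2 ^ n) y.

Lemma Vn_le_Un k m y : Vn (dl k) m y <= Un (maxn k m) y.
Proof.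
have kE : (k + (maxn k m - k) = maxn k m)%N by rewrite subnKC// leq_maxl.
apply: (le_trans (Vn_refine_pow k (maxn k m - k) m y)); rewrite kE.
apply: (Vn_homo HE HX cq qC bG) => //.
by rewrite leq_mul ?leq_maxr// leq_exp2l// leq_subr.
Qed.

Lemma Un_nd y : nondecreasing_seq (Un ^~ y).
Proof.
apply/nondecreasing_seqP => n.
apply: (le_trans (Vn_refine_pow n 1 (n * 2 ^ n) y)); rewrite addn1.
apply: (Vn_homo HE HX cq qC bG) => //.
by rewrite -mulnA -expnSr leq_mul.
Qed.

Definition Wv y : R := sup (range (Un ^~ y)).

Let Un_ub y : has_ubound (range (Un ^~ y)).
Proof. by exists Vbd => _ [n _ <-]; exact: Vn_le_Vbd. Qed.

Lemma Un_cvg y : Un ^~ y @ \oo --> Wv y.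
Proof. by apply: nondecreasing_cvgn; [exact: Un_nd|exact: Un_ub]. Qed.

Lemma Vn_le_Wv k m y : Vn (dl k) m y <= Wv y.
Proof.
by apply: (le_trans (Vn_le_Un k m y)); apply: ub_le_sup; [exact: Un_ub|exists (maxn k m)].
Qed.

Lemma Wv_le y b : (forall k m, Vn (dl k) m y <= b) -> Wv y <= b.
Proof. by move=> h; apply: ge_sup => [|_ [n _ <-]]; [exists (Un 0 y); exists 0%N|exact: h]. Qed.

Lemma Wv_geG y : G y <= Wv y.
Proof. exact: (Vn_le_Wv 0 0 y). Qed.

Lemma Wv_le_Vbd y : Wv y <= Vbd.
Proof. by apply: Wv_le => k m; exact: Vn_le_Vbd. Qed.

Let Wv0 y : 0 <= Wv y. Proof. exact: le_trans (G0 y) (Wv_geG y). Qed.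

Lemma bm_Wv : bm Wv.
Proof.
split; last by exists Vbd => y; rewrite ger0_norm// Wv_le_Vbd.
apply: (@measurable_fun_cvg _ E R setT Un) => [n|y _]; last exact: Un_cvg.
by have [] := bVn (n * 2 ^ n) (d0 n).
Qed.

(** A time of the grid [dl k] is a time of every finer grid, so [FK_Vn] bounds the operator applied
    to [Un n] for [n >= k]; dominated convergence passes to [Wv]. *)
Lemma FK_Wv k j y : FK (j%:R * dl k) Wv y <= Wv y.
Proof.
have jd : 0 <= j%:R * dl k :> R by rewrite mulr_ge0.
have bU n : bm (Un n) := bVn (n * 2 ^ n) (d0 n).
have cU : (fun n => FK (j%:R * dl k) (Un n) y) @ \oo --> FK (j%:R * dl k) Wv y.
  apply: (@Ex_cvg _ _ _ _ _ _ _ _ _ (expR (C * (j%:R * dl k)) * Vbd)).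
  - by move=> n; have [] := bZX jd (bU n).
  - move=> n w; rewrite normrM ler_pM//.
      by rewrite ger0_norm//; have /andP[] := Zexp_le HE HX cq qC w jd.
    by rewrite ger0_norm ?Vn_le_Vbd// (Vn_ge0 X P q G0).
  - by move=> w; apply: cvgM; [exact: cvg_cst|exact: Un_cvg].
apply: (@closed_cvg _ _ \oo _ (fun n => FK (j%:R * dl k) (Un n) y) (fun z => z <= Wv y)) cU.
  exact: closed_le.
near=> n.
have kn : (k <= n)%N by near: n; exact: nbhs_infty_ge.
rewrite (dlD k (n - k)) subnKC// mulrA -natrM.
exact: le_trans (FK_Vn HE HX cq qC bG _ _ _ (d0 n)) (Vn_le_Wv _ _ _).
Unshelve. all: by end_near. Qed.

Lemma stopping_time_grid (d : R) (tau : Om -> nat) : 0 <= d ->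
  (forall i, F (i%:R * d) [set w | tau w = i]) ->
  stopping_time F (fun w => (tau w)%:R * d).
Proof.
move=> dd Ft; split => [w|t t0]; first by rewrite mulr_ge0.
rewrite (_ : mkset _ = \bigcup_(i in [set i : nat | i%:R * d <= t]) [set w | tau w = i]).
  apply: (F_bigcup HX) => // i /= it; apply: (F_mono HX) it (Ft i).
  by rewrite mulr_ge0.
apply/seteqP; split => w /=; first by move=> h; exists (tau w).
by move=> [i /= it tw]; rewrite tw.
Qed.

Lemma Vn_stop k n x : exists2 tau, Txb P F x tau &
  Vn (dl k) n x = Ex P x (fun w => Z (tau w) w * G (X (tau w) w)).
Proof.
have [tau [tN Ft Ve]] := Vn_attained HE HX cq qC bG n (d0 k).
exists (fun w => (tau w)%:R * dl k) => //; split; first exact: stopping_time_grid.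
by exists (n%:R * dl k); apply: aeW => w; rewrite ler_wpM2r// ler_nat.
Qed.

Definition up_index (d s : R) : nat := `|Num.ceil (s / d)|%N.

(** Rounding up is what keeps a discretized time a stopping time: whether index [i] has been reached
    is decided at time [i * d]. *)
Lemma up_index_le (d s : R) i : 0 < d -> 0 <= s ->
  (up_index d s <= i)%N = (s <= i%:R * d).
Proof.
move=> dd s0; rewrite /up_index -ler_pdivrMr//.
rewrite -lez_nat gez0_abs; first by rewrite ceil_le_int.
by rewrite ceil_ge0 (lt_le_trans _ (divr_ge0 s0 (ltW dd)))// ltrN10.
Qed.

Lemma up_index_itv (d s : R) : 0 < d -> 0 <= s ->
  s <= (up_index d s)%:R * d <= s + d.
Proof.
move=> dd s0; rewrite -up_index_le// leqnn /=.
case u : (up_index d s) => [|i]; first by rewrite mul0r addr_ge0// ltW.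
have : ~~ (up_index d s <= i)%N by rewrite u ltnn.
by rewrite up_index_le// -ltNge -natr1 mulrDl mul1r => /ltW; lra.
Qed.

Hypothesis cG : rcontinuous rho G.

(** [Wv] satisfies the supersolution inequality on the whole space, so optional stopping applies
    with [B] equal to [setT] and there is no exit to control. The cut at [N] keeps the index
    bounded. *)
Lemma grid_stop_le x (tau : Om -> R) k N : stopping_time F tau ->
  let s w := (minn (up_index (dl k) (tau w)) (N * 2 ^ k))%:R * dl k in
  bm (fun w => Z (s w) w * G (X (s w) w)) /\
  Ex P x (fun w => Z (s w) w * G (X (s w) w)) <= Wv x.
Proof.
move=> [tau0 Ft] s.
pose t w := minn (up_index (dl k) (tau w)) (N * 2 ^ k).
have tN w : (t w <= N * 2 ^ k)%N by exact: geq_minr.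
have id0 (i : nat) : 0 <= i%:R * dl k :> R by rewrite mulr_ge0.
have Fle i : F (i%:R * dl k) [set w | (t w <= i)%N].
  have [Ni|Ni] := leqP (N * 2 ^ k) i.
    rewrite (_ : mkset _ = setT); first exact: (F_setT HX).
    by apply/seteqP; split => // w _ /=; exact: leq_trans Ni.
  rewrite (_ : mkset _ = [set w | tau w <= i%:R * dl k]); first exact: Ft.
  apply/seteqP; split => w /=; rewrite /t geq_min [(N * 2 ^ k <= i)%N]leqNgt Ni orbF
    up_index_le//; exact: dl_gt0.
have Feq i : F (i%:R * dl k) [set w | t w = i].
  case: i => [|i].
    rewrite (_ : mkset _ = [set w | (t w <= 0)%N]); first exact: Fle.
    by apply/seteqP; split => w /=; rewrite leqn0 => /eqP.
  rewrite (_ : mkset _ = [set w | (t w <= i.+1)%N] `&` ~` [set w | (t w <= i)%N]).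
    apply: (F_setI HX) => //; apply: (F_setC HX) => //.
    apply: (F_mono HX (id0 i)) (Fle i); first by rewrite ler_wpM2r// ler_nat.
  apply/seteqP; split => w /=; first by move=> ->; rewrite leqnn ltnn.
  by move=> [h1 /negP]; rewrite -ltnNge => h2; apply/eqP; rewrite eqn_leq h1.
have mt i : measurable [set w | t w = i] := F_measurable HX (id0 i) (Feq i).
split.
  exact: (bm_tau (a := fun i w => Z (i%:R * dl k) w * G (X (i%:R * dl k) w)) tN mt
    (fun i => bZX (id0 i) bG)).
have := supersolution_ge HE HX cq qC bG G0 (d0 k) bm_Wv Wv_geG measurableT _ tN Feq x.
have FKW y : setT y -> FK (dl k) Wv y <= Wv y by have := FK_Wv k 1 y; rewrite mul1r.
move=> /(_ FKW); apply: le_trans; rewrite le_eqVlt; apply/orP; left; apply/eqP.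
by apply: eq_Ex => w; rewrite indicE mem_set ?mul1r.
Qed.

Lemma ZG_cvg w (u : nat -> R) (a : R) : 0 <= a -> (forall n, a <= u n) ->
  u @ \oo --> a -> (fun n => Z (u n) w * G (X (u n) w)) @ \oo --> Z a w * G (X a w).
Proof.
move=> a0 au ua; apply: cvgM; last exact: (rcont0_cvg (path_rcont HE HX w cG)).
apply: (cvg_comp (fun n => tint (fun s => q (X s w)) (u n)) expR); last exact: continuous_expR.
have ua0 : (fun n => C * (u n - a)) @ \oo --> 0.
  rewrite -(mulr0 C) -(subrr a); apply: cvgM; first exact: cvg_cst.
  by apply: cvgB => //; exact: cvg_cst.
apply/cvgrPdist_le => e e0; move/cvgrPdist_le : ua0 => /(_ e e0); apply: filterS => n.
rewrite sub0r normrN => h; rewrite distrC; apply: le_trans (le_trans (ler_norm _) h).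
have ua' : 0 <= u n - a by rewrite subr_ge0.
have := tintB_bound (path_rcont HE HX w cq) (fun s => qC (X s w)) a0 ua'.
by rewrite subrKC.
Qed.

(** The rounded times tend to the cut stopping time from above, and right-continuity of the paths
    passes the grid bound to the limit. The cut at [N] gives a bound on every path, where [tau] has
    one only almost surely. Strict positivity is what allows taking [ln] afterwards. *)
Lemma stop_le x (tau : Om -> R) (b : R) : 0 < b -> (forall y, b <= G y) ->
  Txb P F x tau ->
  0 < Ex P x (fun w => Z (tau w) w * G (X (tau w) w)) <= Wv x.
Proof.
move=> b0 bG' [st [T hT]]; have [tau0 Ft] := st.
pose h (N : nat) w := Z (Num.min (tau w) N%:R) w * G (X (Num.min (tau w) N%:R) w).
have hN N : measurable_fun setT (h N) /\ Ex P x (h N) <= Wv x.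
  pose s k w : R := (minn (up_index (dl k) (tau w)) (N * 2 ^ k))%:R * dl k.
  have sE k w : s k w = Num.min ((up_index (dl k) (tau w))%:R * dl k) N%:R.
    rewrite /s -(dl_mul N k) natr_min minr_pMl// ltW//; exact: dl_gt0.
  have sc w : (fun k => Z (s k w) w * G (X (s k w) w)) @ \oo --> h N w.
    have m0 : 0 <= Num.min (tau w) N%:R by rewrite le_min tau0 ler0n.
    have sl k : Num.min (tau w) N%:R <= s k w <= Num.min (tau w) N%:R + dl k.
      have /andP[u1 u2] := up_index_itv (dl_gt0 k) (tau0 w).
      have dk := dl_gt0 (R := R) k.
      rewrite sE; apply/andP; split.
        by rewrite le_min !ge_min u1 lexx orbT.
      rewrite addr_minl le_min !ge_min u2 /=; apply/orP; right; lra.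
    apply: ZG_cvg => // [k|]; first by have /andP[] := sl k.
    apply: (@squeeze_cvgr _ _ _ _ (fun=> Num.min (tau w) N%:R)
      (fun k => Num.min (tau w) N%:R + dl k)).
    - exact: nearW.
    - exact: cvg_cst.
    - by rewrite -[X in _ --> X]addr0; apply: cvgD; [exact: cvg_cst|exact: cvg_dl].
  have ms k := (grid_stop_le x k N st).1.
  have ls k := (grid_stop_le x k N st).2.
  split.
    apply: (@measurable_fun_cvg _ Om R setT (fun k w => Z (s k w) w * G (X (s k w) w))) => [k|w _].
      by have [] := ms k.
    exact: sc.
  have cE : (fun k => Ex P x (fun w => Z (s k w) w * G (X (s k w) w))) @ \oo --> Ex P x (h N).
    apply: (@Ex_cvg _ _ _ _ _ _ _ _ _ (expR (C * N%:R))) => //.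
    - by move=> k; have [] := ms k.
    - move=> k w; rewrite ger0_norm ?mulr_ge0//; apply: ZG_le.
        by rewrite mulr_ge0.
      by rewrite -/(s k w) sE ge_min lexx orbT.
  by apply: (closed_cvg _ (@closed_le _ (Wv x)) _ _ cE); apply: nearW.
pose N := (Num.truncn `|T|).+1.
have TN : T <= N%:R by rewrite (le_trans (ler_norm T))// ltW// /N truncnS_gt.
suff -> : Ex P x (fun w => Z (tau w) w * G (X (tau w) w)) = Ex P x (h N).
  rewrite (hN N).2 andbT.
  have m0 w : 0 <= Num.min (tau w) N%:R by rewrite le_min tau0 ler0n.
  have mN w : Num.min (tau w) N%:R <= N%:R by rewrite ge_min lexx orbT.
  apply: (@lt_le_trans _ _ (expR (- (C * N%:R)) * b)).
    by rewrite mulr_gt0// expR_gt0.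
  apply: Ex_ge_cst => [|w].
    split; first exact: (hN N).1.
    exists (expR (C * N%:R)) => w; rewrite ger0_norm ?mulr_ge0//.
    exact: ZG_le (m0 w) (mN w).
  apply: ler_pM; [exact: expR_ge0|exact: ltW| |exact: bG'].
  have /andP[h1 _] := Zexp_le HE HX cq qC w (m0 w).
  by apply: le_trans h1; rewrite ler_expR lerN2 ler_wpM2l// (C0 x).
apply: Ex_ae_eq.
(* On each path [h n] is constant as soon as [n >= tau], so the reward at [tau] is a limit of
   measurable functions. *)
- apply: (@measurable_fun_cvg _ Om R setT h) => [n|w _]; first exact: (hN n).1.
  apply: cvg_near_cst; near=> n; rewrite /h (min_idPl _)//.
  rewrite (@le_trans _ _ (Num.truncn (tau w)).+1%:R)//; first by rewrite ltW// truncnS_gt.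
  by rewrite ler_nat; near: n; exact: nbhs_infty_ge.
- exact: (hN N).1.
- by apply: filterS hT => w tT; rewrite /h (min_idPl _)// (le_trans tT).
Unshelve. all: by end_near. Qed.

End value_function.

(** * Continuity of the value function *)

Section path_supremum.
Context {R : realType}.

(** Real induction on the end point: the left limit carries the bound up to the supremum of [S],
    right-continuity beyond it. Boundedness matters because [sup] of an unbounded set is only a
    default value. *)
Lemma cadlag_bounded (g : R -> R) (t : R) : rcont0 g ->
  (forall s, 0 < s -> exists b, exists2 eta : R, 0 < eta &
     forall u, 0 <= u -> s - eta < u -> u < s -> g u <= b) ->
  0 <= t -> exists b, forall s, 0 <= s <= t -> g s <= b.
Proof.
move=> rg lg t0.
pose S := [set u | 0 <= u <= t /\ exists b, forall s, 0 <= s <= u -> g s <= b].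
have S0 : S 0.
  split; first by rewrite lexx.
  by exists (g 0) => s /andP[s0 s1]; rewrite (_ : s = 0)//; apply/le_anti/andP.
have hS : has_sup S by split; [exists 0|exists t => u [/andP[]]].
have s0 : 0 <= sup S by apply: ub_le_sup => //; case: hS.
have st : sup S <= t by apply: ge_sup; [case: hS|move=> u [/andP[]]].
have [b bS] : exists b, forall s, 0 <= s <= sup S -> g s <= b.
  have [sp|] := ltP 0 (sup S); last first.
    move=> s1; exists (g 0) => s /andP[sp1 sp2].
    by rewrite (_ : s = 0)//; apply/le_anti; rewrite sp1 (le_trans sp2).
  have [b [eta eta0 h]] := lg _ sp.
  have [u [_ [b' ub']] su] := sup_adherent eta0 hS.
  exists (Num.max (g (sup S)) (Num.max b b')) => s /andP[s1].
  rewrite !le_max le_eqVlt => /predU1P[->|s2]; first by rewrite lexx.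
  have [us|us] := ltP u s; last by rewrite ub' ?orbT// s1.
  by rewrite h ?orbT// (lt_trans su).
have [e|ne] := eqVneq (sup S) t; first by exists b => s; rewrite -e; exact: bS.
have {st ne} st : sup S < t by rewrite lt_neqAle ne.
have [eta eta0 h] := rg _ 1 s0 ltr01.
exfalso; pose v := Num.min t (sup S + eta / 2).
have Sv : sup S < v by rewrite lt_min st ltrDl divr_gt0.
suff : S v by move=> /(ub_le_sup hS.2); rewrite leNgt Sv.
split; first by rewrite ge_min lexx andbT (le_trans s0)// ltW.
exists (Num.max b (g (sup S) + 1)) => s /andP[s1 sv]; rewrite le_max.
have [ss|ss] := leP s (sup S); first by rewrite bS// s1.
apply/orP; right.
have : `|g s - g (sup S)| < 1.
  apply: h; first exact: ltW.
  move: sv; rewrite le_min => /andP[_ sv]; rewrite (le_lt_trans sv)// ltrD2l.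
  by rewrite ltr_pdivrMr// ltr_pMr// ltr1n.
by move=> /ltW /(le_trans (ler_norm _)); rewrite lerBlDl.
Qed.

(** The cut at [t] keeps the points that approach some [s <= t] from the right inside [[0, t]], also
    for [s = t]. *)
Definition dyadic_pt (t : R) (k m : nat) : R := Num.min t (m%:R * dl k).

Lemma dyadic_pt_itv t k m : 0 <= t -> 0 <= dyadic_pt t k m <= t.
Proof.
move=> t0; rewrite /dyadic_pt le_min t0 ge_min lexx /= andbT mulr_ge0//.
exact/ltW/dl_gt0.
Qed.

Lemma rcont0_dyadic (g : R -> R) (t s a : R) : rcont0 g -> 0 <= s <= t -> a < g s ->
  exists k m, a < g (dyadic_pt t k m).
Proof.
move=> rg /andP[s0 st] ags.
pose u k := dyadic_pt t k (up_index (dl k) s).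
have su k : s <= u k <= s + dl k.
  have /andP[h1 h2] := up_index_itv (dl_gt0 k) s0.
  by rewrite /u /dyadic_pt le_min st h1 ge_min h2 orbT.
have us : u @ \oo --> s.
  apply: (@squeeze_cvgr _ _ _ _ (fun=> s) (fun k => s + dl k)).
  - exact: nearW.
  - exact: cvg_cst.
  - by rewrite -[X in _ --> X]addr0; apply: cvgD; [exact: cvg_cst|exact: cvg_dl].
have gu : (fun k => g (u k)) @ \oo --> g s.
  by apply: rcont0_cvg => // k; have /andP[] := su k.
have [k ak] : exists k, a < g (u k).
  have [n _ h] : \forall k \near \oo, a < g (u k) by apply: cvgr_gt ags.
  by exists n; apply: h => /=.
by exists k, (up_index (dl k) s).
Qed.

(** By right-continuity countably many times determine the supremum; the slack [1 / (n + 1)] is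
    there because it need not be attained. This makes the event of a large excursion measurable. *)
Lemma le_sup_dyadic (g : R -> R) (t r : R) : rcont0 g -> 0 <= t ->
  (exists b, forall s, 0 <= s <= t -> g s <= b) ->
  (r <= sup [set g s | s in `[0, t]%classic]) =
  `[< forall n, exists k m, r - n.+1%:R^-1 < g (dyadic_pt t k m) >].
Proof.
move=> rg t0 [b gb]; set S := (S in sup S).
have hS : has_sup S.
  split; first by exists (g 0), 0 => //=; rewrite in_itv/= lexx t0.
  by exists b => _ [s + <-]; rewrite /= in_itv/=; exact: gb.
apply/idP/asboolP => [rS n|h].
  have n0 : 0 < n.+1%:R^-1 :> R by rewrite invr_gt0.
  have [_ [s /=] + <-] := sup_adherent n0 hS.
  rewrite in_itv/= => s0t gs; apply: (rcont0_dyadic rg s0t).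
  by apply: le_lt_trans gs; rewrite lerB.
apply/ler_addgt0Pr => e e0; have [k [m gk]] := h (Num.truncn e^-1).
have gS : g (dyadic_pt t k m) <= sup S.
  apply: ub_le_sup; first by case: hS.
  by exists (dyadic_pt t k m) => //=; rewrite in_itv/=; exact: dyadic_pt_itv.
have ne : (Num.truncn e^-1).+1%:R^-1 <= e.
  by rewrite invf_ple ?posrE// ltW// truncnS_gt.
by rewrite -lerBlDr (le_trans _ gS)// (le_trans _ (ltW gk))// lerB.
Qed.

End path_supremum.

(** * The value function compared with its average after a short time *)

Section value_continuity.
Context {R : realType} {dE dO : measure_display}
  {E : measurableType dE} {Om : measurableType dO}.
Variables (X : R -> Om -> E) (P : E -> probability Om R) (F : R -> set (set Om))
  (rho : E -> E -> R).
Hypotheses (HE : lcs_metric_borel rho) (HX : standard_feller_markov X P F rho).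
Hypothesis tv_cont : forall (t : R) (u : nat -> E) x, 0 < t -> rcvg rho u x ->
  forall e : R, 0 < e -> exists N, forall n, (N <= n)%N ->
  forall A, measurable A -> `|Ptr X P t (u n) A - Ptr X P t x A| <= e.
Hypothesis small_moves : forall (K : set E) (r : R), rcompact rho K -> 0 < r ->
  forall e : R, 0 < e -> exists2 eta : R, 0 < eta & forall t, 0 < t -> t < eta ->
  `|MGamma X P rho K t r| <= e.

(** [tv_cont] treats indicators and [bm_ind] extends it to bounded measurable [u]. This is the
    strong Feller property: it makes the average of [Wv] continuous before [Wv] itself is known to
    be. *)
Lemma semigroup_seq_cvg t (u : E -> R) (xs : nat -> E) x : 0 < t -> bm u ->
  rcvg rho xs x -> forall e : R, 0 < e -> exists N, forall n, (N <= n)%N ->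
  `|semigroup X P t u (xs n) - semigroup X P t u x| <= e.
Proof.
move=> t0 bu xsx; have t0' := ltW t0.
move: u bu; apply: bm_ind => [A mA e e0|a u v bu bv hu hv e e0|u bu h e e0].
- have [N hN] := tv_cont t0 xsx e0; exists N => n /hN /(_ A mA).
  have PE y : Ptr X P t y A = semigroup X P t \1_A y.
    rewrite /Ptr -Ex_indic; last exact: (F_measurable HX t0' (F_X HX t0' mA)).
    by apply: eq_Ex => w; rewrite !indicE; congr (nat_of_bool _)%:R; apply/idP/idP; rewrite !inE.
  by rewrite !PE.
- have a0 : 0 < `|a| + 1 by rewrite ltr_pwDr.
  have [N1 h1] := hu _ (divr_gt0 e0 (mulr_gt0 (ltr0Sn R 1) a0)).
  have [N2 h2] := hv _ (divr_gt0 e0 (ltr0Sn R 1)).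
  exists (maxn N1 N2) => n; rewrite geq_max => /andP[/h1 {}h1 /h2 {}h2].
  have SE y : semigroup X P t (fun z => a * u z + v z) y =
      a * semigroup X P t u y + semigroup X P t v y.
    rewrite /semigroup ExD ?ExZ//; [exact: (bm_X HX)|apply: bmZ|]; exact: (bm_X HX).
  rewrite !SE (_ : _ - _ = a * (semigroup X P t u (xs n) - semigroup X P t u x) +
    (semigroup X P t v (xs n) - semigroup X P t v x)); last by ring.
  apply: (le_trans (ler_normD _ _)); rewrite normrM [leRHS]splitr lerD//.
  apply: (@le_trans _ _ ((`|a| + 1) * (e / (2 * (`|a| + 1))))).
    by rewrite ler_pM// lerDl.
  by rewrite le_eqVlt; apply/orP; left; apply/eqP; field; rewrite gt_eqF//.
- have [v [bv hv uv]] := h _ (divr_gt0 e0 (ltr0Sn R 2)).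
  have [N hN] := hv _ (divr_gt0 e0 (ltr0Sn R 2)).
  exists N => n /hN {}hN.
  have cl y : `|semigroup X P t u y - semigroup X P t v y| <= e / 3.
    rewrite /semigroup -ExB; [|exact: (bm_X HX)|exact: (bm_X HX)].
    by apply: Ex_norm_le => //; apply: bmB; exact: (bm_X HX).
  have := cl (xs n); have := cl x; move: hN; rewrite !ler_norml.
  by move=> /andP[? ?] /andP[? ?] /andP[? ?]; apply/andP; split; lra.
Qed.

Lemma rcontinuous_semigroup t (u : E -> R) : 0 < t -> bm u ->
  rcontinuous rho (semigroup X P t u).
Proof.
move=> t0 bu x e e0; apply: contrapT => ncont.
have /choice[xs hxs] : forall n : nat, exists y, rho x y < n.+1%:R^-1 /\
    e <= `|semigroup X P t u x - semigroup X P t u y|.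
  move=> n; apply: contrapT => hn; apply: ncont.
  exists n.+1%:R^-1 => [|y xy]; first by rewrite invr_gt0.
  by rewrite ltNge; apply/negP => ey; apply: hn; exists y.
have cxs : rcvg rho xs x.
  move=> r r0; exists (Num.truncn r^-1) => n rn.
  rewrite (rho_sym (lcs_metric HE)) (lt_le_trans (hxs n).1)//.
  rewrite invf_ple ?posrE// (le_trans (ltW (truncnS_gt _)))// ler_nat ltnS//.
have [N hN] := semigroup_seq_cvg t0 bu cxs (divr_gt0 e0 (ltr0Sn R 1)).
have := le_trans (hxs N).2 (_ : _ <= e / 2); rewrite distrC hN// => /(_ isT).
by rewrite leNgt ltr_pdivrMr// ltr_pMr// ltr1n.
Qed.

Lemma path_rho_rcont w x : rcont0 (fun s => rho (X s w) x).
Proof.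
exact: (path_rcont HE HX w (rcontinuous_rho (lcs_metric HE) x)).
Qed.

Lemma path_rho_bounded w x (t : R) : 0 <= t ->
  exists b, forall s, 0 <= s <= t -> rho (X s w) x <= b.
Proof.
apply: cadlag_bounded => [|s s0]; first exact: path_rho_rcont.
have [_ [_ [_ [_ [_ [_ [_ [_ [+ _]]]]]]]]] := HX.
move=> /(_ w s s0)[l /(_ 1 ltr01)[eta eta0 h]].
exists (1 + rho l x), eta => // u u0 su us.
apply: (le_trans (rho_tri (lcs_metric HE) (X u w) l x)).
by rewrite lerD2r ltW// h.
Qed.

Definition far_set x (t r : R) : set Om :=
  [set w | r <= sup [set rho (X s w) x | s in `[0, t]%classic]].

Lemma measurable_far_set x t r : 0 <= t -> measurable (far_set x t r).
Proof.
move=> t0; rewrite (_ : far_set x t r = \bigcap_(n in setT) \bigcup_(k in setT)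
    \bigcup_(m in setT) X (dyadic_pt t k m) @^-1` [set y | r - n.+1%:R^-1 < rho y x]).
  apply: bigcap_measurable => [|n _]; first by exists 0%N.
  apply: bigcup_measurable => k _; apply: bigcup_measurable => m _.
  have /andP[p0 _] := dyadic_pt_itv k m t0.
  apply: (F_measurable HX p0); apply: (F_X HX p0); apply: (ropen_measurable HE).
  move=> y /= ry.
  have e0 : 0 < rho y x - (r - n.+1%:R^-1) by rewrite subr_gt0.
  have [eta eta0 h] := (rcontinuous_rho (lcs_metric HE) x : rcontinuous rho (rho^~ x)) y _ e0.
  by exists eta => // z /h; rewrite ltr_norml => /andP[_]; rewrite ltrD2l ltrN2.
apply/seteqP; split => w; rewrite /far_set/= le_sup_dyadic//.
- by move=> /asboolP h n _; have [k [m km]] := h n; exists k => //; exists m.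
- exact: path_rho_rcont.
- exact: path_rho_bounded.
- move=> h; apply/asboolP => n; have [k _ [m _ km]] := h n I; by exists k, m.
- exact: path_rho_rcont.
- exact: path_rho_bounded.
Qed.

Lemma far_set_le_MGamma (K : set E) x t r : 0 <= t -> K x ->
  fine (P x (far_set x t r)) <= MGamma X P rho K t r.
Proof.
move=> t0 Kx; apply: ub_le_sup; last by exists x.
exists 1 => _ [y _ <-]; rewrite -lee_fin fineK ?probability_le1//.
  exact: measurable_far_set.
by rewrite fin_num_measure//; exact: measurable_far_set.
Qed.

Lemma far_setP x t r s w : 0 <= s <= t -> r <= rho (X s w) x -> far_set x t r w.
Proof.
move=> /andP[s0 st] rs; have t0 := le_trans s0 st; apply: (le_trans rs).
apply: ub_le_sup; last by exists s => //=; rewrite in_itv/= s0.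
have [b hb] := path_rho_bounded w x t0.
by exists b => _ [u + <-]; rewrite /= in_itv/=; exact: hb.
Qed.

Variables (q : E -> R) (C : R).
Hypotheses (cq : rcontinuous rho q) (qC : forall x, `|q x| <= C).
Variable G : E -> R.
Hypotheses (cG : rcontinuous rho G) (G0 : forall x, 0 <= G x) (G1 : forall x, G x <= 1).
Variables (M : nat) (theta : R).
Hypotheses (th01 : 0 <= theta < 1)
  (FKth : forall x, FK X P q M%:R (cst 1) x <= theta).

Local Notation Z := (Zexp X q).
Local Notation W := (Wv X P q G).
Local Notation D := (Vbd C M theta).

Let bG : bm G.
Proof.
split; first exact: (rcontinuous_measurable HE).
by exists 1 => x; rewrite ger0_norm.
Qed.

Let bW : bm W := bm_Wv HE HX cq qC bG G0 G1 th01 FKth.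
Let W_D y : W y <= D := Wv_le_Vbd HE HX cq qC bG G0 G1 th01 FKth y.
Let V_D k n y : Vn X P q G (dl k) n y <= D := Vn_le_Vbd HE HX cq qC bG G0 G1 th01 FKth k n y.
Let V_W k n y : Vn X P q G (dl k) n y <= W y := Vn_le_Wv HE HX cq qC bG G0 G1 th01 FKth k n y.
Let G_W y : G y <= W y := Wv_geG HE HX cq qC bG G0 G1 th01 FKth y.
Let W0 y : 0 <= W y := le_trans (G0 y) (G_W y).
Let Z0 t w : 0 <= Z t w := ltW (Zexp_gt0 X q t w).
Let D0 (y : E) : 0 <= D := le_trans (W0 y) (W_D y).
Let C0 (x : E) : 0 <= C := le_trans (normr_ge0 (q x)) (qC x).

Lemma Wv_ge_semigroup p x :
  expR (- (C * dl p)) * semigroup X P (dl p) W x <= W x.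
Proof.
have p0 := dl_gt0 (R := R) p; have p0' := ltW p0.
have := FK_Wv HE HX cq qC bG G0 G1 th01 FKth p 1 x; rewrite mul1r.
apply: le_trans; rewrite /semigroup -ExZ; last exact: (bm_X HX).
apply: Ex_le.
- by apply: bmZ; exact: (bm_X HX).
- exact: (bm_ZX HE HX cq qC).
- by move=> w; rewrite ler_wpM2r//; have /andP[] := Zexp_le HE HX cq qC w p0'.
Qed.

(** If the path stays [r]-close to [x] up to time [dl p], any reward seen on the way differs from
    the one at time [dl p] by at most [2 * e], and the latter is below [Wv]. On the far event the
    crude bounds [1] on the reward and [D] on the value are used. *)
Lemma Wv_le_semigroup p x (r e : R) : 0 <= e ->
  (forall y, rho x y < r -> `|G x - G y| <= e) ->
  W x <= expR (C * dl p) * (semigroup X P (dl p) W x + 2 * e +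
    (1 + D) * fine (P x (far_set x (dl p) r))).
Proof.
move=> e0 Ge; apply: Wv_le => k n.
have p0 := dl_gt0 (R := R) p; have p0' := ltW p0.
(* This step refines both the grid [dl k] of the given value and the time [dl p], which becomes
   index [2 ^ k]. *)
set d := dl (p + k) : R; have d0 : 0 <= d by apply/ltW/dl_gt0.
have pd : dl p = (2 ^ k)%:R * d by exact: dlD.
apply: (le_trans (Vn_refine_pow HE HX cq qC bG k p n x)).
rewrite (addnC k p) -/d; set m := (n * 2 ^ p)%N.
apply: (le_trans (Vn_homo HE HX cq qC bG x d0 (leq_addr (2 ^ k) m))).
apply: (le_trans (perfect_foresight HE HX cq qC bG (2 ^ k) m x d0)).
rewrite -pd; set t := dl p in p0 p0' pd *.
have mA := measurable_far_set x r p0'.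
set A := far_set x t r in mA *.
have bWX : bm (fun w => W (X t w)) by exact: (bm_X HX).
have b1 : bm (fun w => W (X t w) + 2 * e) by apply: bmD => //; exact: bm_cst.
have b2 : bm (fun w => (1 + D) * \1_A w) by apply: bmZ; exact: bm_indic.
rewrite -Ex_indic// -ExZ; last exact: bm_indic.
rewrite (_ : semigroup X P t W x + 2 * e = Ex P x (fun w => W (X t w) + 2 * e)); last first.
  by rewrite ExD ?Ex_cst//; exact: bm_cst.
rewrite -ExD// -ExZ; last exact: bmD.
apply: Ex_le.
- apply: bm_max; first exact: (bm_Psi HE HX cq qC bG).
  by apply: (bm_ZX HE HX cq qC) => //; exact: (bm_Vn HE HX cq qC bG).
- by apply: bmZ; exact: bmD.
move=> w.
have e1 : 0 <= expR (C * t) by exact: expR_ge0.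
have Zle i : (i <= 2 ^ k)%N -> Z (i%:R * d) w <= expR (C * t).
  move=> ik; have id0 : 0 <= i%:R * d by rewrite mulr_ge0.
  have /andP[_ h] := Zexp_le HE HX cq qC w id0; apply: (le_trans h).
  by rewrite ler_expR ler_wpM2l ?(C0 x)// pd ler_wpM2r// ler_nat.
have Zt : Z t w <= expR (C * t) by have := Zle _ (leqnn (2 ^ k)%N); rewrite -pd.
have DD := D0 x.
have [wA|wA] := pselect (A w).
  rewrite indicE mem_set// mulr1 ge_max; apply/andP; split.
    apply: (@le_trans _ _ (expR (C * t))).
      apply: Psi_le => // i ik; rewrite -[leRHS]mulr1.
      by apply: ler_pM; [exact: Z0|exact: G0|exact: Zle (ltnW ik)|exact: G1].
    by rewrite ler_peMr//; have := W0 (X t w); lra.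
  rewrite ler_pM ?(Vn_ge0 X P q G0)//.
  by rewrite (le_trans (V_D _ _ _))//; have := W0 (X t w); lra.
rewrite indicE memNset// mulr0 addr0 ge_max.
have near s : 0 <= s <= t -> `|G x - G (X s w)| <= e.
  move=> st; apply: Ge; rewrite ltNge; apply/negP => rs; apply: wA.
  by apply: (far_setP st); rewrite (rho_sym (lcs_metric HE)).
apply/andP; split.
  apply: Psi_le; first by rewrite mulr_ge0// addr_ge0// mulr_ge0.
  move=> i ik; apply: ler_pM; [exact: Z0|exact: G0|exact: Zle (ltnW ik)|].
  have h1 : `|G x - G (X (i%:R * d) w)| <= e.
    by apply: near; rewrite mulr_ge0//= pd ler_wpM2r// ler_nat ltnW.
  have h2 : `|G x - G (X t w)| <= e by apply: near; rewrite p0' lexx.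
  move: h1 h2; rewrite !ler_norml => /andP[? ?] /andP[? ?].
  by have := G_W (X t w); lra.
rewrite ler_pM ?(Vn_ge0 X P q G0)//.
by rewrite (le_trans (V_W _ _ _))// lerDl mulr_ge0.
Qed.

Lemma Wv_approx (K : set E) (e : R) : rcompact rho K -> 0 < e ->
  exists p, forall x, K x -> `|W x - semigroup X P (dl p) W x| <= e.
Proof.
move=> cK e0.
have [[x0 Kx0]|K0] := pselect (K !=set0); last first.
  by exists 0%N => x Kx; exfalso; apply: K0; exists x.
have DD := D0 x0; have CC := C0 x0.
have D1 : 0 < 1 + D by rewrite ltr_pwDl.
have [r r0 hr] := rcompact_ucont (lcs_metric HE) cK (divr_gt0 e0 (ltr0Sn R 15)) cG.
(* The oscillation of [G], the far event and the factor [exp (C * dl p) - 1] contribute [e / 8]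
   each, the first two multiplied by a factor which the [1] in [Num.min 1 e2] keeps below [2]. *)
pose e2 := e / (8 * (1 + D)); have e20 : 0 < e2 by rewrite divr_gt0// mulr_gt0.
have [eta eta0 heta] := small_moves cK r0 e20.
have cC : (fun p => expR (C * dl p)) @ \oo --> (1 : R).
  rewrite -expR0; apply: (cvg_comp (fun p => C * dl p) expR); last exact: continuous_expR.
  by rewrite -(mulr0 C); apply: cvgM; [exact: cvg_cst|exact: cvg_dl].
have e30 : 0 < Num.min 1 e2 by rewrite lt_min ltr01.
have /cvgrPdist_le/(_ _ e30)[n1 _ h1] := cC.
have /cvgrPdist_lt/(_ _ eta0)[n2 _ h2] := @cvg_dl R.
pose p := maxn n1 n2; exists p => x Kx.
have {}h1 : expR (C * dl p) - 1 <= Num.min 1 e2.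
  by apply: le_trans (h1 p (leq_maxl _ _)); rewrite distrC ler_norm.
have {}h2 : dl p < eta :> R.
  by have := h2 p (leq_maxr _ _); rewrite /= sub0r normrN ger0_norm// ltW// dl_gt0.
have p0 := dl_gt0 (R := R) p.
have hM : fine (P x (far_set x (dl p) r)) <= e2.
  apply: (le_trans (far_set_le_MGamma r (ltW p0) Kx)).
  by apply: le_trans (heta _ p0 h2); exact: ler_norm.
have Gx y : rho x y < r -> `|G x - G y| <= e / 16 by move=> /(hr _ _ Kx)/ltW.
have e16 : 0 <= e / 16 by rewrite divr_ge0// ltW.
have up := Wv_le_semigroup p e16 Gx.
have lo := Wv_ge_semigroup p x.
set a := expR (C * dl p) in h1 up.
have a1 : 1 <= a by rewrite -expR0 ler_expR mulr_ge0// ltW.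
(* [2 - a <= 1 / a] is [0 <= (a - 1) ^ 2]. *)
have aI : 2 - a <= expR (- (C * dl p)).
  rewrite expRN -/a -(ler_pM2l (lt_le_trans ltr01 a1)) mulfV ?gt_eqF//; last first.
    exact: lt_le_trans a1.
  by have := sqr_ge0 (a - 1); rewrite expr2; nra.
move: h1; rewrite le_min => /andP[h1 h1'].
set s := semigroup X P (dl p) W x in up lo *.
have s0 : 0 <= s by apply: Ex_ge0 => w.
have sD : s <= D by apply: Ex_le_cst => // ; exact: (bm_X HX (ltW p0) bW).
have eE : e2 * (1 + D) = e / 8 by rewrite /e2; field; rewrite gt_eqF.
set f := fine _ in up hM.
have fD : (1 + D) * f <= e / 8 by rewrite -eE mulrC ler_wpM2r// ltW.
have f0 : 0 <= f by rewrite fine_ge0.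
have fD0 : 0 <= (1 + D) * f by rewrite mulr_ge0// ltW.
have as' : (a - 1) * s <= e / 8.
  rewrite -eE; apply: ler_pM => //; [by rewrite subr_ge0|].
  by rewrite (le_trans sD)// lerDr.
rewrite ler_norml; apply/andP; split.
  have : (2 - a) * s <= expR (- (C * dl p)) * s by rewrite ler_wpM2r.
  by move: as'; rewrite !mulrBl mul1r; lra.
have : a * (s + 2 * (e / 16) + (1 + D) * f) <= a * s + 2 * (e / 8 + e / 8).
  rewrite -addrA mulrDr lerD2l; apply: ler_pM; lra.
by move: as'; rewrite mulrBl mul1r; lra.
Qed.

Lemma rcontinuous_Wv : rcontinuous rho W.
Proof.
move=> x e e0; have [_ lc _ _] := HE.
have [K [cK [r r0 rK]]] := lc x.
have [p hp] := Wv_approx cK (divr_gt0 e0 (ltr0Sn R 3)).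
have [s s0 hs] := rcontinuous_semigroup (dl_gt0 p) bW x (divr_gt0 e0 (ltr0Sn R 3)).
exists (Num.min r s); first by rewrite lt_min r0.
move=> y; rewrite lt_min => /andP[xr xs].
have Kx : K x by apply: rK; rewrite /rball/= (rho_xx (lcs_metric HE)).
have := hp x Kx; have := hp y (rK y xr); have := hs y xs.
rewrite !ler_norml !ltr_norml => /andP[? ?] /andP[? ?] /andP[? ?].
by apply/andP; split; lra.
Qed.

End value_continuity.

(** * The one-step equation *)

Section impulse_operator.
Context {R : realType} {E : Type} (rho : E -> E -> R) (c : E -> E -> R) (U : set E).
Hypothesis rhoM : is_metric rho.
Hypothesis U0 : U !=set0.
Variable Cc : R.
Hypothesis cC : forall x xi, U xi -> `|c x xi| <= Cc.
Hypothesis c_le0 : forall x xi, U xi -> c x xi <= 0.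
Hypothesis c_cont : forall x xi (e : R), U xi -> 0 < e -> exists2 eta : R, 0 < eta &
  forall y zeta, U zeta -> rho x y < eta -> rho xi zeta < eta ->
  `|c x xi - c y zeta| < e.
Hypothesis c_tail : forall e : R, 0 < e -> exists K, rcompact rho K /\
  forall x y xi, ~ K x -> ~ K y -> U xi -> `|c x xi - c y xi| <= e.
Hypothesis cU : rcompact rho U.

Local Notation Mop := (Mop c U).

Definition bounded_onU (h : E -> R) : Prop := exists K, forall xi, U xi -> h xi <= K.

Let has_sup_M h x : bounded_onU h -> has_sup [set c x xi + h xi | xi in U].
Proof.
move=> [K hK]; split; first by have [xi Uxi] := U0; exists (c x xi + h xi), xi.
by exists K => _ [xi Uxi <-]; rewrite -[leRHS]add0r lerD// ?c_le0// hK.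
Qed.

Lemma Mop_ge h x xi : bounded_onU h -> U xi -> c x xi + h xi <= Mop h x.
Proof. by move=> hh Uxi; apply: ub_le_sup; [case: (has_sup_M x hh)|exists xi]. Qed.

Lemma Mop_le h x b : (forall xi, U xi -> c x xi + h xi <= b) -> Mop h x <= b.
Proof.
move=> hb; apply: ge_sup => [|_ [xi Uxi <-]]; last exact: hb.
by have [xi Uxi] := U0; exists (c x xi + h xi), xi.
Qed.

Lemma Mop_adherent h x (e : R) : bounded_onU h -> 0 < e ->
  exists2 xi, U xi & Mop h x - e < c x xi + h xi.
Proof.
by move=> hh e0; have [_ [xi Uxi <-] ?] := sup_adherent e0 (has_sup_M x hh); exists xi.
Qed.

Lemma Mop_shift h x s : bounded_onU h -> Mop (fun y => h y - s) x = Mop h x - s.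
Proof.
move=> hh; have [K hK] := hh.
have hs : bounded_onU (fun y => h y - s) by exists (K - s) => xi /hK; rewrite lerD2r.
apply/le_anti/andP; split.
  by apply: Mop_le => xi Uxi; rewrite addrA lerD2r Mop_ge.
rewrite lerBlDr; apply: Mop_le => xi Uxi.
by have := Mop_ge x hs Uxi; rewrite addrA lerBlDr.
Qed.

Lemma c_equicont x (e : R) : 0 < e -> exists2 r : R, 0 < r &
  forall y xi, U xi -> rho x y < r -> `|c x xi - c y xi| <= e.
Proof.
move=> e0.
suff [r r0 hr] : exists2 r : R, 0 < r & forall y xi, U xi -> U xi -> rho x y < r ->
    `|c x xi - c y xi| <= e by exists r => // y xi Uxi; exact: hr.
apply: (rcompact_ind rhoM (Q := fun A => exists2 r : R, 0 < r &
    forall y xi, A xi -> U xi -> rho x y < r -> `|c x xi - c y xi| <= e)) cU _ _ _ _.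
- by exists 1.
- move=> A B [a a0 aA] [b b0 bB]; exists (Num.min a b); first by rewrite lt_min a0.
  by move=> y xi [/aA|/bB] h Uxi; rewrite lt_min => /andP[? ?]; exact: h.
- by move=> A B AB [r r0 rB]; exists r => // y xi /AB/rB; exact.
- move=> xi Uxi; have [r r0 h] := c_cont x Uxi (divr_gt0 e0 (ltr0Sn R 1)).
  exists r => //; exists r => // y zeta; rewrite /rball/= => xz Uz xy.
  have h1 := h y zeta Uz xy xz; have h2 := h x zeta Uz _ xz.
  have {}h2 : `|c x xi - c x zeta| < e / 2 by apply: h2; rewrite (rho_xx rhoM).
  move: h1 h2; rewrite !ltr_norml ler_norml => /andP[? ?] /andP[? ?].
  by apply/andP; split; lra.
Qed.

(** On the compact set of [c_tail] finitely many local estimates suffice; all points outside it are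
    compared with one of them, [y0], whence the three terms [e / 3]. *)
Lemma c_unif xi0 (e : R) : U xi0 -> 0 < e -> exists2 r : R, 0 < r &
  forall xi, U xi -> rho xi0 xi < r -> forall x, `|c x xi - c x xi0| <= e.
Proof.
move=> U0' e0; have e30 := divr_gt0 e0 (ltr0Sn R 2).
have loc x : exists2 r : R, 0 < r & forall y xi, U xi -> rho x y < r ->
    rho xi0 xi < r -> `|c y xi - c y xi0| <= e / 3.
  have [r r0 h] := c_cont x U0' (divr_gt0 e0 (ltr0Sn R 5)).
  exists r => // y xi Uxi xy xx.
  have h1 := h y xi Uxi xy xx; have h2 := h y xi0 U0' xy.
  have {}h2 : `|c x xi0 - c y xi0| < e / 6 by apply: h2; rewrite (rho_xx rhoM).
  move: h1 h2; rewrite !ltr_norml ler_norml => /andP[? ?] /andP[? ?].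
  by apply/andP; split; lra.
have [K [cK tK]] := c_tail e30.
have [r1 r10 h1] : exists2 r : R, 0 < r & forall x xi, K x -> U xi -> rho xi0 xi < r ->
    `|c x xi - c x xi0| <= e.
  apply: (rcompact_ind rhoM (Q := fun A => exists2 r : R, 0 < r &
    forall x xi, A x -> U xi -> rho xi0 xi < r -> `|c x xi - c x xi0| <= e)) cK _ _ _ _.
  - by exists 1.
  - move=> A B [a a0 aA] [b b0 bB]; exists (Num.min a b); first by rewrite lt_min a0.
    by move=> y xi [/aA|/bB] h Uxi; rewrite lt_min => /andP[? ?]; exact: h.
  - by move=> A B AB [r r0 rB]; exists r => // y xi /AB/rB; exact.
  - move=> x Kx; have [r r0 h] := loc x; exists r => //; exists r => // y xi xy Uxi xx.
    by rewrite (le_trans (h y xi Uxi xy xx))//; lra.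
have [[y0 Ky0]|nK] := pselect (exists y, ~ K y); last first.
  exists r1 => // xi Uxi xx x; apply: h1 => //.
  by apply: contrapT => Kx; apply: nK; exists x.
have [r2 r20 h2] := loc y0.
exists (Num.min r1 r2); first by rewrite lt_min r10.
move=> xi Uxi; rewrite lt_min => /andP[xr1 xr2] x.
have [Kx|Kx] := pselect (K x); first exact: h1.
have a1 := tK x y0 xi Kx Ky0 Uxi; have a2 := tK x y0 xi0 Kx Ky0 U0'.
have a3 := h2 y0 xi Uxi (_ : rho y0 y0 < r2) xr2.
have {}a3 : `|c y0 xi - c y0 xi0| <= e / 3 by apply: a3; rewrite (rho_xx rhoM).
move: a1 a2 a3; rewrite !ler_norml => /andP[? ?] /andP[? ?] /andP[? ?].
by apply/andP; split; lra.
Qed.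

Lemma rcontinuous_Mop h : bounded_onU h -> rcontinuous rho (Mop h).
Proof.
move=> hh x e e0; have [r r0 hr] := c_equicont x (divr_gt0 e0 (ltr0Sn R 1)).
exists r => // y xy.
have h1 : Mop h x <= Mop h y + e / 2.
  apply: Mop_le => xi Uxi; have := Mop_ge y hh Uxi; have := hr y xi Uxi xy.
  by rewrite ler_norml => /andP[? ?]; lra.
have h2 : Mop h y <= Mop h x + e / 2.
  apply: Mop_le => xi Uxi; have := Mop_ge x hh Uxi; have := hr y xi Uxi xy.
  by rewrite ler_norml => /andP[? ?]; lra.
by rewrite ltr_norml; apply/andP; split; lra.
Qed.

End impulse_operator.

(** * Normalized solutions and the monotonicity of their constants *)

Section one_step_equation.
Context {R : realType} {dE dO : measure_display}
  {E : measurableType dE} {Om : measurableType dO}.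
Variables (X : R -> Om -> E) (P : E -> probability Om R) (F : R -> set (set Om))
  (rho : E -> E -> R) (f : E -> R) (c : E -> E -> R) (U : set E).
Hypotheses (HE : lcs_metric_borel rho) (HX : standard_feller_markov X P F rho).
Hypotheses (cU : rcompact rho U) (U0 : U !=set0).
Variables (Cf Cc c0 : R).
Hypotheses (cf : rcontinuous rho f) (fC : forall x, `|f x| <= Cf).
Hypothesis cC : forall x xi, U xi -> `|c x xi| <= Cc.
Hypotheses (c0_lt0 : c0 < 0) (c_le : forall x xi, U xi -> c x xi <= c0).
Hypothesis c_cont : forall x xi (e : R), U xi -> 0 < e -> exists2 eta : R, 0 < eta &
  forall y zeta, U zeta -> rho x y < eta -> rho xi zeta < eta ->
  `|c x xi - c y zeta| < e.

Local Notation Mop := (Mop c U).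

Definition qf (l : R) (x : E) : R := f x - l.

Lemma rcontinuous_qf l : rcontinuous rho (qf l).
Proof.
move=> x e e0; have [r r0 h] := @cf x e e0; exists r => // y /h.
by rewrite /qf opprB addrA subrK.
Qed.

Lemma qf_bound l x : `|qf l x| <= Cf + `|l|.
Proof. by rewrite (le_trans (ler_normB _ _))// lerD. Qed.

Lemma Zexp_qf l t w : 0 <= t -> Zexp X (qf l) t w = expR (- (l * t)) * Zexp X f t w.
Proof.
move=> t0; rewrite /Zexp (tint_subc l (path_rcont HE HX w cf) (fun s => fC (X s w)) t0).
by rewrite addrC expRD.
Qed.

Lemma FK_qf l l' t u y : 0 <= t -> bm u ->
  FK X P (qf l) t u y = expR ((l' - l) * t) * FK X P (qf l') t u y.
Proof.
move=> t0 bu; rewrite /FK -ExZ; last first.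
  exact: (bm_ZX HE HX (rcontinuous_qf l') (qf_bound l') t0 bu).
apply: eq_Ex => w; rewrite !Zexp_qf// !mulrA -expRD; congr (expR _ * _ * _); ring.
Qed.

Let c_le0 x xi : U xi -> c x xi <= 0.
Proof. by move=> /(c_le x)/le_trans; apply; exact: ltW. Qed.

Let M_ge h x xi := @Mop_ge R E c U U0 c_le0 h x xi.
Let M_le h x b := @Mop_le R E c U U0 h x b.

(* A solution of the one-step equation on [B] in exponential form, shifted by a
   constant so that its supremum over [U] is zero. *)
Definition nsol (B : set E) (d l : R) (w : E -> R) : Prop :=
  (bm (fun x => expR (w x)) /\ (exists K, forall x, w x <= K)) /\
  [/\ forall xi, U xi -> w xi <= 0,
      forall e : R, 0 < e -> exists2 xi, U xi & - e < w xi,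
      forall x, Mop w x <= w x,
      forall x, ~ B x -> w x = Mop w x &
      forall x, B x -> expR (w x) =
        Num.max (FK X P (qf l) d (fun y => expR (w y)) x) (expR (Mop w x))].

(** The supremum [s] of [w] over [U] is subtracted, and both the impulse operator and the equation
    commute with constants. Continuity of [w] on the closed set [B] and of [Mop w] outside gives
    measurability. *)
Lemma OS_nsol (B : set E) (d l : R) (w : E -> R) : rcompact rho B -> U `<=` B -> 0 <= d ->
  OS X P rho f c U B d l w -> exists w', nsol B d l w'.
Proof.
move=> cB UB d0 [[K wK] cw wM wE].
have bU : bounded_onU U w.
  by exists K => xi /UB/wK; exact: le_trans (ler_norm _).
have M_K x : Mop w x <= K.
  apply: M_le => xi Uxi; have := c_le0 x Uxi; have := wK xi (UB xi Uxi).
  by rewrite ler_norml => /andP[? ?] ?; lra.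
have w_K x : w x <= K.
  have [Bx|Bx] := pselect (B x); first exact: le_trans (ler_norm _) (wK x Bx).
  by rewrite wM.
have mB := rcompact_measurable HE cB.
have mw : measurable_fun setT w.
  rewrite -(setUv B); apply/measurable_funU => //; first exact: measurableC.
  split; first exact: (rcontinuous_on_measurable HE mB cw).
  apply: (eq_measurable_fun (Mop w)) => [x|].
    by rewrite inE => /wM ->.
  apply: measurable_funTS; apply: (rcontinuous_measurable HE).
  exact: (rcontinuous_Mop (lcs_metric HE) U0 c_le0 c_cont cU bU).
have bW : bm (fun x => expR (w x)).
  split; first exact: measurableT_comp.
  by exists (expR K) => x; rewrite ger0_norm ?expR_ge0// ler_expR.
pose s := sup [set w xi | xi in U].
have hs : has_sup [set w xi | xi in U].
  split; first by have [xi Uxi] := U0; exists (w xi), xi.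
  by have [K' hK'] := bU; exists K' => _ [xi Uxi <-]; exact: hK'.
have Ms x : Mop (fun y => w y - s) x = Mop w x - s := Mop_shift U0 c_le0 x s bU.
have eW : (fun x => expR (w x - s)) = (fun x => expR (- s) * expR (w x)).
  by apply/funext => x; rewrite -expRD addrC.
exists (fun x => w x - s); split; [split|split].
- by rewrite eW; exact: bmZ.
- by exists (K - s) => x; rewrite lerD2r.
- by move=> xi Uxi; rewrite subr_le0; apply: ub_le_sup; [case: hs|exists xi].
- move=> e e0; have [_ [xi Uxi <-] h] := sup_adherent e0 hs; exists xi => //.
  by move: h; rewrite -/s; lra.
- move=> x; rewrite Ms lerD2r//.
  have [Bx|Bx] := pselect (B x); last by rewrite -wM.
  by rewrite (wE x Bx) le_max lexx orbT.
- by move=> x Bx; rewrite Ms wM.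
- move=> x Bx; rewrite Ms eW (FKZ HE HX (rcontinuous_qf l) (qf_bound l))//.
  have es z : expR (z - s) = expR (- s) * expR z by rewrite -expRD addrC.
  rewrite !es -maxr_pMr ?expR_ge0//; congr (_ * _); rewrite {1}(wE x Bx).
  set A := Defs.Ex _ _ _.
  (* Outside [B] the solution equals its impulse value, so the case distinction at time [d]
     disappears. *)
  have AE : A = FK X P (qf l) d (fun y => expR (w y)) x.
    apply: eq_Ex => om; rewrite /Zexp -expRD; congr (expR (_ + _)).
    by case: asboolP => // /wM ->.
  (* [expR] undoes [ln] only on positive numbers, so a lower bound on the expectation is needed; the
     second entry of the maximum handles an exit from [B] followed by an impulse. *)
  have A0 : 0 < A.
    rewrite AE; apply: (@lt_le_trans _ _ (expR (- ((Cf + `|l|) * d)) * expR (- Num.max K (Cc + K)))).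
      by rewrite mulr_gt0 ?expR_gt0.
    apply: Ex_ge_cst; first exact: (bm_ZX HE HX (rcontinuous_qf l) (qf_bound l) d0 bW).
    move=> om; apply: ler_pM; rewrite ?expR_ge0//.
      by have /andP[] := Zexp_le HE HX (rcontinuous_qf l) (qf_bound l) om d0.
    rewrite ler_expR lerNl le_max; have [Bo|Bo] := pselect (B (X d om)).
      by have := wK _ Bo; rewrite ler_norml lerNl => /andP[-> _].
    rewrite wM//; have [xi Uxi] := U0; apply/orP; right.
    have := M_ge (X d om) bU Uxi; have := cC (X d om) Uxi; have := wK xi (UB _ Uxi).
    by rewrite !ler_norml => /andP[? ?] /andP[? ?]; lra.
  rewrite -AE; have [h|h] := leP (ln A) (Mop w x).
    by rewrite (max_idPr _)// -[leLHS]lnK ?posrE// ler_expR.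
  by rewrite (max_idPl _) ?lnK ?posrE// -[leRHS]lnK ?posrE// ler_expR ltW.
Qed.

Section nsol_theory.
Variables (B : set E) (d l : R) (w : E -> R).
Hypothesis sw : nsol B d l w.

Lemma nsol_bm : bm (fun x => expR (w x)). Proof. by have [[]] := sw. Qed.

Lemma nsol_bU : bounded_onU U w.
Proof. by exists 0 => xi Uxi; have [_ [+ _ _ _ _]] := sw; apply. Qed.

Lemma nsol_Mop_le x : Mop w x <= w x. Proof. by have [_ [_ _ + _ _]] := sw. Qed.

Lemma nsol_U_le0 xi : U xi -> w xi <= 0. Proof. by have [_ [+ _ _ _ _]] := sw => /(_ xi). Qed.

(** An impulse to a point of [U] where [w] is almost zero costs at most [Cc]. The bounds are the
    same for all solutions, which makes limits along an ultrafilter possible. *)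
Lemma nsol_Mop_bound x : - Cc <= Mop w x <= 0.
Proof.
have [_ [wU we _ _ _]] := sw; apply/andP; split.
  apply/ler_addgt0Pr => e e0; have [xi Uxi h] := we e e0.
  have := M_ge x nsol_bU Uxi; have := cC x Uxi; rewrite ler_norml => /andP[? ?]; lra.
by apply: M_le => xi Uxi; have := wU xi Uxi; have := c_le0 x Uxi; lra.
Qed.

Lemma nsol_ge x : - Cc <= w x.
Proof. by have /andP[h _] := nsol_Mop_bound x; rewrite (le_trans h)// nsol_Mop_le. Qed.

Lemma nsol_subsolution x :
  expR (w x) <= Num.max (FK X P (qf l) d (fun y => expR (w y)) x) (expR (Mop w x)).
Proof.
have [_ [_ _ _ h1 h2]] := sw.
have [Bx|Bx] := pselect (B x); first by rewrite h2.
by rewrite h1// le_max lexx orbT.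
Qed.

Lemma nsol_supersolution x : B x ->
  FK X P (qf l) d (fun y => expR (w y)) x <= expR (w x).
Proof. by have [_ [_ _ _ _ h2]] := sw => Bx; rewrite [leRHS]h2// le_max lexx. Qed.

End nsol_theory.

(* At an approximate maximum point of [w1 - w2] the first solution cannot continue,
   so it must give an impulse; the impulse leads to another approximate maximum
   point, at which [w1] is larger by [- c0].  As [w1 <= 0] on [U], this cannot be
   repeated forever. *)
Lemma nsol_compare (B1 B2 : set E) (d l1 l2 : R) (w1 w2 : E -> R) : 0 < d ->
  U `<=` B1 -> B1 `<=` B2 -> nsol B1 d l1 w1 -> nsol B2 d l2 w2 -> l1 <= l2.
Proof.
move=> d0 UB B12 s1 s2; rewrite leNgt; apply/negP => l21.
have [[_ [K wK]] [_ _ _ w1M w1E]] := s1.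
have b1 := nsol_bU s1; have b2 := nsol_bU s2.
pose S := [set w1 x - w2 x | x in B1].
have [xi0 Uxi0] := U0.
have hS : has_sup S.
  split; first by exists (w1 xi0 - w2 xi0), xi0 => //; exact: UB.
  by exists (K + Cc) => _ [x _ <-]; have := wK x; have := nsol_ge s2 x; lra.
set D := sup S.
have DS x : B1 x -> w1 x - w2 x <= D.
  by move=> Bx; apply: ub_le_sup; [case: hS|exists x].
have Mle x (D' : R) : (forall xi, U xi -> w1 xi - w2 xi <= D') -> Mop w1 x <= Mop w2 x + D'.
  move=> h; apply: M_le => xi Uxi; have := h xi Uxi; have := M_ge x b2 Uxi; lra.
have DSall x : w1 x <= w2 x + D.
  have [Bx|Bx] := pselect (B1 x); first by have := DS x Bx; lra.
  rewrite w1M//; apply: (@le_trans _ _ (Mop w2 x + D)).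
    by apply: Mle => xi Uxi; apply: DS; exact: UB.
  by rewrite lerD2r (nsol_Mop_le s2).
pose eta := (l1 - l2) * d; have eta0 : 0 < eta by rewrite mulr_gt0// subr_gt0.
(* If [w1] continues at [x], the larger constant makes one step lose the factor [exp (- eta)]
   against [w2], whose supersolution inequality holds on [B1]. *)
have dich x : B1 x -> w1 x - w2 x <= D - eta \/ w1 x = Mop w1 x.
  move=> Bx; have := w1E x Bx.
  have [h1 e1|h1 e1] := leP (FK X P (qf l1) d (fun y => expR (w1 y)) x) (expR (Mop w1 x)).
    by right; apply: expR_inj.
  left; suff : expR (w1 x) <= expR (w2 x + D - eta) by rewrite ler_expR; lra.
  rewrite e1 (FK_qf l1 l2 x (ltW d0) (nsol_bm s1)).
  apply: (@le_trans _ _ (expR ((l2 - l1) * d) * (expR D * expR (w2 x)))); last first.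
    by rewrite -!expRD ler_expR /eta; lra.
  rewrite ler_wpM2l ?expR_ge0//.
  apply: (@le_trans _ _ (expR D * FK X P (qf l2) d (fun y => expR (w2 y)) x)).
    rewrite -(FKZ HE HX (rcontinuous_qf l2) (qf_bound l2) _ _ (ltW d0) (nsol_bm s2)).
    apply: (FK_le HE HX (rcontinuous_qf l2) (qf_bound l2) _ (ltW d0) (nsol_bm s1)).
      by apply: bmZ; exact: nsol_bm s2.
    by move=> y; rewrite -expRD ler_expR addrC.
  by rewrite ler_wpM2l ?expR_ge0// (nsol_supersolution s2)//; exact: B12.
(* Were the difference bounded by [D - e'] on [U], impulses would carry this bound to [B1], and
   continuation loses at least [eta]; then [D] would not be the supremum. *)
have DU (e : R) : 0 < e -> exists2 xi, U xi & D - e < w1 xi - w2 xi.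
  move=> e0; apply: contrapT => hno.
  pose e' := Num.min e eta; have e'0 : 0 < e' by rewrite lt_min e0.
  have e'e : e' <= e by rewrite ge_min lexx.
  have e'eta : e' <= eta by rewrite ge_min lexx orbT.
  have Un xi : U xi -> w1 xi - w2 xi <= D - e'.
    move=> Uxi; rewrite leNgt; apply/negP => h; apply: hno; exists xi => //; lra.
  suff : D <= D - e' by lra.
  apply: ge_sup; first by case: hS.
  move=> _ [x Bx <-]; have [h|h] := dich x Bx; first by lra.
  by rewrite h; have := Mle x _ Un; have := nsol_Mop_le s2 x; lra.
(* With this [N] the number [- Cc + N * (- c0 / 2)] is positive, which contradicts [w1 <= 0] on
   [U]. *)
pose N := (Num.truncn (2 * Cc / - c0)).+1.
have c0' : 0 < - c0 by rewrite oppr_gt0.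
have Nc : 2 * Cc < N%:R * - c0 by rewrite -ltr_pdivrMr// truncnS_gt.
(* The first entry keeps the total loss of [N] impulses below [eta / 2], so continuation stays
   excluded; the second leaves a gain of at least [- c0 / 2] per impulse. *)
pose e := Num.min (eta / (2 * N%:R)) (- c0 / 2).
have N0 : 0 < N%:R :> R by rewrite ltr0n.
have e0 : 0 < e by rewrite lt_min !divr_gt0// mulr_gt0.
have eN : N%:R * e <= eta / 2.
  rewrite (@le_trans _ _ (N%:R * (eta / (2 * N%:R))))//.
    by apply: ler_wpM2l; [exact: ltW|rewrite /e ge_min lexx].
  by rewrite le_eqVlt; apply/orP; left; apply/eqP; field; rewrite gt_eqF.
have ec : e <= - c0 / 2 by rewrite /e ge_min lexx orbT.
have iterate j : (j <= N)%N -> exists2 xi, U xi &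
    D - eta / 2 - j%:R * e < w1 xi - w2 xi /\ - Cc + j%:R * (- c0 / 2) <= w1 xi.
  elim: j => [_|j ih jN].
    have [xi Uxi h] := DU _ (divr_gt0 eta0 (ltr0Sn R 1)).
    by exists xi => //; rewrite !mul0r subr0 addr0; split => //; exact: nsol_ge s1 xi.
  have [xi Uxi [h1 h2]] := ih (ltnW jN).
  have je : j%:R * e <= N%:R * e.
    by apply: ler_wpM2r; [exact: ltW|rewrite ler_nat ltnW].
  have [h|h] := dich xi (UB xi Uxi); first by lra.
  have [zeta Uz hz] := Mop_adherent U0 c_le0 xi b1 e0.
  have z1 := M_ge xi b2 Uz; have z2 := nsol_Mop_le s2 xi; have z3 := c_le xi Uz.
  have jS (z : R) : j.+1%:R * z = j%:R * z + z by rewrite -natr1 mulrDl mul1r.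
  by exists zeta => //; rewrite !jS; split; lra.
have [xi Uxi [_ h]] := iterate N (leqnn N).
have := nsol_U_le0 s1 Uxi; lra.
Qed.

End one_step_equation.

(** * Ultralimits of solutions of the one-step equation *)

Section ultrafilter_limits.
Context {R : realType} {I : Type} (UU : set_system I) {UF : UltraFilter UU}.

(** The limit is the supremum of the levels [r] with [r <= a i] for almost all [i]; the estimate
    from above uses that an ultrafilter contains a set or its complement. *)
Lemma ulim_ex (a : I -> R) (K : R) : (forall i, `|a i| <= K) ->
  exists L, forall e : R, 0 < e -> UU [set i | `|a i - L| <= e].
Proof.
move=> aK; pose S := [set r | UU [set i | r <= a i]].
have hS : has_sup S.
  split.
    exists (- K); rewrite /S/= (_ : mkset _ = setT); first exact: filterT.
    by apply/seteqP; split => // i _ /=; have := aK i; rewrite ler_norml => /andP[].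
  exists K => r /= /filter_ex[i /= ri]; apply: (le_trans ri).
  exact: le_trans (ler_norm _) (aK i).
exists (sup S) => e e0.
have h1 : UU [set i | sup S - e <= a i].
  have [r Sr er] := sup_adherent e0 hS.
  by apply: filterS Sr => i /= ri; rewrite (le_trans (ltW er)).
have h2 : UU [set i | a i <= sup S + e].
  have [//|h] := in_ultra_setVsetC [set i | a i <= sup S + e] UF.
  have : S (sup S + e).
    by apply: filterS h => i /= /negP; rewrite -ltNge => /ltW.
  by move=> /(ub_le_sup hS.2); lra.
apply: filterS (filterI h1 h2) => i /= [? ?].
by rewrite ler_norml; apply/andP; split; lra.
Qed.

Context {E : Type} (rho : E -> E -> R) (c : E -> E -> R) (U : set E).
Hypothesis rhoM : is_metric rho.
Hypothesis U0 : U !=set0.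
Variable Cc : R.
Hypothesis c_le0 : forall x xi, U xi -> c x xi <= 0.
Hypothesis c_cont : forall x xi (e : R), U xi -> 0 < e -> exists2 eta : R, 0 < eta &
  forall y zeta, U zeta -> rho x y < eta -> rho xi zeta < eta ->
  `|c x xi - c y zeta| < e.
Hypothesis c_tail : forall e : R, 0 < e -> exists K, rcompact rho K /\
  forall x y xi, ~ K x -> ~ K y -> U xi -> `|c x xi - c y xi| <= e.
Hypothesis cU : rcompact rho U.
Variable w : I -> E -> R.
Hypothesis wU : forall i xi, U xi -> - Cc <= w i xi <= 0.

Local Notation Mop := (Mop c U).

Let bU i : bounded_onU U (w i).
Proof. by exists 0 => xi /(wU i)/andP[]. Qed.

(* On a small ball around [xi0] the function [c x xi] hardly depends on [xi],
   uniformly in [x], so that only the supremum of [w i] over the ball matters,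
   and these suprema converge along the ultrafilter. *)
Lemma Mop_ultra_cauchy (e : R) : 0 < e -> exists2 A, UU A &
  forall i j, A i -> A j -> forall x, Mop (w i) x <= Mop (w j) x + e.
Proof.
move=> e0; have e40 := divr_gt0 e0 (ltr0Sn R 7).
suff [A UA hA] : exists2 A, UU A & forall i j, A i -> A j ->
    forall x xi, U xi -> U xi -> c x xi + w i xi <= Mop (w j) x + e.
  exists A => // i j Ai Aj x; apply: (Mop_le U0) => xi Uxi; exact: hA.
apply: (rcompact_ind rhoM (Q := fun S => exists2 A, UU A & forall i j, A i -> A j ->
    forall x xi, S xi -> U xi -> c x xi + w i xi <= Mop (w j) x + e)) cU _ _ _ _.
- by exists setT; [exact: filterT|].
- move=> S T [A UA hA] [B UB hB]; exists (A `&` B); first exact: filterI.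
  by move=> i j [Ai Bi] [Aj Bj] x xi [] ? ?; [exact: hA|exact: hB].
- by move=> S T ST [A UA hA]; exists A => // i j Ai Aj x xi /ST; exact: hA.
- move=> xi0 Uxi0; have [r r0 hr] := c_unif rhoM c_cont c_tail Uxi0 e40.
  exists r => //; pose V i := [set w i xi | xi in U `&` rball rho xi0 r].
  have xi0V : (U `&` rball rho xi0 r) xi0 by split => //; rewrite /rball/= (rho_xx rhoM).
  have hV i : has_sup (V i).
    split; first by exists (w i xi0), xi0.
    by exists 0 => _ [xi [Uxi _] <-]; have /andP[] := wU i Uxi.
  have sV i : `|sup (V i)| <= `|Cc|.
    rewrite ler_norml; apply/andP; split.
      apply: (@le_trans _ _ (w i xi0)).
        by have /andP[h _] := wU i Uxi0; apply: le_trans h; rewrite lerN2 ler_norm.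
      by apply: ub_le_sup; [case: (hV i)|exists xi0].
    apply: (@le_trans _ _ 0) => //; apply: ge_sup; first by case: (hV i).
    by move=> _ [xi [Uxi _] <-]; have /andP[] := wU i Uxi.
  have [L hL] := ulim_ex sV.
  exists [set i | `|sup (V i) - L| <= e / 8]; first exact: hL.
  move=> i j /= hi hj x xi xir Uxi.
  have [_ [zeta [Uz zr] <-] hz] := sup_adherent e40 (hV j).
  have z1 := hr xi Uxi xir x; have z2 := hr zeta Uz zr x.
  have z3 := Mop_ge U0 c_le0 x (bU j) Uz.
  have z4 : w i xi <= sup (V i) by apply: ub_le_sup; [case: (hV i)|exists xi].
  move: hi hj z1 z2; rewrite !ler_norml => /andP[? ?] /andP[? ?] /andP[? ?] /andP[? ?].
  lra.
Qed.

Lemma Mop_ultra_lim : (forall i x, - Cc <= Mop (w i) x <= 0) ->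
  exists g, forall e : R, 0 < e -> UU [set i | forall x, `|Mop (w i) x - g x| <= e].
Proof.
move=> MC.
have /choice[g hg] : forall x, exists L, forall e : R, 0 < e ->
    UU [set i | `|Mop (w i) x - L| <= e].
  move=> x; apply: (@ulim_ex _ `|Cc|) => i; rewrite ler_norml.
  have /andP[h1 h2] := MC i x; apply/andP; split.
    by apply: le_trans h1; rewrite lerN2 ler_norm.
  exact: le_trans h2 _.
exists g => e e0; have [A UA hA] := Mop_ultra_cauchy (divr_gt0 e0 (ltr0Sn R 1)).
apply: filterS (UA) => i Ai x.
(* The index [j] depends on [x], but the Cauchy estimate on [A] is uniform in [x], so the bound at
   [i] is uniform too. *)
have [j [Aj /= hj]] := filter_ex (filterI UA (hg x _ (divr_gt0 e0 (ltr0Sn R 1)))).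
have h1 := hA i j Ai Aj x; have h2 := hA j i Aj Ai x.
move: hj; rewrite !ler_norml => /andP[? ?]; apply/andP; split; lra.
Qed.

End ultrafilter_limits.

(** * An ultrafilter of index pairs that realizes the lower limit *)

Section liminf_filter.
Context {R : realType}.
Variables (lam : nat -> nat -> R) (lam0 : R).

(** Monotonicity in [m] makes the inner limit a supremum, so closeness at one [m] persists for all
    larger ones; the threshold [N] may depend on [k]. *)
Lemma liminf_lim_frequently : (forall m k, lam m k <= lam m.+1 k) ->
  limn_einf (fun k => limn (fun m => (lam m k)%:E)) = lam0%:E ->
  forall (e : R) K, 0 < e -> exists2 k, (K <= k)%N &
    exists N, forall m, (N <= m)%N -> `|lam m k - lam0| < e.
Proof.
move=> lamS hl e K e0; pose u k := limn (fun m => (lam m k)%:E).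
have lamn k m n : (m <= n)%N -> lam m k <= lam n k.
  by move=> /subnK <-; elim: (n - m)%N => [//|j ih]; rewrite addSn (le_trans ih).
have uE k : u k = ereal_sup (range (fun m => (lam m k)%:E)).
  apply/cvg_lim => //; apply: ereal_nondecreasing_cvgn => m n mn.
  by rewrite lee_fin lamn.
have iE : ereal_sup (range (einfs u)) = lam0%:E.
  rewrite -hl limn_einf_lim; apply/esym/cvg_lim => //.
  by apply: ereal_nondecreasing_cvgn; exact: nondecreasing_einfs.
have : ((lam0 - e)%:E < ereal_sup (range (einfs u)))%E by rewrite iE lte_fin; lra.
move=> /ereal_sup_gt[_ [n0 _ <-]] hn0; pose n := maxn n0 K.
have hn : ((lam0 - e)%:E < einfs u n)%E.
  by apply: (lt_le_trans hn0); apply: nondecreasing_einfs; exact: leq_maxl.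
have : (einfs u n < (lam0 + e)%:E)%E.
  apply: (@le_lt_trans _ _ lam0%:E); last by rewrite lte_fin; lra.
  by rewrite -iE; apply: ereal_sup_ubound; exists n.
move=> /ereal_inf_lt[_ [k /= nk <-]] uk.
have kl : ((lam0 - e)%:E < u k)%E.
  by apply: (lt_le_trans hn); apply: ereal_inf_lbound; exists k.
exists k; first exact: leq_trans (leq_maxr _ _) nk.
have := kl; rewrite uE => /ereal_sup_gt[_ [N _ <-]]; rewrite lte_fin => hN.
exists N => m Nm; have h1 := lamn k N m Nm.
have : ((lam m k)%:E < (lam0 + e)%:E)%E.
  by apply: le_lt_trans uk; rewrite uE; apply: ereal_sup_ubound; exists m.
by rewrite lte_fin => h2; rewrite ltr_norml; apply/andP; split; lra.
Qed.

(** The frequency hypothesis says exactly that no set of the base is empty. An arbitrary function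
    [phi] is allowed because the probability of leaving [B_m] at the times of a grid must be made
    small after its step is known. *)
Lemma liminf_ultrafilter :
  (forall (e : R) K, 0 < e -> exists2 k, (K <= k)%N &
    exists N, forall m, (N <= m)%N -> `|lam m k - lam0| < e) ->
  exists UU : set_system (nat * nat), UltraFilter UU /\
    (forall e : R, 0 < e -> UU [set i | `|lam i.2 i.1 - lam0| < e]) /\
    (forall K (phi : nat -> nat), UU [set i | (K <= i.1)%N /\ (phi i.1 <= i.2)%N]).
Proof.
move=> fr.
pose base (e : R) (K : nat) (phi : nat -> nat) : set (nat * nat) :=
  [set i | `|lam i.2 i.1 - lam0| < e /\ ((K <= i.1)%N /\ (phi i.1 <= i.2)%N)].
pose F0 : set_system (nat * nat) :=
  [set A | exists (e : R) K phi, 0 < e /\ base e K phi `<=` A].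
have pF0 : ProperFilter F0.
  split.
    move=> [e [K [phi [e0 h]]]]; have [k Kk [N hN]] := fr e K e0.
    apply: (h (k, maxn N (phi k))); split => /=; first by apply: hN; exact: leq_maxl.
    by split => //; exact: leq_maxr.
  split.
  - by exists 1, 0%N, id; split.
  - move=> A B [e1 [K1 [p1 [e10 h1]]]] [e2 [K2 [p2 [e20 h2]]]].
    exists (Num.min e1 e2), (maxn K1 K2), (fun k => maxn (p1 k) (p2 k)).
    split; first by rewrite lt_min e10.
    move=> i [/= l1 [l2 l3]]; move: l1 l2 l3.
    rewrite lt_min !geq_max => /andP[? ?] /andP[? ?] /andP[? ?].
    by split; [apply: h1|apply: h2].
  - move=> A B AB [e [K [phi [e0 h]]]]; exists e, K, phi; split => //.
    exact: subset_trans AB.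
have [UU [uU F0U]] := ultraFilterLemma pF0.
exists UU; split => //; split.
- by move=> e e0; apply: F0U; exists e, 0%N, (fun=> 0%N); split => // i [].
- by move=> K phi; apply: F0U; exists 1, K, phi; split => // i [].
Qed.

End liminf_filter.

Lemma exp_small {R : realType} (K kappa e : R) (M : nat) : 0 <= K -> 0 < kappa -> 0 < e ->
  exists2 j, (M <= j)%N & K * expR (- (kappa * j%:R)) <= e.
Proof.
move=> K0 k0 e0; pose j := maxn M (Num.truncn (K / (kappa * e))).+1.
exists j; first exact: leq_maxl.
have hj : K / (kappa * e) <= j%:R.
  apply: (le_trans (ltW (truncnS_gt _))); rewrite ler_nat; exact: leq_maxr.
rewrite expRN ler_pdivrMr ?expR_gt0//.
move: hj; rewrite ler_pdivrMr ?mulr_gt0// => /le_trans; apply.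
apply: (@le_trans _ _ (e * (1 + kappa * j%:R))).
  have -> : j%:R * (kappa * e) = e * (kappa * j%:R) by ring.
  by rewrite mulrDr mulr1 lerDr ltW.
by rewrite ler_pM2l// expR_ge1Dx.
Qed.

(** * Decay of the semigroup and comparison of solutions with the stopping value *)

Section fixed_point.
Context {R : realType} {dE dO : measure_display}
  {E : measurableType dE} {Om : measurableType dO}.
Variables (X : R -> Om -> E) (P : E -> probability Om R) (F : R -> set (set Om))
  (rho : E -> E -> R) (f : E -> R) (c : E -> E -> R) (U : set E).
Hypotheses (HE : lcs_metric_borel rho) (HX : standard_feller_markov X P F rho).
Hypotheses (cU : rcompact rho U) (U0 : U !=set0).
Variables (Cf Cc c0 : R).
Hypotheses (cf : rcontinuous rho f) (fC : forall x, `|f x| <= Cf).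
Hypothesis cC : forall x xi, U xi -> `|c x xi| <= Cc.
Hypotheses (c0_lt0 : c0 < 0) (c_le : forall x xi, U xi -> c x xi <= c0).
Hypothesis c_cont : forall x xi (e : R), U xi -> 0 < e -> exists2 eta : R, 0 < eta &
  forall y zeta, U zeta -> rho x y < eta -> rho xi zeta < eta ->
  `|c x xi - c y zeta| < e.

Local Notation Mop := (Mop c U).
Local Notation qf := (qf f).

Let c_le0 x xi : U xi -> c x xi <= 0.
Proof. by move=> /(c_le x)/le_trans; apply; exact: ltW. Qed.

Lemma FK_qf0 l t u y : 0 <= t -> bm u ->
  FK X P (qf l) t u y = expR (- (l * t)) * FK X P f t u y.
Proof.
move=> t0 bu; rewrite /FK -ExZ; last exact: (bm_ZX HE HX cf fC t0 bu).
by apply: eq_Ex => w; rewrite (Zexp_qf HE HX cf fC)// mulrA.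
Qed.

(** A rate [mu] strictly between [r(f)] and [lam0] absorbs the error of the limit from some integer
    horizon on. *)
Lemma rf_decay (lam0 : R) (rf : \bar R) :
  ((rf_approx X P f t)%:E @[t --> +oo] --> rf) -> (rf < lam0%:E)%E ->
  exists mu, mu < lam0 /\ exists2 M : nat, (0 < M)%N & forall T : nat, (M <= T)%N ->
    forall x, FK X P f T%:R (cst 1) x <= expR (mu * T%:R).
Proof.
move=> rfl rfl0.
have [mu rmu mul] : exists2 mu : R, (rf < mu%:E)%E & mu < lam0.
  (* The midpoint serves for a finite rate and [lam0 - 1] for the rate minus infinity. *)
  case: rf rfl rfl0 => [r _|//|_ _].
  - rewrite lte_fin => rl; exists ((r + lam0) / 2); rewrite ?lte_fin; lra.
  - by exists (lam0 - 1); [rewrite ltNyr|lra].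
exists mu; split => //.
have [A [_ hA]] : \forall t \near +oo, rf_approx X P f t < mu.
  have : nbhs rf [set y | (y < mu%:E)%E].
    by apply: open_nbhs_nbhs; split => //; exact: open_ereal_lt_ereal.
  by move=> /rfl[A [Ar hA]]; exists A; split => // t /hA; rewrite /= lte_fin.
exists (Num.truncn `|A|).+1 => // T MT x.
have T0 : 0 < T%:R :> R by rewrite ltr0n (leq_trans _ MT).
have AT : A < T%:R.
  apply: (le_lt_trans (ler_norm A)); apply: (lt_le_trans (truncnS_gt _)).
  by rewrite ler_nat.
have := hA _ AT; rewrite /rf_approx.
set S := [set _ | _ in _].
have bZ := bm_Z HE HX cf fC (ltW T0).
have ZT w := Zexp_le HE HX cf fC w (ltW T0).
have SE y : Ex P y (fun w => expR (tint (fun s => f (X s w)) T%:R)) =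
    FK X P f T%:R (cst 1) y by apply: eq_Ex => w; rewrite mulr1.
have hS : has_sup S.
  split; first by exists (FK X P f T%:R (cst 1) x), x.
  exists (expR (Cf * T%:R)) => _ [y _ <-]; apply: Ex_le_cst => // w.
  by have /andP[] := ZT w.
have xS : FK X P f T%:R (cst 1) x <= sup S by apply: ub_le_sup; [case: hS|exists x].
have S0 : 0 < sup S.
  apply: lt_le_trans xS; apply: (@lt_le_trans _ _ (expR (- (Cf * T%:R)))).
    exact: expR_gt0.
  rewrite -SE; apply: Ex_ge_cst => // w; by have /andP[] := ZT w.
rewrite mulrC ltr_pdivrMr// => /ltW h; apply: (le_trans xS).
by rewrite -[leLHS]lnK ?posrE// ler_expR.
Qed.

(** Replacing [l] by [l'] multiplies each step by at most [exp (a * d)], and the reward enters once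
    with the factor [b]; where the strategy stops early, the excess factor is at least [1]. *)
Lemma Vn_perturb (l l' a b : R) (G G' : E -> R) (d : R) n y : 0 <= d ->
  bm G -> bm G' -> (forall x, 0 <= G x) -> (forall x, G' x <= b * G x) ->
  0 <= b -> 0 <= a -> l - l' <= a ->
  Vn X P (qf l') G' d n y <= b * expR (a * (n%:R * d)) * Vn X P (qf l) G d n y.
Proof.
move=> d0 bG bG' G0 GG b0 a0 la.
have cq l1 := rcontinuous_qf cf l1; have qC l1 := qf_bound fC l1.
have bV m := bm_Vn HE HX (cq l) (qC l) bG m d0.
have bV' m := bm_Vn HE HX (cq l') (qC l') bG' m d0.
elim: n y => [|n ih] y; first by rewrite mul0r mulr0 expR0 mulr1.
have ead : 1 <= expR (a * (n.+1%:R * d)).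
  by rewrite -expR0 ler_expR mulr_ge0// mulr_ge0.
rewrite VnS ge_max; apply/andP; split; last first.
  apply: (le_trans (GG y)); rewrite -[b * _ * _]mulrA; apply: ler_wpM2l => //.
  apply: (@le_trans _ _ (Vn X P (qf l) G d n.+1 y)); first exact: Vn_geG.
  by apply: ler_peMl => //; exact: Vn_ge0.
apply: (@le_trans _ _ (FK X P (qf l') d
    (fun x => b * expR (a * (n%:R * d)) * Vn X P (qf l) G d n x) y)).
  apply: (FK_le HE HX (cq l') (qC l')) => //; exact: bmZ.
rewrite (FKZ HE HX (cq l') (qC l'))// (FK_qf HE HX cf fC l' l)//.
have -> : expR (a * (n.+1%:R * d)) = expR (a * (n%:R * d)) * expR (a * d).
  by rewrite -expRD -natr1; congr expR; ring.
rewrite -!mulrA; apply: ler_wpM2l => //; apply: ler_wpM2l; first exact: expR_ge0.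
apply: ler_pM.
- exact: expR_ge0.
- by apply: FK_ge0 => x; exact: Vn_ge0.
- by rewrite ler_expR ler_wpM2r.
- by rewrite VnS le_max lexx.
Qed.

(** A path visits finitely many points at the grid times, and each of them lies in [B m] for [m]
    large; dominated convergence does the rest. *)
Lemma inB_vanish (B : nat -> set E) (d : R) (N : nat) x : 0 <= d ->
  (forall m, measurable (B m)) -> (forall m, B m `<=` B m.+1) -> \bigcup_m B m = setT ->
  forall e : R, 0 < e -> exists m0, forall m, (m0 <= m)%N ->
    fine (P x (~` inB X d (B m) N)) <= e.
Proof.
move=> d0 mB BS Bu e e0.
have Bn m n : (m <= n)%N -> B m `<=` B n.
  by move=> /subnK <-; elim: (n - m)%N => [//|j ih]; rewrite addSn; apply: subset_trans (BS _).
have Nd : 0 <= N%:R * d by rewrite mulr_ge0.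
have mI m : measurable (~` inB X d (B m) N).
  apply: measurableC; apply: (F_measurable HX Nd).
  exact: (F_inB HX d0 (mB m) (leqnSn N)).
have ev w : exists m0, forall m, (m0 <= m)%N -> inB X d (B m) N w.
  elim: N {Nd mI} => [|N [m0 ih]]; first by exists 0%N => m _ j.
  have [m1 _ Bm1] : (\bigcup_m B m) (X (N%:R * d) w) by rewrite Bu.
  exists (maxn m0 m1) => m; rewrite geq_max => /andP[h0 h1] j.
  rewrite ltnS leq_eqVlt => /predU1P[->|jN]; first exact: Bn h1 _ Bm1.
  exact: ih h0 j jN.
have : (fun m => Ex P x (\1_(~` inB X d (B m) N))) @ \oo --> Ex P x (cst 0).
  apply: (@Ex_cvg _ _ _ _ _ _ _ _ _ 1) => [m|m w|w].
  - exact: measurable_indic.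
  - by rewrite indicE normr_nat; case: (_ \in _); rewrite ?ler01.
  - have [m0 hm0] := ev w; apply: cvg_near_cst; exists m0 => // m /= /hm0 h.
    by rewrite indicE memNset.
rewrite Ex_cst => /cvgrPdist_le/(_ e e0)[m0 _ h]; exists m0 => m /h /=.
by rewrite sub0r normrN Ex_indic// => /(le_trans (ler_norm _)).
Qed.

Variables (lam0 mu : R) (M : nat).
Hypotheses (mu_lt : mu < lam0) (M0 : (0 < M)%N).
Hypothesis decay : forall T : nat, (M <= T)%N ->
  forall x, FK X P f T%:R (cst 1) x <= expR (mu * T%:R).

(** Half of the gap: every constant [l >= lam0 - kappa] leaves the decay rate [kappa]. *)
Definition kappa : R := (lam0 - mu) / 2.
Definition theta : R := expR (- (kappa * M%:R)).
(** A common bound of [f - l] for all [l] at distance at most [1] from [lam0]. *)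
Definition Cq : R := Cf + (`|lam0| + 1).

Lemma kappa_gt0 : 0 < kappa. Proof. by rewrite divr_gt0// subr_gt0. Qed.

Lemma theta01 : 0 <= theta < 1.
Proof.
rewrite expR_ge0/= -expR0 ltr_expR oppr_lt0 mulr_gt0 ?kappa_gt0// ltr0n //.
Qed.

Lemma FK_decay l (T : nat) x : mu + kappa <= l -> (M <= T)%N ->
  FK X P (qf l) T%:R (cst 1) x <= expR (- (kappa * T%:R)).
Proof.
move=> ml MT; rewrite FK_qf0//; last exact: bm_cst.
apply: (@le_trans _ _ (expR (- (l * T%:R)) * expR (mu * T%:R))).
  by apply: ler_wpM2l; [exact: expR_ge0|exact: decay].
rewrite -expRD ler_expR.
have : 0 <= (l - (mu + kappa)) * T%:R by rewrite mulr_ge0// subr_ge0.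
by rewrite mulrBl mulrDl; lra.
Qed.

Lemma qf_Cq l x : `|l - lam0| <= 1 -> `|qf l x| <= Cq.
Proof.
move=> h; apply: (le_trans (qf_bound fC l x)); rewrite /Cq lerD2l.
by have := ler_normD (l - lam0) lam0; rewrite subrK; lra.
Qed.

Local Notation D := (Vbd Cq M theta).

Section comparison.
Variables (B : set E) (k : nat) (l : R) (w : E -> R) (g : E -> R) (e a : R).
Hypotheses (sw : nsol X P f c U B (dl k) l w).
Hypotheses (ml : mu + kappa <= l) (l1 : `|l - lam0| <= 1).
Hypotheses (e0 : 0 <= e) (a0 : 0 <= a).
Hypotheses (cg : rcontinuous rho g) (g0 : forall x, g x <= 0).

Let cq l1 := rcontinuous_qf cf l1.
Let qC x := qf_Cq x l1.
Let cM : rcontinuous rho (Mop w) :=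
  rcontinuous_Mop (lcs_metric HE) U0 c_le0 c_cont cU (nsol_bU sw).

Lemma bm_exp_le0 (h : E -> R) : rcontinuous rho h -> (forall x, h x <= 0) ->
  bm (fun x => expR (h x)).
Proof.
move=> ch h0; split; last first.
  by exists 1 => x; rewrite ger0_norm ?expR_ge0// -expR0 ler_expR.
exact: (rcontinuous_measurable HE (rcontinuous_expR ch)).
Qed.

Let M0' x : Mop w x <= 0.
Proof. by have /andP[] := nsol_Mop_bound U0 cC c0_lt0 c_le sw x. Qed.

Let bGw := bm_exp_le0 cM M0'.
Let bG := bm_exp_le0 cg g0.
Let d0 : 0 <= dl k :> R := ltW (dl_gt0 k).
Let bW := nsol_bm sw.
Let Gw1 x : expR (Mop w x) <= 1. Proof. by rewrite -expR0 ler_expR. Qed.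

Let FKth x : FK X P (qf l) M%:R (cst 1) x <= theta := FK_decay x ml (leqnn M).

Let sub (j : nat) y : expR (w y) <= Vn X P (qf l) (fun x => expR (Mop w x)) (dl k) (j * 2 ^ k) y +
  FK X P (qf l) j%:R (fun x => expR (w x)) y.
Proof.
have := subsolution_le HE HX (cq l) qC bGw (fun x => expR_ge0 _) (j * 2 ^ k) y d0 bW
  (fun x => expR_ge0 _) (nsol_subsolution sw).
by rewrite dl_mul.
Qed.

Let tail_le (K : R) (j : nat) y : 0 <= K -> (forall x, expR (w x) <= K) -> (M <= j)%N ->
  FK X P (qf l) j%:R (fun x => expR (w x)) y <= K * expR (- (kappa * j%:R)).
Proof.
move=> K0 wK Mj.
apply: (@le_trans _ _ (FK X P (qf l) j%:R (fun x => K * cst 1 x) y)).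
  apply: (FK_le HE HX (cq l) qC) => // [|x]; last by rewrite mulr1.
  by apply: bmZ; exact: bm_cst.
rewrite (FKZ HE HX (cq l) qC)//; last exact: bm_cst.
by apply: ler_wpM2l => //; exact: FK_decay.
Qed.

(** The bound [K] of [w] may vary with the solution; as the tail [K * exp (- kappa * j)] vanishes
    when [j] grows, only the bound of the stopping value remains. *)
Lemma nsol_le_Vbd y : expR (w y) <= D.
Proof.
have [[_ [K wK]] _] := sw.
apply/ler_addgt0Pr => z z0.
have [j Mj hj] := exp_small M (expR_ge0 K) kappa_gt0 z0.
apply: (le_trans (sub j y)); apply: lerD.
  exact: (Vn_le_Vbd HE HX (cq l) qC bGw (fun x => expR_ge0 _) Gw1 theta01 FKth).
by apply: le_trans hj; apply: tail_le => // x; rewrite ler_expR.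
Qed.

(** Here the tail is estimated with the bound [D] common to all solutions, so that [j] can be fixed
    before the solution. *)
Lemma nsol_upper (j : nat) y : lam0 - l <= a -> (forall x, Mop w x <= g x + e) ->
  (M <= j)%N ->
  expR (w y) <= expR (e + a * j%:R) *
      Vn X P (qf lam0) (fun x => expR (g x)) (dl k) (j * 2 ^ k) y +
    D * expR (- (kappa * j%:R)).
Proof.
move=> la Mg Mj; apply: (le_trans (sub j y)); apply: lerD; last first.
  apply: tail_le => //; last exact: nsol_le_Vbd.
  exact: le_trans (expR_ge0 (w y)) (nsol_le_Vbd y).
have := @Vn_perturb lam0 l a (expR e) (fun x => expR (g x)) (fun x => expR (Mop w x))
  (dl k) (j * 2 ^ k) y d0 bG bGw (fun x => expR_ge0 _) _ (expR_ge0 e) a0 la.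
rewrite dl_mul -expRD; apply => x.
by rewrite -expRD ler_expR addrC.
Qed.

(** A stopping rule optimal on the coarse grid [dl k0] is used against the supersolution inequality
    on the fine grid [dl k], valid until the exit from [B]; the exit event is paid with the largest
    possible reward. *)
Lemma nsol_lower (k0 n0 : nat) x : (k0 <= k)%N -> measurable B -> l - lam0 <= a ->
  (forall x, g x <= Mop w x + e) ->
  Vn X P (qf lam0) (fun x => expR (g x)) (dl k0) n0 x <=
    expR (e + a * (n0%:R * dl k0)) * expR (w x) +
    expR (Cq * (n0%:R * dl k0)) * fine (P x (~` inB X (dl k) B (n0 * 2 ^ (k - k0)))).
Proof.
move=> kk mB la gM.
have l01 : `|lam0 - lam0| <= 1 by rewrite subrr normr0.
have qC0 x' := qf_Cq x' l01.
have dk0 : 0 <= dl k0 :> R by apply/ltW/dl_gt0.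
have [tau [tN Ft ->]] := Vn_attained HE HX (cq lam0) qC0 bG n0 dk0.
(* One coarse step is [p] fine steps, so the rule becomes [t = tau * p], which takes only multiples
   of [p] as values. *)
pose p := (2 ^ (k - k0))%N; pose N := (n0 * p)%N; set T := n0%:R * dl k0.
have dlE : dl k0 = p%:R * dl k :> R by rewrite (dlD k0 (k - k0)) subnKC.
pose t w' := (tau w' * p)%N.
have tE w' : (t w')%:R * dl k = (tau w')%:R * dl k0 :> R by rewrite dlE mulrA -natrM.
have ttN w' : (t w' <= N)%N by rewrite leq_mul2r tN orbT.
have p0 : (0 < p)%N by rewrite expn_gt0.
have id0 (i : nat) : 0 <= i%:R * dl k :> R by rewrite mulr_ge0.
have Ftt i : F (i%:R * dl k) [set w' | t w' = i].
  have [/dvdnP[q iq]|ndv] := boolP (p %| i)%N.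
    rewrite (_ : mkset _ = [set w' | tau w' = q]).
      by rewrite iq natrM -mulrA -dlE.
    apply/seteqP; split => w' /=; rewrite /t iq; last by move=> ->.
    by move=> /eqP; rewrite eqn_pmul2r// => /eqP.
  rewrite (_ : mkset _ = ~` setT); first by apply: (F_setC HX) => //; exact: (F_setT HX).
  apply/seteqP; split => w' //= ti; exfalso; move/negP: ndv; apply.
  by rewrite -ti /t dvdn_mull.
have := supersolution_ge HE HX (cq l) qC bGw (fun x => expR_ge0 _) d0 bW _ mB
  (nsol_supersolution sw) ttN Ftt x.
have GW y : expR (Mop w y) <= expR (w y) by rewrite ler_expR; exact: (nsol_Mop_le sw).
move=> /(_ GW) sup_le.
have mI n : measurable (inB X (dl k) B n).
  by apply: (F_measurable HX (id0 n)); exact: (F_inB HX d0 mB (leqnSn n)).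
have mtau i : measurable [set w' | tau w' = i].
  apply: (F_measurable HX _ (Ft i)); by rewrite mulr_ge0.
have mt i : measurable [set w' | t w' = i] := F_measurable HX (id0 i) (Ftt i).
have mIC : measurable (~` inB X (dl k) B N) by exact: measurableC.
pose H w' : R := \1_(inB X (dl k) B (t w')) w' *
  (Zexp X (qf l) ((t w')%:R * dl k) w' * expR (Mop w (X ((t w')%:R * dl k) w'))).
have bH : bm H.
  apply: (bm_tau (a := fun i w' => \1_(inB X (dl k) B i) w' *
    (Zexp X (qf l) (i%:R * dl k) w' * expR (Mop w (X (i%:R * dl k) w')))) ttN mt) => i.
  apply: bmM; first exact: bm_indic.
  exact: (bm_ZX HE HX (cq l) qC (id0 i) bGw).
rewrite -Ex_indic// -ExZ; last exact: bm_indic.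
apply: (@le_trans _ _ (Ex P x (fun w' => expR (e + a * T) * H w' +
    expR (Cq * T) * \1_(~` inB X (dl k) B N) w'))); last first.
  rewrite ExD ?ExZ ?lerD2r//.
  - by apply: ler_wpM2l; [exact: expR_ge0|exact: sup_le].
  - exact: bm_indic.
  - exact: bmZ.
  - by apply: bmZ; exact: bm_indic.
apply: Ex_le.
- apply: (bm_tau (a := fun i w' => Zexp X (qf lam0) (i%:R * dl k0) w' *
    expR (g (X (i%:R * dl k0) w'))) tN mtau) => i.
  by apply: (bm_ZX HE HX (cq lam0) qC0 _ bG); rewrite mulr_ge0.
- by apply: bmD; apply: bmZ => //; exact: bm_indic.
move=> w'; set s := (tau w')%:R * dl k0.
have s0 : 0 <= s by rewrite mulr_ge0.
have sT : s <= T by rewrite ler_wpM2r// ler_nat.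
rewrite /H tE -/s.
have [wI|wI] := pselect (inB X (dl k) B N w'); last first.
  rewrite (_ : \1_(~` inB X (dl k) B N) w' = 1); last by rewrite indicE mem_set.
  rewrite mulr1.
  rewrite -[leLHS]add0r; apply: lerD.
    by rewrite mulr_ge0 ?expR_ge0// mulr_ge0 ?indicE// mulr_ge0 ?expR_ge0.
  by apply: (ZG_le HE HX (cq lam0) qC0 (fun x => expR_ge0 _) _ w' s0 sT) => y;
    rewrite -expR0 ler_expR.
rewrite (_ : \1_(~` inB X (dl k) B N) w' = 0); last first.
  by rewrite indicE memNset// => /(_ wI).
rewrite mulr0 addr0 indicE mem_set ?mul1r; last first.
  by move=> j jt; apply: wI; exact: leq_trans jt (ttN w').
rewrite !(Zexp_qf HE HX cf fC)// expRD.
have -> : expR e * expR (a * T) * (expR (- (l * s)) * Zexp X f s w' * expR (Mop w (X s w'))) =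
   (expR (a * T) * expR (- (l * s))) * Zexp X f s w' * (expR e * expR (Mop w (X s w'))) by ring.
have h1 : expR (- (lam0 * s)) <= expR (a * T) * expR (- (l * s)).
  rewrite -expRD ler_expR; have : (l - lam0) * s <= a * s by rewrite ler_wpM2r.
  by have : a * s <= a * T by [rewrite ler_wpM2l]; rewrite mulrBl; lra.
have h2 : expR (g (X s w')) <= expR e * expR (Mop w (X s w')).
  by rewrite -expRD ler_expR addrC; exact: gM.
apply: ler_pM; [|exact: expR_ge0| |exact: h2].
  by apply: mulr_ge0; exact: expR_ge0.
by apply: ler_wpM2r; [exact: expR_ge0|exact: h1].
Qed.

End comparison.

End fixed_point.

Theorem theorem5p1 (R : realType) (dE dO : measure_display)
  (E : measurableType dE) (Om : measurableType dO)
  (rho : E -> E -> R) (X : R -> Om -> E) (F : R -> set (set Om))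
  (P : E -> probability Om R)
  (f : E -> R) (c : E -> E -> R) (U : set E) (B : nat -> set E)
  (lam : nat -> nat -> R) (lam0 : R) (rf : \bar R) :
  (* setting *)
  lcs_metric_borel rho ->
  standard_feller_markov X P F rho ->
  rcompact rho U -> U !=set0 ->
  (forall m, rcompact rho (B m)) -> U `<=` B 0%N ->
  (forall m, B m `<=` B m.+1) -> \bigcup_m B m = setT ->
  (* (A1) *)
  rcontinuous rho f -> bnd f -> (forall x, f x <= 0) ->
  (forall x xi (e : R), U xi -> 0 < e -> exists2 eta : R, 0 < eta &
     forall y zeta, U zeta -> rho x y < eta -> rho xi zeta < eta ->
       `|c x xi - c y zeta| < e) ->
  (exists C : R, forall x xi, U xi -> `|c x xi| <= C) ->
  (forall x xi, U xi -> c x xi <= 0) ->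
  (exists2 c0 : R, c0 < 0 & forall x xi eta, U xi -> U eta ->
     c x xi <= c0 /\ c x eta + c eta xi <= c x xi) ->
  (forall e : R, 0 < e -> exists K, rcompact rho K /\
     forall x y xi, ~ K x -> ~ K y -> U xi -> `|c x xi - c y xi| <= e) ->
  (* (A2) *)
  (forall (t : R) (u : nat -> E) x, 0 < t -> rcvg rho u x ->
     forall e : R, 0 < e -> exists N, forall n, (N <= n)%N ->
       forall A, measurable A -> `|Ptr X P t (u n) A - Ptr X P t x A| <= e) ->
  (* (A3) *)
  (forall G (t0 r0 : R), rcompact rho G -> 0 < t0 -> 0 < r0 ->
     (forall e : R, 0 < e -> exists r1 : R, forall r, r1 <= r ->
        `|MGamma X P rho G t0 r| <= e) /\
     (forall e : R, 0 < e -> exists2 eta : R, 0 < eta & forall t, 0 < t -> t < eta ->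
        `|MGamma X P rho G t r0| <= e)) ->
  (* (A4) *)
  (forall m x (delta : R) O, B m x -> 0 < delta -> ropen rho O -> O !=set0 ->
     O `<=` B m ->
     P x (\bigcup_(i in [set i : nat | (0 < i)%N]) [set w | O (X (i%:R * delta) w)])
       = 1%E) ->
  (forall x (delta : R) m, 0 < delta ->
     P x [set w | exists k : nat, ~ B m (X (k%:R * delta) w)] = 1%E) ->
  (* lam m k = lambda^m_{delta_k}, delta_k = 2^-k: the constant of a solution of (OS) *)
  (forall m k, exists w, OS X P rho f c U (B m) (2 ^+ k)^-1 (lam m k) w) ->
  (* lambda = liminf_k lim_m lambda^m_{delta_k} *)
  limn_einf (fun k => limn (fun m => (lam m k)%:E)) = lam0%:E ->
  (* rf = r(f) *)
  ((rf_approx X P f t)%:E @[t --> +oo] --> rf) ->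
  (rf < lam0%:E)%E ->
  exists w : E -> R,
    [/\ rcontinuous rho w, bnd w &
        forall x, (w x)%:E =
          ereal_sup [set (stop_value X P f c U lam0 w x tau)%:E | tau in Txb P F x]].
Proof.
move=> HE HX cU U0 cB UB0 BS Bu cf [Cf fC] _ c_cont [Cc cC] c_le0 [c0 c00 c_tri] c_tail
  HA2 HA3 _ _ HOS hlam hrf rfl.
have c_le x xi : U xi -> c x xi <= c0 by move=> Uxi; have [] := c_tri x xi xi Uxi Uxi.
have UB m : U `<=` B m by elim: m => [//|m ih]; exact: subset_trans (BS m).
have dp k : 0 < dl k :> R := dl_gt0 k.
have /choice[w sw] : forall i : nat * nat, exists w,
    nsol X P f c U (B i.2) (dl i.1) (lam i.2 i.1) w.
  move=> i; have [w0 hw0] := HOS i.2 i.1.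
  exact: (OS_nsol HE HX cU U0 cf fC cC c00 c_le c_cont (cB _) (UB _) (ltW (dp _)) hw0).
have lamS m k : lam m k <= lam m.+1 k.
  exact: (nsol_compare HE HX U0 cf fC cC c00 c_le (dp k) (UB m) (BS m)
    (sw (k, m)) (sw (k, m.+1))).
have [UU [UF [UUlam UUphi]]] := liminf_ultrafilter (liminf_lim_frequently lamS hlam).
have MwC i x : - Cc <= Mop c U (w i) x <= 0 := nsol_Mop_bound U0 cC c00 c_le (sw i) x.
have wU i xi : U xi -> - Cc <= w i xi <= 0.
  by move=> Uxi; rewrite (nsol_ge U0 cC c00 c_le (sw i)) (nsol_U_le0 (sw i)).
have [g hg] := Mop_ultra_lim (lcs_metric HE) U0 c_le0 c_cont c_tail cU wU MwC.
have gC x : - Cc <= g x <= 0.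
  have gz z : 0 < z -> - Cc - z <= g x <= z.
    move=> z0; have [i /= /(_ x)] := filter_ex (hg z z0).
    have /andP[? ?] := MwC i x; rewrite ler_norml => /andP[? ?]; apply/andP; split; lra.
  apply/andP; split; apply/ler_addgt0Pr => z z0; have /andP[? ?] := gz z z0; lra.
have g0 x : g x <= 0 by have /andP[] := gC x.
have cg : rcontinuous rho g.
  move=> x e e0; have e3 : 0 < e / 3 by rewrite divr_gt0.
  have [i /= hi] := filter_ex (hg _ e3).
  have [r r0 hr] := rcontinuous_Mop (lcs_metric HE) U0 c_le0 c_cont cU
    (nsol_bU (sw i)) x e3.
  exists r => // y /hr; have := hi x; have := hi y.
  rewrite !ler_norml !ltr_norml => /andP[? ?] /andP[? ?] /andP[? ?].
  by apply/andP; split; lra.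
have [mu [mul [M M0 decay]]] := rf_decay HE HX cf fC hrf rfl.
have kap0 := kappa_gt0 mul; have kapE : mu + kappa lam0 mu = lam0 - kappa lam0 mu.
  by rewrite /kappa; lra.
have cq := rcontinuous_qf (rho := rho) cf lam0.
have qC x : `|qf f lam0 x| <= Cq Cf lam0 by apply: qf_Cq => //; rewrite subrr normr0.
have th01 := theta01 mul M0.
have FKth x : FK X P (qf f lam0) M%:R (cst 1) x <= theta lam0 mu M.
  by apply: (FK_decay HE HX cf fC decay) => //; rewrite kapE gerBl ltW.
pose G x := expR (g x).
have bG : bm G := bm_exp_le0 HE cg g0.
have G0 x : 0 <= G x := expR_ge0 _.
have G1 x : G x <= 1 by rewrite -expR0 ler_expR.
have cG : rcontinuous rho G := rcontinuous_expR cg.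
have GC x : expR (- Cc) <= G x by rewrite ler_expR; have /andP[] := gC x.
pose W := Wv X P (qf f lam0) G.
have GW x : G x <= W x := Wv_geG HE HX cq qC bG G0 G1 th01 FKth x.
have WC x : expR (- Cc) <= W x := le_trans (GC x) (GW x).
have W0 x : 0 < W x := lt_le_trans (expR_gt0 _) (WC x).
have WD x : W x <= Vbd (Cq Cf lam0) M (theta lam0 mu M).
  exact: (Wv_le_Vbd HE HX cq qC bG G0 G1 th01 FKth).
have VW k n x : Vn X P (qf f lam0) G (dl k) n x <= W x.
  exact: (Vn_le_Wv HE HX cq qC bG G0 G1 th01 FKth).
pose D := Vbd (Cq Cf lam0) M (theta lam0 mu M).
have [xi0 Uxi0] := U0.
have D0 : 0 < D := lt_le_trans (W0 xi0) (WD xi0).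
pose w0 x := ln (W x).
have ew0 x : expR (w0 x) = W x by rewrite lnK// posrE.
have w0D x : w0 x <= ln D by rewrite ler_ln ?posrE// WD.
have bw0 : bounded_onU U w0 by exists (ln D) => xi _; exact: w0D.
(* The comparison gives [exp (2 * z) * W] and the tail at most [z * W], as [W >= exp (- Cc)]; then
   [1 + z <= exp z] yields [3 * z]. *)
have upper z : 0 < z -> UU [set i | forall y, w i y <= w0 y + 3 * z].
  move=> z0; have zC : 0 < z * expR (- Cc) by rewrite mulr_gt0// expR_gt0.
  have [j Mj hj] := exp_small M (ltW D0) kap0 zC.
  (* The horizon [j] is already fixed, so the tolerance on the constant can be chosen with
     [a * j <= z]. *)
  pose a := z / j.+1%:R; have a0 : 0 < a by rewrite divr_gt0.
  have aj : a * j%:R <= z by rewrite /a mulrAC ler_pdivrMr// ler_wpM2l ?ltW// ltr_nat.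
  (* Besides [a], the entry [1] makes [Cq] a valid bound and [kappa] keeps the decay rate. *)
  have b0 : 0 < Num.min a (Num.min 1 (kappa lam0 mu)) by rewrite !lt_min a0 ltr01.
  apply: filterS (filterI (hg z z0) (UUlam _ b0)) => i [/= hi].
  rewrite !lt_min => /andP[la /andP[l1 lk]] y.
  have ml : mu + kappa lam0 mu <= lam i.2 i.1.
    by rewrite kapE; move: lk; rewrite ltr_norml => /andP[? ?]; lra.
  have la' : lam0 - lam i.2 i.1 <= a.
    by move: la; rewrite ltr_norml => /andP[? ?]; lra.
  have hig x : Mop c U (w i) x <= g x + z.
    by have := hi x; rewrite ler_norml => /andP[? ?]; lra.
  have := nsol_upper HE HX cU U0 cf fC cC c00 c_le c_cont mul M0 decay (sw i) ml
    (ltW l1) (ltW a0) cg g0 y la' hig Mj.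
  rewrite -/D -/G => h; rewrite -ler_expR expRD ew0; apply: (le_trans h).
  apply: (@le_trans _ _ (expR (2 * z) * W y + z * W y)).
    apply: lerD; last by apply: (le_trans hj); apply: ler_wpM2l; [exact: ltW|exact: WC].
    apply: ler_pM; [exact: expR_ge0| | |exact: VW].
      exact: (Vn_ge0 X P (qf f lam0) G0).
    by rewrite ler_expR; lra.
  have e2 : 1 <= expR (2 * z) by rewrite -[leLHS]expR0 ler_expR; lra.
  apply: (@le_trans _ _ (expR (2 * z) * (W y * (1 + z)))).
    rewrite mulrDr mulr1 mulrDr lerD2l [z * _]mulrC ler_peMl//.
    by rewrite mulr_ge0// ltW.
  have -> : 3 * z = 2 * z + z by lra.
  rewrite expRD mulrCA; apply: ler_wpM2l; first exact: ltW.
  by apply: ler_wpM2l; [exact: expR_ge0|exact: expR_ge1Dx].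
(* [W xi] is tested one grid value at a time: such a value is almost below [exp (w_i xi)], and
   [w_i xi <= Mop (w_i) x - c x xi], which is close to [g x - c x xi]. *)
have lower x xi : U xi -> c x xi + w0 xi <= g x.
  move=> Uxi; suff : W xi <= expR (g x - c x xi).
    by rewrite -ew0 ler_expR; lra.
  apply: Wv_le => k0 n0; set V := Vn _ _ _ _ _ _ _; set b := expR _.
  pose T : R := n0%:R * dl k0; have T0 : 0 <= T by rewrite mulr_ge0// ltW.
  have key z : 0 < z -> V <= expR (3 * z) * b + expR (Cq Cf lam0 * T) * z.
    move=> z0; pose a := z / (1 + T); have T1 : 0 < 1 + T by rewrite ltr_pwDl.
    have a0 : 0 < a by rewrite divr_gt0.
    have aT : a * T <= z.
      by rewrite /a mulrAC ler_pdivrMr// ler_wpM2l ?ltW// ltrDr.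
    have b0 : 0 < Num.min a 1 by rewrite lt_min a0 ltr01.
    have mB m := rcompact_measurable HE (cB m).
    (* The exit event involves [n0 * 2 ^ (k - k0)] grid times, so the admissible [m] depends on [k];
       the ultrafilter respects any such choice. *)
    have /choice[phi hphi] : forall k : nat, exists m0, forall m, (m0 <= m)%N ->
        fine (P xi (~` inB X (dl k) (B m) (n0 * 2 ^ (k - k0)))) <= z.
      by move=> k; apply: (inB_vanish HX) => //; exact: ltW.
    have [i [/= hi [/= li [ki mi]]]] := filter_ex (filterI (hg z z0)
      (filterI (UUlam _ b0) (UUphi k0 phi))).
    move: li; rewrite lt_min => /andP[la l1].
    have la' : lam i.2 i.1 - lam0 <= a.
      by move: la; rewrite ltr_norml => /andP[? ?]; lra.
    have hig y : g y <= Mop c U (w i) y + z.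
      by have := hi y; rewrite ler_norml => /andP[? ?]; lra.
    have := nsol_lower HE HX cU U0 cf fC cC c00 c_le c_cont (sw i) (ltW l1) (ltW a0)
      cg g0 n0 xi ki (mB i.2) la' hig.
    move=> h; apply: (le_trans h); apply: lerD.
      rewrite -!expRD ler_expR -/T.
      have := Mop_ge U0 c_le0 x (nsol_bU (sw i)) Uxi.
      by have := hi x; rewrite ler_norml => /andP[? ?]; lra.
    by apply: ler_wpM2l; [exact: expR_ge0|exact: hphi].
  have cz : (fun n : nat => (n.+1%:R^-1 : R)) @ \oo --> (0 : R) by exact: cvg_harmonic.
  have cV : (fun n : nat => expR (3 * n.+1%:R^-1) * b + expR (Cq Cf lam0 * T) * n.+1%:R^-1)
      @ \oo --> b.
    rewrite -[X in _ --> X]addr0 -{2}(mul1r b) -(mulr0 (expR (Cq Cf lam0 * T))).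
    apply: cvgD; last by apply: cvgM; [exact: cvg_cst|exact: cz].
    apply: cvgM; last exact: cvg_cst.
    have e30 : 1 = expR (3 * 0) :> R by rewrite mulr0 expR0.
    rewrite [X in _ --> X]e30.
    apply: (cvg_comp (fun n : nat => 3 * n.+1%:R^-1) expR); last exact: continuous_expR.
    by apply: cvgM; [exact: cvg_cst|exact: cz].
  apply: (closed_cvg _ (@closed_ge _ V) _ _ cV); apply: nearW => n.
  by apply: key; rewrite invr_gt0.
(* Bounding [Mop w0] from above treats one [xi] at a time, so the pointwise estimate is enough; from
   below the near-optimal impulse for [w i] varies with [i], and the estimate uniform on [U] is
   needed. *)
have Mw0 : Mop c U w0 = g.
  apply/funext => x; apply/le_anti/andP; split.
    by apply: (Mop_le U0) => xi Uxi; exact: lower.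
  apply/ler_addgt0Pr => z z0; have z4 : 0 < z / 4 by rewrite divr_gt0.
  have [i [/= hi ui]] := filter_ex (filterI (hg _ z4) (upper _ z4)).
  have : Mop c U (w i) x <= Mop c U w0 x + 3 * (z / 4).
    apply: (Mop_le U0) => xi Uxi; have := Mop_ge U0 c_le0 x bw0 Uxi.
    by have := ui xi; lra.
  by have := hi x; rewrite ler_norml => /andP[? ?]; lra.
have sE x tau : stop_value X P f c U lam0 w0 x tau =
    ln (Ex P x (fun om => Zexp X (qf f lam0) (tau om) om * G (X (tau om) om))).
  by rewrite /stop_value Mw0; congr ln; apply: eq_Ex => om; rewrite expRD.
exists w0; split.
(* [W] is continuous and at least [exp (- Cc)], so [ln] is continuous at its values. *)
- have cW : rcontinuous rho W.
    apply: (rcontinuous_Wv HE HX HA2 _ cq qC cG G0 G1 th01 FKth) => K r cK r0.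
    by have [_] := HA3 K 1 r cK ltr01 r0.
  move=> x e e0.
  have /cvgrPdist_lt/(_ e e0) : ln y @[y --> W x] --> ln (W x) by exact: continuous_ln.
  move=> /nbhs_ballP[r r0 h]; have [s s0 hs] := cW x r r0; exists s => // y /hs xy.
  by apply: h; rewrite /ball/=.
- exists (Num.max `|ln D| Cc) => x; rewrite ler_norml; apply/andP; split.
    rewrite lerNl le_max; apply/orP; right; rewrite lerNl.
    by rewrite -ler_expR ew0.
  by rewrite le_max (le_trans (w0D x))// ler_norm.
move=> x; apply/le_anti/andP; split; last first.
  apply: ge_ereal_sup => _ [tau tx <-]; rewrite lee_fin sE.
  have /andP[h1 h2] := stop_le HE HX cq qC bG G0 G1 th01 FKth cG (expR_gt0 _) GC tx.
  by rewrite ler_ln ?posrE.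
set s := ereal_sup _.
(* Each grid value is attained by a bounded stopping time, hence lies below the supremum, and [W] is
   the least upper bound of the grid values. *)
have Vs k n : ((ln (Vn X P (qf f lam0) G (dl k) n x))%:E <= s)%E.
  have [tau tx ->] := Vn_stop HE HX cq qC bG k n x.
  by apply: ereal_sup_ubound; exists tau => //; rewrite sE.
case: s Vs => [r| |] Vs; last 2 first.
- exact: leey.
- by have := Vs 0%N 0%N.
rewrite lee_fin -ler_expR ew0; apply: Wv_le => k n.
have V0 : 0 < Vn X P (qf f lam0) G (dl k) n x.
  exact: lt_le_trans (expR_gt0 (g x)) (@Vn_geG _ _ _ _ _ X P (qf f lam0) G (dl k) n x).
by have := Vs k n; rewrite lee_fin => h; rewrite -[leLHS]lnK ?posrE// ler_expR.
Qed.
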